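(* Let $(f,f^c)$ be a Christoffel pair of isothermic surfaces in $\mathbb{R}^n$ on a simply connected surface $M$ with base-point $o$, and let $p_{\alpha,L}$ be a simple factor. Then the dressing action of $p_{\alpha,L}$ on $(f,f^c)$ is by the Darboux transform $\mathcal{D}^v_{\alpha^2}$, where $v\in\mathbb{R}^n$ is such that $L$ is the (complexified) null line corresponding to $h=\alpha(v-f(o))$, i.e. $L=\mathbb{C}\,(h+v_0+(h,h)v_\infty)$. Explicitly, where defined, $$p_{\alpha,L}\#\begin{pmatrix}0&f\\ f^c&0\end{pmatrix}=\begin{pmatrix}0&f+g\\ f^c+(\alpha^2g)^{-1}&0\end{pmatrix},$$ where $g:M\to\mathbb{R}^n$ solves $dg=\alpha^2\,g\,df^c\,g-df$ with $g(o)=v-f(o)$ (so that $f+g=\mathcal{D}^v_{\alpha^2}f$ and $f^c+(\alpha^2g)^{-1}=\mathcal{D}_{\alpha^2}f^c$).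
   Context: Clifford algebra: $C\ell_n$ is the Clifford algebra of Euclidean $\mathbb{R}^n$ with $vw+wv=-2(v,w)1$; for $C\ell_n$-valued 1-forms, $(\alpha\wedge\beta)(X,Y)=\alpha(X)\beta(Y)-\alpha(Y)\beta(X)$. A Christoffel pair is a pair $f,f^c:M\to\mathbb{R}^n$, $f$ an immersion of a surface, $f^c$ non-constant, with $df\wedge df^c=0$. $\mathcal{D}^v_rf=f+g$ where $dg=r\,g\,df^c\,g-df$, $g(o)=v-f(o)$; and $\mathcal{D}_rf^c=f^c+k$ where $dk=r\,k\,df\,k-df^c$. Lorentz space: $\mathbb{R}^{n+1,1}=\left\{\begin{pmatrix}x&\mu\\ \nu&-x\end{pmatrix}:x\in\mathbb{R}^n,\mu,\nu\in\mathbb{R}\right\}$ (2×2 matrices over $C\ell_n$) with $w^2=-(w,w)I$; $\mathbb{R}^n$ is the diagonal part, $\mathbb{R}^{1,1}$ the off-diagonal part, $v_0=\begin{pmatrix}0&0\\ 1&0\end{pmatrix}$, $v_\infty=\begin{pmatrix}0&1\\ 0&0\end{pmatrix}$. The Lie algebra $\mathfrak{o}(n+1,1)$ is identified with matrices $\begin{pmatrix}\xi&x\\ y&-\xi^t\end{pmatrix}$ ($x,y\in\mathbb{R}^n$, $\xi\in[\mathbb{R}^n,\mathbb{R}^n]\oplus\mathbb{R}$, $t$ the anti-involution fixing vectors) acting on $\mathbb{R}^{n+1,1}$ by commutator. $\mathfrak{p}$ denotes the off-diagonal matrices. $\rho$ is the reflection of $\mathbb{R}^{n+1,1}$ which is $+1$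 on $\mathbb{R}^n$ and $-1$ on $\mathbb{R}^{1,1}$, $\tau$ is conjugation by $\rho$, and everything is extended complex-linearly to $\mathbb{C}^{n+2}=(\mathbb{R}^{n+1,1})^{\mathbb{C}}$, $O(n+2,\mathbb{C})$; $g\mapsto\bar g$ is complex conjugation on $O(n+2,\mathbb{C})$ with respect to $\mathbb{R}^{n+1,1}$. Loop groups: $\mathcal{G}^+$ is the group of holomorphic maps $g:\mathbb{C}\to O(n+2,\mathbb{C})$ with $g(0)=1$, $\tau g(\lambda)=g(-\lambda)$, $\overline{g(\lambda)}=g(\bar\lambda)$. $\mathcal{G}^-_*$ is the group of rational maps $g$ from $\mathbb{P}^1$ to $O(n+2,\mathbb{C})$, holomorphic near $\infty$, with $g(0)=1$ and the same two symmetry conditions. If for $g_\pm\in\mathcal{G}^{\pm}$ (with $g_-\in\mathcal{G}^-_*$) there is a factorisation $g_-g_+=\hat g_+\hat g_-$ with $\hat g_+\in\mathcal{G}^+$, $\hat g_-\in\mathcal{G}^-_*$ (necessarily unique), set $g_-\#g_+=\hat g_+$. Dressing: given $\psi=\begin{pmatrix}0&f\\ f^c&0\end{pmatrix}:M\to\mathfrak{p}$, let $\Phi:M\to\mathcal{G}^+$ be the unique solution of $\Phi^{-1}d\Phi=\lambda\,d\psi$, $\Phi(o)=1$. For $g_-\in\mathcal{G}^-_*$ define, at points where $g_-\#\Phi$ (pointwise) is defined, $g_-\#\psi=\psi(o)+\frac{\partial}{\partial\lambda}\big|_{\lambda=0}(g_-\#\Phi)-\frac{\partial}{\partial\lambda}\big|_{\lambda=0}g_-$,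 a $\mathfrak{p}$-valued map. Simple factors: let $\alpha\in\mathbb{C}^\times$ with $\alpha^2\in\mathbb{R}$, and let $L\subset\mathbb{C}^{n+2}$ be the complexification of a light-line $\ell$ with $\rho\ell\ne\ell$, where $\ell\subset\mathbb{R}^{n+1,1}$ if $\alpha^2>0$ and $\ell\subset\mathbb{R}^n\oplus\sqrt{-1}\,\mathbb{R}^{1,1}$ if $\alpha^2<0$. Then $p_{\alpha,L}(\lambda)=\frac{\alpha-\lambda}{\alpha+\lambda}\pi_++\pi_0+\frac{\alpha+\lambda}{\alpha-\lambda}\pi_-$, where $\pi_+,\pi_0,\pi_-$ are the projections for the decomposition $\mathbb{C}^{n+2}=L\oplus(L\oplus\rho L)^\perp\oplus\rho L$. The statement holds on the (connected component containing $o$ of the) set where $p_{\alpha,L}\#\Phi$ is defined. *)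

(* Defs.v *)
From HB Require Import structures.
From mathcomp Require Import all_boot all_order all_algebra all_field.
From mathcomp Require Import ring.

Set Implicit Arguments.
Unset Strict Implicit.
Unset Printing Implicit Defensive.

Import Order.TTheory GRing.Theory Num.Theory.

Local Open Scope ring_scope.

(* The algebra with basis e_A, for A a subset of {0, ..., n-1}, where e_A is
   the product of the generators e_i, i in A, in increasing order.  Then
   e_A e_B = clsign A B e_(A + B), with + the symmetric difference: there is
   one sign for each pair (i, j) with i in A, j in B and j < i (transposition)
   or j = i (as e_i ^ 2 = -1).  The real algebra is clifford R n and its
   complexification is clifford R[i] n. *)
Definition clifford (K : fieldType) (n : nat) : Type :=
  {ffun {set 'I_n} -> K^o}.

HB.instance Definition _ (K : fieldType) (n : nat) :=
  Vector.copy (clifford K n) ({ffun {set 'I_n} -> K^o} : vectType K).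

Section CliffordAlgebra.
Context {K : fieldType} {n : nat}.
Implicit Types (A B C D : {set 'I_n}) (a b c : clifford K n).

Definition symdiff A B : {set 'I_n} := (A :\: B) :|: (B :\: A).

Definition clsign A B : K := \prod_(i in A) \prod_(j in B | (j <= i)%N) (-1).

Definition clbase A : clifford K n := [ffun B => (B == A)%:R].

Definition clmul a b : clifford K n :=
  [ffun C => \sum_(A : {set 'I_n})
     clsign A (symdiff A C) * (a A : K) * (b (symdiff A C) : K)].

Lemma in_symdiff A B i : (i \in symdiff A B) = (i \in A) (+) (i \in B).
Proof. by rewrite !inE; case: (i \in A); case: (i \in B). Qed.

Lemma symdiffA A B C : symdiff A (symdiff B C) = symdiff (symdiff A B) C.
Proof. by apply/setP => i; rewrite !in_symdiff addbA. Qed.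

Lemma symdiffC A B : symdiff A B = symdiff B A.
Proof. by apply/setP => i; rewrite !in_symdiff addbC. Qed.

Lemma symdiffK A B : symdiff A (symdiff A B) = B.
Proof. by apply/setP => i; rewrite !in_symdiff addKb. Qed.

Lemma symdiffv A : symdiff A A = set0.
Proof. by apply/setP => i; rewrite in_symdiff addbb inE. Qed.

Lemma symdiff0 A : symdiff A set0 = A.
Proof. by apply/setP => i; rewrite in_symdiff inE addbF. Qed.

Lemma symdiff_eq0 A B : (symdiff A B == set0) = (B == A).
Proof.
apply/eqP/eqP => [AB0|->]; last exact: symdiffv.
by rewrite -[LHS](symdiffK A) AB0 symdiff0.
Qed.

Lemma prod_symdiff (P : pred 'I_n) (F : 'I_n -> K) A B :
  (forall i, F i * F i = 1) ->
  \prod_(i in symdiff A B | P i) F i =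
  \prod_(i in A | P i) F i * \prod_(i in B | P i) F i.
Proof.
move=> F2; rewrite big_mkcond [X in _ = X * _]big_mkcond.
rewrite [X in _ = _ * X]big_mkcond -big_split.
apply: eq_bigr => i _ /=; rewrite in_symdiff.
by case: (i \in A); case: (i \in B); case: (P i) => /=;
  rewrite ?mulr1 ?mul1r ?F2.
Qed.

Lemma clsign_row2 B (i : 'I_n) :
  (\prod_(j in B | (j <= i)%N) (-1 : K)) *
  (\prod_(j in B | (j <= i)%N) (-1 : K)) = 1.
Proof. by rewrite -big_split big1 //= => j _; rewrite mulrNN mulr1. Qed.

Lemma clsignDl A B C : clsign (symdiff A B) C = clsign A C * clsign B C.
Proof.
rewrite /clsign; have := @prod_symdiff xpredT
  (fun i => \prod_(j in C | (j <= i)%N) (-1 : K)) A B (clsign_row2 C).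
by rewrite ?(eq_bigl _ _ (fun i => andbT _)); apply.
Qed.

Lemma clsignDr A B C : clsign A (symdiff B C) = clsign A B * clsign A C.
Proof.
rewrite /clsign -big_split; apply: eq_bigr => i _ /=.
by apply: prod_symdiff => j; rewrite mulrNN mulr1.
Qed.

Lemma clsign2 A B : clsign A B * clsign A B = 1.
Proof.
by rewrite /clsign -big_split big1 //= => i _; rewrite clsign_row2.
Qed.

Lemma clsign0l A : clsign set0 A = 1.
Proof. by rewrite /clsign big1 // => i; rewrite inE. Qed.

Lemma clsign0r A : clsign A set0 = 1.
Proof.
by rewrite /clsign big1 // => i _; rewrite big1 // => j; rewrite inE.
Qed.

Lemma clsign_cocycle A B D :
  clsign A (symdiff A B) * clsign B (symdiff B D) =
  clsign A (symdiff A D) * clsign (symdiff A B) (symdiff B D).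
Proof.
rewrite !(clsignDl, clsignDr).
transitivity ((clsign A D * clsign A D) * (clsign A A * clsign A B *
  (clsign B B * clsign B D))); last by ring.
by rewrite clsign2 mul1r.
Qed.

Lemma clmulA : associative clmul.
Proof.
move=> a b c; apply/ffunP => D; rewrite !ffunE; apply/esym.
under eq_bigr => B _ do rewrite ffunE mulr_sumr mulr_suml.
rewrite exchange_big; apply: eq_bigr => A _ /=.
rewrite ffunE mulr_sumr [RHS](reindex_inj (can_inj (symdiffK A))) /=.
apply: eq_bigr => B _.
have -> : symdiff (symdiff A B) (symdiff A D) = symdiff B D.
  by rewrite -symdiffA (symdiffC B) -symdiffA symdiffK symdiffC.
transitivity (clsign A (symdiff A B) * clsign B (symdiff B D) *
  ((a A : K) * (b (symdiff A B) : K) * (c (symdiff B D) : K))); first ring.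
by rewrite clsign_cocycle; ring.
Qed.

Lemma clmul1l : left_id (clbase set0) clmul.
Proof.
move=> a; apply/ffunP => C; rewrite ffunE (bigD1 set0) //= ffunE eqxx.
rewrite clsign0l symdiffC symdiff0 !mul1r big1 ?addr0 // => A /negPf A0.
by rewrite ffunE A0 mulr0 mul0r.
Qed.

Lemma clmul1r : right_id (clbase set0) clmul.
Proof.
move=> a; apply/ffunP => C; rewrite ffunE (bigD1 C) //= ffunE symdiffv eqxx.
rewrite clsign0r mul1r mulr1 big1 ?addr0 // => A AC.
by rewrite ffunE symdiff_eq0 eq_sym (negPf AC) mulr0.
Qed.

Lemma clmulDl : left_distributive clmul +%R.
Proof.
move=> a b c; apply/ffunP => C; rewrite !ffunE -big_split.
by apply: eq_bigr => A _ /=; rewrite ffunE mulrDr mulrDl.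
Qed.

Lemma clmulDr : right_distributive clmul +%R.
Proof.
move=> a b c; apply/ffunP => C; rewrite !ffunE -big_split.
by apply: eq_bigr => A _ /=; rewrite ffunE mulrDr.
Qed.

Lemma clbase0_neq0 : clbase set0 != 0.
Proof.
by apply/eqP => /ffunP /(_ set0); rewrite !ffunE eqxx => /eqP; rewrite oner_eq0.
Qed.

HB.instance Definition _ := GRing.Zmodule_isNzRing.Build (clifford K n)
  clmulA clmul1l clmul1r clmulDl clmulDr clbase0_neq0.

Lemma clscaleAl (k : K) a b : k *: (a * b) = k *: a * b.
Proof.
apply/ffunP => C; rewrite !ffunE scaler_sumr; apply: eq_bigr => A _.
by rewrite ffunE /GRing.scale /=; ring.
Qed.

HB.instance Definition _ := GRing.Lmodule_isLalgebra.Build K (clifford K n)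
  clscaleAl.

Lemma clscaleAr (k : K) a b : k *: (a * b) = a * (k *: b).
Proof.
apply/ffunP => C; rewrite !ffunE scaler_sumr; apply: eq_bigr => A _.
by rewrite ffunE /GRing.scale /=; ring.
Qed.

HB.instance Definition _ := GRing.Lalgebra_isAlgebra.Build K (clifford K n)
  clscaleAr.

(* In particular, x^-1 is the two-sided inverse of each invertible x. *)
HB.instance Definition _ := Algebra_isFalgebra.Build K (clifford K n).

Definition dot (v w : 'cV[K]_n) : K := \sum_i v i 0 * w i 0.

Definition clvec (v : 'cV[K]_n) : clifford K n :=
  \sum_i v i 0 *: clbase [set i].

Lemma clbase1_anti (i j : 'I_n) : clbase [set i] * clbase [set j] +
  clbase [set j] * clbase [set i] = (- (2 * (i == j)%:R)) *: 1.
Proof.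
have clbaseM A B :
    clbase A * clbase B = clsign A B *: clbase (symdiff A B) :> clifford K n.
  apply/ffunP => C; rewrite [LHS]ffunE (bigD1 A) //= big1 => [|D DA].
    rewrite !ffunE eqxx addr0 mulr1 /GRing.scale /=.
    case: (eqVneq C (symdiff A B)) => [->|CAB].
      by rewrite symdiffK eqxx.
    rewrite (_ : (_ == B) = false) ?mulr0 //; apply/negP => /eqP AC.
    by move: CAB; rewrite -AC symdiffK eqxx.
  by rewrite !ffunE (negPf DA) mulr0 mul0r.
have sign1 (k l : 'I_n) : clsign [set k] [set l] = (-1) ^+ (l <= k)%N.
  rewrite /clsign big_set1 big_mkcondr big_set1.
  by case: (l <= k)%N; rewrite ?expr1 ?expr0.
rewrite !clbaseM !sign1 (symdiffC [set j]) -scalerDl.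
case: (eqVneq i j) => [<-|ij].
  by rewrite symdiffv leqnn expr1 mulr1 -opprD.
rewrite mulr0 oppr0 scale0r; move: ij; rewrite -val_eqE /= neq_ltn.
by move=> /orP[] ltij; rewrite (ltnW ltij) (leqNgt _ _) ltij /= expr1 expr0
  ?subrr ?addNr scale0r.
Qed.

Lemma clvec_anticomm (v w : 'cV[K]_n) :
  clvec v * clvec w + clvec w * clvec v = (- (2 * dot v w)) *: 1.
Proof.
rewrite /clvec /dot !mulr_suml.
under eq_bigr => i _ do rewrite mulr_sumr.
under [X in _ + X]eq_bigr => i _ do rewrite mulr_sumr.
rewrite [X in _ + X]exchange_big -big_split mulr_sumr -sumrN scaler_suml /=.
apply: eq_bigr => i _; rewrite -big_split /=.
transitivity (\sum_(j < n) (v i 0 * w j 0) *: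
    ((- (2 * (i == j)%:R)) *: (1 : clifford K n))).
  apply: eq_bigr => j _; rewrite -clbase1_anti scalerDr.
  by rewrite -!scalerAl -!scalerAr !scalerA [w j 0 * _]mulrC.
rewrite (bigD1 i) //= big1 ?addr0 => [|j ji].
  by rewrite eqxx scalerA mulr1 mulrN mulrC.
by rewrite eq_sym (negPf ji) mulr0 oppr0 scale0r scaler0.
Qed.

End CliffordAlgebra.

From mathcomp Require Import all_classical all_reals all_analysis.
From mathcomp Require Import complex.

Import numFieldNormedType.Exports.

Local Open Scope classical_set_scope.
Local Open Scope complex_scope.
Local Open Scope ring_scope.

Definition mx2 (A : Type) (a b c d : A) : 'M[A]_2 :=
  \matrix_(i < 2, j < 2)
    if i == 0 then (if j == 0 then a else b) else (if j == 0 then c else d).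

Section Lorentz.
Context {K : fieldType} {n : nat}.
Implicit Types (x : 'cV[K]_n) (mu nu : K) (w : 'cV[K]_(n + 2)).

(* The vector with Clifford matrix (x, mu; nu, -x) is stored as the column
   (x, mu, nu). *)
Definition lvec x mu nu : 'cV[K]_(n + 2) :=
  col_mx x (\col_(i < 2) if i == 0 then mu else nu).

Definition lpart w : 'cV[K]_n := usubmx w.
Definition lmu w : K := dsubmx w 0 0.
Definition lnu w : K := dsubmx w 1 0.

Definition lmx w : 'M[clifford K n]_2 :=
  mx2 (clvec (lpart w)) (lmu w)%:A (lnu w)%:A (- clvec (lpart w)).

Definition lform w w' : K :=
  dot (lpart w) (lpart w') - (lmu w * lnu w' + lnu w * lmu w') / 2.

Definition lv0 : 'cV[K]_(n + 2) := lvec 0 0 1.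
Definition lvinf : 'cV[K]_(n + 2) := lvec 0 1 0.

Definition rho : 'M[K]_(n + 2) := block_mx 1%:M 0 0 (- 1%:M).

Definition orthogonal_mx (A : 'M[K]_(n + 2)) : Prop :=
  forall w w', lform (A *m w) (A *m w') = lform w w'.

Definition offdiag (a b : clifford K n) : 'M[clifford K n]_2 := mx2 0 a b 0.

(* A is the endomorphism by which X acts as the commutator. *)
Definition acts_as (X : 'M[clifford K n]_2) (A : 'M[K]_(n + 2)) : Prop :=
  forall w, lmx (A *m w) = X *m lmx w - lmx w *m X.

Lemma lmx_sq w : (2 : K) != 0 ->
  lmx w *m lmx w = ((- lform w w)%:A)%:M.
Proof.
move=> two0.
have vv : clvec (lpart w) * clvec (lpart w) = (- dot (lpart w) (lpart w))%:A.
  have := clvec_anticomm (lpart w) (lpart w).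
  rewrite -mulr2n -scaler_nat -mulrN -scalerA.
  exact: (scalerI two0).
have -> : lform w w = dot (lpart w) (lpart w) - lmu w * lnu w.
  by rewrite /lform [lnu w * _]mulrC -mulr2n -[_ * _ *+ 2]mulr_natr mulfK.
apply/matrixP => i j; rewrite !mxE !big_ord_recl big_ord0 !mxE /= addr0.
case: i => [[|[|//]] ?]; case: j => [[|[|//]] ?]; rewrite /= ?mulr1n ?mulr0n
  ?mulrNN ?vv -?scalerAl -?scalerAr ?mulr1 ?mul1r ?mulrN ?scalerN ?subrr
  ?addNr ?scaler0 //.
- by rewrite scalerA -scalerDl opprB addrC.
- by rewrite scalerA -scalerDl opprB [lnu w * _]mulrC.
Qed.

End Lorentz.

Arguments lvinf {K n}.
Arguments lv0 {K n}.
Arguments rho {K n}.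

Section Loops.
Context {R : realType} {n : nat}.
Local Notation C := R[i].
Local Notation loop := (C -> 'M[C]_(n + 2)).

Definition cvec {m : nat} (v : 'cV[R]_m) : 'cV[C]_m :=
  map_mx (real_complex R) v.

Definition conj_mx (A : 'M[C]_(n + 2)) : 'M[C]_(n + 2) :=
  map_mx (fun z : C => Num.conj z) A.

Definition holomorphic (g : loop) : Prop :=
  forall i j z, derivable (fun t : C^o => g t i j : C^o) z 1.

Definition Gplus (g : loop) : Prop :=
  [/\ holomorphic g, forall z, orthogonal_mx (g z), g 0 = 1%:M,
      forall z, rho *m g z *m rho = g (- z) &
      forall z, conj_mx (g z) = g (Num.conj z)].

(* A rational map is a function on C, of which only the values away from the
   zeros of a common denominator q of its entries matter.  As q 0 <> 0, the
   value at 0 matters; the bound on the sizes means that the map is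
   holomorphic at infinity. *)
Definition Gminus (g : loop) : Prop :=
  exists (P : 'M[{poly C}]_(n + 2)) (q : {poly C}),
    [/\ q.[0] != 0, (forall i j, (size (P i j) <= size q)%N),
        forall z, q.[z] != 0 -> g z = \matrix_(i, j) ((P i j).[z] / q.[z]) &
        [/\ forall z, q.[z] != 0 -> orthogonal_mx (g z),
            g 0 = 1%:M,
            forall z, q.[z] != 0 -> q.[- z] != 0 ->
              rho *m g z *m rho = g (- z) &
            forall z, q.[z] != 0 -> q.[Num.conj z] != 0 ->
              conj_mx (g z) = g (Num.conj z)]].

(* gm # gp = hp; the factorisation is an equality of meromorphic maps. *)
Definition sharp (gm gp hp : loop) : Prop :=
  Gplus hp /\ exists2 hm, Gminus hm &
    finite_set [set z | gm z *m gp z <> hp z *m hm z].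

Definition deriv0 (g : loop) : 'M[C]_(n + 2) :=
  \matrix_(i, j) derive1 (fun z : C => g z i j : C^o) 0.

(* For r = alpha ^ 2, the line spanned over R by l is a light-line in
   R^(n+1,1) if r > 0, in R^n + i R^(1,1) if r < 0, and is not rho-stable. *)
Definition lightline (r : R) (l : 'cV[C]_(n + 2)) : Prop :=
  [/\ l != 0, lform l l = 0,
      0 < r -> exists w : 'cV[R]_(n + 2), l = cvec w,
      r < 0 -> exists (x : 'cV[R]_n) (mu nu : R),
        l = lvec (cvec x) ('i * mu%:C) ('i * nu%:C) &
      forall t : R, rho *m l <> t%:C *: l].

(* pip, pi0 and pim are the projections for the decomposition
   L + (L + rho L)^perp + rho L. *)
Definition projections (L : {vspace 'cV[C]_(n + 2)})
    (pip pi0 pim : 'M[C]_(n + 2)) : Prop :=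
  forall w, [/\ pip *m w \in L,
    forall u, u \in L ->
      lform (pi0 *m w) u = 0 /\ lform (pi0 *m w) (rho *m u) = 0,
    exists2 u, u \in L & pim *m w = rho *m u &
    w = pip *m w + pi0 *m w + pim *m w].

Definition simple_factor (alpha : C) (r : R) (L : {vspace 'cV[C]_(n + 2)})
    (p : loop) : Prop :=
  [/\ alpha != 0, alpha ^+ 2 = r%:C,
      exists2 l, lightline r l & L = <[l]>%VS &
      exists pip pi0 pim, projections L pip pi0 pim /\
        p = fun z => ((alpha - z) / (alpha + z)) *: pip + pi0 +
                     ((alpha + z) / (alpha - z)) *: pim].

Definition null_line (h : 'cV[C]_n) : {vspace 'cV[C]_(n + 2)} :=
  <[lvec h 0 0 + lv0 + dot h h *: lvinf]>%VS.

End Loops.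

Section Smooth.
Context {R : realType}.

Fixpoint Ck (k : nat) (U : set 'rV[R]_2) (F : 'rV[R]_2 -> R) : Prop :=
  if k is k'.+1 then
    (forall u, U u -> differentiable F u) /\
    (forall j : 'I_2, Ck k' U (fun u => 'D_(delta_mx 0 j) F u))
  else forall u, U u -> {for u, continuous F}.

Definition Cinfty (U : set 'rV[R]_2) (F : 'rV[R]_2 -> R) : Prop :=
  forall k, Ck k U F.

End Smooth.

Record chart (R : realType) (M : Type) := Chart {
  cdom : set M;
  cmap : M -> 'rV[R]_2;
  cinv : 'rV[R]_2 -> M }.

Record is_chart (R : realType) (M : topologicalType) (c : chart R M) : Prop := {
  cdom_open : open (cdom c);
  cimg_open : open (cmap c @` cdom c);
  cmapK : forall x, cdom c x -> cinv c (cmap c x) = x;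
  cmap_continuous : {within cdom c, continuous (cmap c)};
  cinv_continuous : {within cmap c @` cdom c, continuous (cinv c)} }.

Record surface (R : realType) := Surface {
  surface_space :> topologicalType;
  atlas : set (chart R surface_space);
  surface_hausdorff : hausdorff_space surface_space;
  surface_countable : @second_countable surface_space;
  atlas_chart : forall c, atlas c -> is_chart c;
  atlas_cover : forall x, exists2 c, atlas c & cdom c x;
  atlas_smooth : forall c d, atlas c -> atlas d -> forall k : 'I_2,
    Cinfty (cmap c @` (cdom c `&` cdom d)) (fun u => cmap d (cinv c u) 0 k) }.

Definition simply_connected (R : realType) (M : topologicalType) : Prop :=
  (forall x y : M, exists gamma : R -> M,
     [/\ {within `[0, 1]%classic, continuous gamma}, gamma 0 = x & gamma 1 = y]) /\
  (forall gamma : R -> M, {within `[0, 1]%classic, continuous gamma} ->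
     gamma 0 = gamma 1 ->
     exists H : R * R -> M,
       [/\ {within `[0, 1]%classic `*` `[0, 1]%classic, continuous H},
           forall t : R, 0 <= t <= 1 -> H (0, t) = gamma t,
           forall t : R, 0 <= t <= 1 -> H (1, t) = gamma 0 &
           forall s : R, 0 <= s <= 1 -> H (s, 0) = gamma 0 /\ H (s, 1) = gamma 0]).

Section Calculus.
Context {R : realType} {M : surface R}.

Definition smooth_on (U : set M) (F : M -> R) : Prop :=
  forall c, atlas c -> Cinfty (cmap c @` (U `&` cdom c)) (F \o cinv c).

(* A 1-form is given by its values on the coordinate vector fields of the
   charts: pd c j F x is the value at x of dF on the j-th one of c. *)
Definition pd (c : chart R M) (j : 'I_2) (F : M -> R) (x : M) : R :=
  'D_(delta_mx 0 j) (F \o cinv c) (cmap c x).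

Definition vsmooth_on {n} (U : set M) (F : M -> 'cV[R]_n) : Prop :=
  forall i, smooth_on U (fun x => F x i 0).

Definition vpd {n} (c : chart R M) j (F : M -> 'cV[R]_n) (x : M) : 'cV[R]_n :=
  \col_i pd c j (fun y => F y i 0) x.

Definition mxsmooth_on {n} (U : set M) (F : M -> 'M[R[i]]_n) : Prop :=
  forall i k, smooth_on U (fun x => complex.Re (F x i k)) /\
              smooth_on U (fun x => complex.Im (F x i k)).

Definition mxpd {n} (c : chart R M) j (F : M -> 'M[R[i]]_n) (x : M) :
    'M[R[i]]_n :=
  \matrix_(i, k) (pd c j (fun y => complex.Re (F y i k)) x
                  +i* pd c j (fun y => complex.Im (F y i k)) x).

Definition immersion {n} (f : M -> 'cV[R]_n) : Prop :=
  vsmooth_on setT f /\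
  forall c x, atlas c -> cdom c x ->
    forall a : 'I_2 -> R, \sum_j a j *: vpd c j f x = 0 -> forall j, a j = 0.

Definition christoffel_pair {n} (f fc : M -> 'cV[R]_n) : Prop :=
  [/\ immersion f, vsmooth_on setT fc, (exists x y, fc x <> fc y) &
      forall c x (j k : 'I_2), atlas c -> cdom c x ->
        clvec (vpd c j f x) * clvec (vpd c k fc x) -
        clvec (vpd c k f x) * clvec (vpd c j fc x) = 0].

(* dg = r g dfc g - df on U.  If moreover g o = v - f o, then f + g is the
   Darboux transform of f with parameters r and v. *)
Definition riccati {n} (U : set M) (r : R) (f fc g : M -> 'cV[R]_n) : Prop :=
  vsmooth_on U g /\
  forall c x (j : 'I_2), atlas c -> cdom c x -> U x ->
    clvec (vpd c j g x) =
    r *: (clvec (g x) * clvec (vpd c j fc x) * clvec (g x)) -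
    clvec (vpd c j f x).

Definition psi_mx {n} (a b : 'cV[R]_n) : 'M[clifford R[i] n]_2 :=
  offdiag (clvec (cvec a)) (clvec (cvec b)).

(* Phi^-1 dPhi = lambda dpsi and Phi o = 1, for psi = psi_mx f fc. *)
Definition extended_frame {n} (o : M) (f fc : M -> 'cV[R]_n)
    (Phi : M -> R[i] -> 'M[R[i]]_(n + 2)) : Prop :=
  [/\ forall x, Gplus (Phi x),
      forall z, mxsmooth_on setT (fun x => Phi x z),
      forall z, Phi o z = 1%:M &
      forall z c x (j : 'I_2), atlas c -> cdom c x ->
        acts_as ((z%:A)%:M *m psi_mx (vpd c j f x) (vpd c j fc x))
                (invmx (Phi x z) *m mxpd c j (Phi^~ z) x)].

Definition sharp_domain {n} (gm : R[i] -> 'M[R[i]]_(n + 2))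
    (Phi : M -> R[i] -> 'M[R[i]]_(n + 2)) : set M :=
  [set x | exists hp, sharp gm (Phi x) hp].

(* (gm # psi) x = X, for psi = psi_mx f fc with extended frame Phi. *)
Definition dressing {n} (gm : R[i] -> 'M[R[i]]_(n + 2)) (o : M)
    (f fc : M -> 'cV[R]_n) (Phi : M -> R[i] -> 'M[R[i]]_(n + 2)) (x : M)
    (X : 'M[clifford R[i] n]_2) : Prop :=
  (exists a b : 'cV[R]_n, X = psi_mx a b) /\
  exists2 hp, sharp gm (Phi x) hp &
    acts_as (X - psi_mx (f o) (fc o)) (deriv0 hp - deriv0 gm).

End Calculus.

(* Main.v *)
(* Let l span L.  The line dual to L at x is spanned by Phi(x)^-1 l, at
   lambda = alpha; as the flat connection d + lambda dpsi acts on lines of the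
   form C (h + v_0 + (h, h) v_infty) by a Riccati equation, this line is
   C (alpha g + v_0 + alpha^2 (g, g) v_infty), where g solves the equation of the
   statement.  If lh spans it, then p_l Phi = (p_l Phi p_lh^-1) p_lh, where the
   residues of the first factor at the poles alpha and - alpha vanish, because
   Phi alpha maps lh to l.  Its derivative at 0 is that of p_l, plus that of Phi
   (which is psi - psi o), plus (2 / alpha) (pi_+ - pi_-) for the line of lh, and
   the last term is the action of (0, g; (alpha^2 g)^-1, 0).  Conversely, a
   factorisation exists only where rho does not fix the line, that is, where
   g is finite and nonzero.

   Instead of Cauchy's integral formula, we use that Phi(x), as the solution of a
   linear equation, is a uniform limit of polynomials in lambda on each disc: this
   class of functions is closed under division by lambda - alpha, and its
   members are differentiable. *)

Require Import Defs.
From HB Require Import structures.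
From mathcomp Require Import all_boot all_order all_algebra all_field.
From mathcomp Require Import all_classical all_reals all_analysis.
From mathcomp Require Import complex.
From mathcomp Require cyclic.
From mathcomp Require Import ring lra zify.

Import Order.TTheory GRing.Theory Num.Theory.
Import numFieldNormedType.Exports.

Set Implicit Arguments.
Unset Strict Implicit.
Unset Printing Implicit Defensive.

Local Open Scope classical_set_scope.
Local Open Scope complex_scope.
Local Open Scope ring_scope.

(** * Entire functions as limits of polynomials *)

Section PolynomialApproximation.
Context {R : realType}.
Local Notation C := R[i].
Implicit Types (F G : C -> C) (P Q : {poly C}) (z a : C) (m : nat).

(** The frame is smooth in x for each lambda and holomorphic in lambda for each x, but nothing is
    known about the two variables jointly, so d and the derivative in lambda cannot simply be
    interchanged. Both facts needed about Phi(x), approximation by polynomials and the value of the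
    derivative at 0, are therefore transported along short segments in charts by estimates for the
    linear equation, uniform on a disc in lambda: an Euler scheme yields the polynomials, an
    expansion with error O(lambda^2) the derivative. Connectedness makes this global.

    The two signs of alpha^2 are treated together by the coordinates (y, alpha mu, nu / alpha) with
    y, mu, nu real, in which the form is (y, y) - mu nu. As (y, y) is definite, the line of a
    nonzero null vector is fixed by rho exactly when y = 0. So the dressing is defined on the open
    set y <> 0, where g = y / nu and its dual - y / (r mu) both make sense, and y, mu, nu solve a
    linear system that exchanges f and fc when nu and - r mu are exchanged.

    Identities between loops are checked away from the poles and extended by continuity. *)

Lemma complex_prim_root (n : nat) : (0 < n)%N ->
  exists w : C, n.-primitive_root w.
Proof.
pose p : {poly C} := 'X^n - 1; have [r Dp] := closed_field_poly_normal p.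
move=> n_gt0; rewrite (monicP _) ?monicXnsubC // scale1r in Dp.
have rn1 : all n.-unity_root r by apply/allP=> z; rewrite -root_prod_XsubC -Dp.
have sz_r : (n < (size r).+1)%N.
  by rewrite -(size_prod_XsubC r id) -Dp size_XnsubC.
have [|z] := hasP (cyclic.has_prim_root n_gt0 rn1 _ sz_r); last by exists z.
by rewrite -separable_prod_XsubC -Dp separable_Xn_sub_1 // pnatr_eq0 -lt0n.
Qed.

Lemma sum_prim_root (n : nat) (w : C) (i : nat) :
  n.-primitive_root w -> (0 < i < n)%N -> \sum_(k < n) w ^+ (i * k) = 0.
Proof.
move=> pw /andP[i0 iN].
have w1 : w ^+ i != 1 by rewrite -(prim_order_dvd pw) gtnNdvd.
have : (w ^+ i) ^+ n - 1 = 0 by rewrite exprAC (prim_expr_order pw) expr1n subrr.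
rewrite subrX1 => /eqP; rewrite mulf_eq0 subr_eq0 (negPf w1) /= => /eqP w0.
by rewrite -[RHS]w0; apply: eq_bigr => k _; rewrite exprM.
Qed.

(* The value at z is the mean of the values at the vertices of a regular polygon
   with more vertices than the degree. *)
Lemma poly_mean_value (P : {poly C}) (z s S : C) :
  (forall w, `|w| = 1 -> `|P.[z + s * w]| <= S) -> `|P.[z]| <= S.
Proof.
move=> PS; pose q := P \Po (z%:P + s *: 'X).
have qE w : q.[w] = P.[z + s * w] by rewrite /q horner_comp !hornerE.
pose n := (size q).+1; have [w pw] := @complex_prim_root n isT.
have w1 : `|w| = 1.
  apply/eqP; rewrite -(@pexpr_eq1 _ _ n) ?normr_ge0 //.
  by rewrite -normrX (prim_expr_order pw) normr1.
(* Summation over the vertices annihilates each power with exponent strictly between 0 and [n]; the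
   constant coefficient of [q] is [P.[z]]. *)
have -> : P.[z] = n%:R^-1 * \sum_(k < n) q.[w ^+ k].
  under eq_bigr => k _ do rewrite (@horner_coef_wide _ n _ _ (leqnSn _)).
  rewrite exchange_big /= (big_ord_recl (size q)) /= [X in _ + X]big1 => [|i _]; last first.
    under eq_bigr => k _ do rewrite -exprM mulnC.
    by rewrite -mulr_sumr (sum_prim_root pw) ?mulr0 //= ltnS ltn_ord.
  rewrite addr0; under eq_bigr => k _ do rewrite expr0 mulr1.
  rewrite sumr_const card_ord -[X in _ * X]mulr_natr mulrCA mulVf ?pnatr_eq0 //.
  by rewrite mulr1 -horner_coef0 qE mulr0 addr0.
rewrite normrM normfV normr_nat ler_pdivrMl ?ltr0n //.
apply: (le_trans (ler_norm_sum _ _ _)).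
rewrite mulr_natl (_ : S *+ n = \sum_(k < n) S); last first.
  by rewrite sumr_const card_ord.
by apply: ler_sum => k _; rewrite qE PS // normrX w1 expr1n.
Qed.

(** At distance at least 1 from [a] the difference quotient is bounded directly. If [z] is closer to
    [a], the circle of radius 2 about [z] stays at distance at least 1 from [a], and the mean value
    bound applies; hence the margin 2 in the radius. *)
Lemma poly_quotient_bound (P Q : {poly C}) (a r S : C) :
  P = P.[a]%:P + ('X - a%:P) * Q -> `|a| <= r ->
  (forall z, `|z| <= r + 2 -> `|P.[z]| <= S) ->
  forall z, `|z| <= r -> `|Q.[z]| <= 2 * S.
Proof.
move=> PQ ar PS.
have S0 : 0 <= S by apply: le_trans (PS a _) => //; rewrite (le_trans ar) ?lerDl.
have far z : `|z| <= r + 2 -> 1 <= `|z - a| -> `|Q.[z]| <= 2 * S.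
  move=> zr za.
  have : P.[z] - P.[a] = (z - a) * Q.[z].
    by have := congr1 (horner^~ z) PQ; rewrite /= !hornerE => ->; rewrite addrC addKr.
  move=> /(congr1 Num.norm); rewrite normrM => E.
  apply: (@le_trans _ _ (`|z - a| * `|Q.[z]|)); first by rewrite ler_peMl.
  rewrite -E mulr_natl mulr2n (le_trans (ler_normB _ _)) // lerD // PS //.
  by rewrite (le_trans ar) ?lerDl.
move=> z zr; have [za|za] := real_leP (real1 _) (normr_real (z - a)).
  by apply: far => //; rewrite (le_trans zr) ?lerDl.
apply: (@poly_mean_value _ z 2) => w w1; apply: far.
  by rewrite (le_trans (ler_normD _ _)) // lerD // normrM w1 mulr1 normr_nat.
have -> : z + 2 * w - a = 2 * w + (z - a) by ring.
apply: le_trans (lerB_normD _ _); rewrite normrM w1 normr_nat mulr1.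
by rewrite lerBrDl -lerBrDr (le_trans (ltW za)) // -[2]/(1 + 1) addrK.
Qed.

(** In the order of [C], [0 < e] forces [e] to be real. *)
Definition papprox m F := forall e : C, 0 < e -> exists P : {poly C},
  forall z, `|z| <= m%:R -> `|F z - P.[z]| <= e.

Definition entire F := forall m, papprox m F.

Lemma poly_bounded m P : exists2 K : C, 0 < K &
  forall z, `|z| <= m%:R -> `|P.[z]| <= K.
Proof.
exists (1 + \sum_(i < size P) `|P`_i| * m%:R ^+ i).
  by rewrite ltr_pwDl // sumr_ge0 // => i _; rewrite mulr_ge0 ?exprn_ge0 ?ler0n.
move=> z zm; rewrite horner_coef (le_trans (ler_norm_sum _ _ _)) //.
rewrite ler_wpDl // ler_sum // => i _.
by rewrite normrM normrX ler_wpM2l // lerXn2r // nnegrE ?ler0n.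
Qed.

Lemma papprox_bounded m F : papprox m F -> exists2 K : C, 0 < K &
  forall z, `|z| <= m%:R -> `|F z| <= K.
Proof.
move=> /(_ 1 ltr01)[P FP]; have [K K0 PK] := poly_bounded m P.
exists (1 + K) => [|z zm]; first by rewrite addr_gt0.
rewrite -[F z](subrK P.[z]) (le_trans (ler_normD _ _)) // lerD ?FP ?PK //.
Qed.

Lemma papprox_poly m P : papprox m (fun z => P.[z]).
Proof. by move=> e e0; exists P => z _; rewrite subrr normr0 ltW. Qed.

Lemma papprox_cst m a : papprox m (fun=> a).
Proof. by move=> e e0; exists a%:P => z _; rewrite hornerC subrr normr0 ltW. Qed.

Lemma papproxD m F G : papprox m F -> papprox m G ->
  papprox m (fun z => F z + G z).
Proof.
move=> aF aG e e0; have e20 : 0 < e / 2 by rewrite divr_gt0.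
have [[P FP] [Q GQ]] := (aF _ e20, aG _ e20); exists (P + Q) => z zm.
rewrite hornerD opprD addrACA (le_trans (ler_normD _ _)) //.
by rewrite [leRHS]splitr lerD ?FP ?GQ.
Qed.

Lemma papproxM m F G : papprox m F -> papprox m G ->
  papprox m (fun z => F z * G z).
Proof.
move=> aF aG e e0; have e20 : 0 < e / 2 by rewrite divr_gt0.
have [K K0 FK] := papprox_bounded aF.
have [Q GQ] := aG (e / 2 / K) (divr_gt0 e20 K0).
have [L L0 QL] := poly_bounded m Q.
have [P FP] := aF (e / 2 / L) (divr_gt0 e20 L0).
exists (P * Q) => z zm; rewrite hornerM.
have -> : F z * G z - P.[z] * Q.[z] =
  F z * (G z - Q.[z]) + (F z - P.[z]) * Q.[z] by ring.
rewrite (le_trans (ler_normD _ _)) // [leRHS]splitr !normrM.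
rewrite lerD //.
  apply: (@le_trans _ _ (K * (e / 2 / K))).
    by apply: ler_pM; rewrite ?FK ?GQ.
  by rewrite mulrC divfK ?gt_eqF.
apply: (@le_trans _ _ (e / 2 / L * L)); last by rewrite divfK ?gt_eqF.
by apply: ler_pM; rewrite ?FP ?QL.
Qed.

Lemma papprox_sum m (I : Type) (s : seq I) (p : pred I) (F : I -> C -> C) :
  (forall i, papprox m (F i)) -> papprox m (fun z => \sum_(i <- s | p i) F i z).
Proof.
move=> aF; elim: s => [|i s IH].
  by under eq_fun do rewrite big_nil; exact: papprox_cst.
under eq_fun do rewrite big_cons.
by case: (p i) => //; apply: papproxD.
Qed.

Lemma papprox_oppz m F : papprox m F -> papprox m (fun z => F (- z)).
Proof.
move=> aF e e0; have [P FP] := aF e e0; exists (P \Po (- 'X)) => z zm.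
by rewrite horner_comp !hornerE FP // normrN.
Qed.

Lemma nat_bound (x : R) : exists m, x <= m%:R.
Proof.
by exists (Num.bound `|x|); rewrite (le_trans (ler_norm _)) // ltW // archi_boundP.
Qed.

Lemma norm_nat_bound z : exists m, `|z| <= m%:R.
Proof.
have [m zm] := nat_bound (complex.Re `|z|); exists m.
rewrite -(RRe_real (normr_real z)) -(rmorph_nat (real_complex R)) lecR //.
Qed.

Lemma inv_nat_bound (e : C) : 0 < e -> exists m, m.+1%:R^-1 <= e.
Proof.
move=> e0; have [m em] := norm_nat_bound e^-1; exists m.
rewrite -[e]invrK lef_pV2 ?posrE ?ltr0n ?invr_gt0 //.
rewrite -[e^-1]ger0_norm ?invr_ge0 ?(ltW e0) //.
by rewrite (le_trans em) // ler_nat.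
Qed.

(* The limit is the supremum of the lower bounds u m - d m. *)
Lemma complete_real (u d : nat -> R) :
  (forall i j, `|u i - u j| <= d i + d j) ->
  exists c, forall i, `|u i - c| <= d i.
Proof.
move=> ud; pose A := [set u i - d i | i in setT].
have ubA j : ubound A (u j + d j).
  move=> _ [i _ <-]; have := ud i j; rewrite ler_norml => /andP[_]; lra.
have supA : has_sup A by split; [exists (u 0 - d 0), 0|exists (u 0%N + d 0%N)].
exists (sup A) => i; rewrite ler_norml; apply/andP; split.
  have : sup A <= u i + d i by apply: ge_sup => //; exact: supA.1.
  lra.
have : u i - d i <= sup A by apply: ub_le_sup; [exact: supA.2|exists i].
lra.
Qed.

Lemma complete_complex (u : nat -> C) (d : nat -> R) :
  (forall i j, `|u i - u j| <= (d i + d j)%:C) ->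
  exists c, forall i, `|u i - c| <= (2 * d i)%:C.
Proof.
move=> ud.
have [|x ux] := @complete_real (fun i => complex.Re (u i)) d.
  move=> i j; rewrite -lecR (le_trans _ (ud i j)) //.
  by rewrite (le_trans _ (normc_ge_Re _)) // lecR raddfB.
have [|y uy] := @complete_real (fun i => complex.Im (u i)) d.
  move=> i j; rewrite -lecR (le_trans _ (ud i j)) //.
  rewrite -[leRHS]mul1r -[1](_ : `|'i : C| = 1) -?normrM.
    rewrite (le_trans _ (normc_ge_Re _)) // lecR mulrC ReiNIm normrN raddfB //.
  by rewrite normc_def /= expr0n expr1n add0r sqrtr1.
exists (x +i* y) => i.
have -> : u i - (x +i* y) =
    (complex.Re (u i) - x)%:C + 'i * (complex.Im (u i) - y)%:C.
  by rewrite [LHS]complexE; case: (u i).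
rewrite (le_trans (ler_normD _ _)) // normrM.
have -> : `|'i : C| = 1 by rewrite normc_def /= expr0n expr1n add0r sqrtr1.
have nR (t : R) : `|t%:C| = `|t|%:C.
  by rewrite normc_def /= expr0n addr0 sqrtr_sqr.
by rewrite mul1r !nR -rmorphD lecR mulr_natl mulr2n lerD.
Qed.

(** The approximating polynomials are divided at [a]; by [poly_quotient_bound] their quotients are
    uniformly Cauchy on discs. The limit is the difference quotient of [F] away from [a], and at [a]
    it is supplied by completeness. *)
Lemma entire_division F a : entire F ->
  exists2 G, entire G & forall z, F z = F a + (z - a) * G z.
Proof.
move=> eF; have [m0 am0] := norm_nat_bound a.
pose e m : C := m.+1%:R^-1.
have e_gt0 m : 0 < e m by rewrite invr_gt0 ltr0n.
have e_le i j : (i <= j)%N -> e j <= e i.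
  by move=> ij; rewrite lef_pV2 ?posrE ?ltr0n // ler_nat.
(* The radius contains [a], grows with [m], and leaves the margin 2 that [poly_quotient_bound]
   consumes. *)
have {eF} /choice[P FP] m : exists P, forall z,
    `|z| <= (m0 + m + 2)%:R -> `|F z - P.[z]| <= e m.
  exact: eF.
have /choice[Q PQ] m : exists Q, P m = (P m).[a]%:P + ('X - a%:P) * Q.
  have /factor_theorem[Q QE] : root (P m - (P m).[a]%:P) a.
    by rewrite /root !hornerE subrr.
  by exists Q; rewrite mulrC -QE addrC subrK.
have QQ i j z : (i <= j)%N -> `|z| <= (m0 + i)%:R ->
    `|(Q i).[z] - (Q j).[z]| <= 2 * (e i + e j).
  move=> ij zi; rewrite -hornerN -hornerD.
  apply: (@poly_quotient_bound (P i - P j) _ a (m0 + i)%:R) => //.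
  - rewrite {1}(PQ i) {1}(PQ j) !hornerE mulrBr rmorphB /=; ring.
  - by rewrite (le_trans am0) // ler_nat leq_addr.
  - move=> w wi; rewrite !hornerE distrC.
    rewrite (_ : _ - _ = (F w - (P i).[w]) - (F w - (P j).[w])); last by ring.
    have wi' : `|w| <= (m0 + i + 2)%:R by rewrite natrD.
    rewrite (le_trans (ler_normB _ _)) // lerD ?FP // (le_trans wi') //.
    by rewrite ler_nat !leq_add2r leq_add2l.
pose d m : R := 2 * m.+1%:R^-1.
have dE m : (d m)%:C = 2 * e m.
  by rewrite /d rmorphM fmorphV !rmorph_nat.
have [c Qc] : exists c, forall m, `|(Q m).[a] - c| <= (2 * d m)%:C.
  apply: complete_complex => i j; rewrite rmorphD /= !dE -mulrDr.
  wlog ij : i j / (i <= j)%N.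
    move=> W; case: (leqP i j) => [|/ltnW ji]; first exact: W.
    by rewrite distrC [e i + _]addrC; exact: W.
  by rewrite QQ // (le_trans am0) // ler_nat leq_addr.
pose G z := if z == a then c else (F z - F a) / (z - a).
exists G => [m eps eps0|z]; last first.
  rewrite /G; case: eqVneq => [->|za]; first by rewrite subrr mul0r addr0.
  by rewrite mulrC divfK ?subr_eq0 // addrC subrK.
(* The 6 is the sum of [2 e k], the distance from the difference quotient to [Q j], and of
   [2 (e k + e j)] with [e j <= e k], the distance from [Q j] to [Q k]. *)
have [k0 k0e] := inv_nat_bound (divr_gt0 eps0 (ltr0Sn C 5)).
pose k := maxn k0 m; exists (Q k) => z zm.
have {k0e} ke : 6 * e k <= eps.
  rewrite mulrC -ler_pdivlMr // (le_trans _ k0e) //.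
  by apply: e_le; rewrite leq_maxl.
have zk : `|z| <= (m0 + k)%:R.
  by rewrite (le_trans zm) // ler_nat (leq_trans (leq_maxr k0 m)) ?leq_addl.
apply: le_trans ke; rewrite /G; case: eqVneq => [->|za].
  rewrite distrC (le_trans (Qc _)) // rmorphM rmorph_nat /= dE mulrA.
  by rewrite ler_wpM2r ?(ltW (e_gt0 _)) // -natrM ler_nat.
have za0 : 0 < `|z - a| by rewrite normr_gt0 subr_eq0.
(* The index [j] may depend on [z], since [Q j] and [Q k] are close uniformly in [z]; it is taken so
   large that the division by [z - a] does no harm. *)
have [j0 j0e] := inv_nat_bound (mulr_gt0 (e_gt0 k) za0).
pose j := maxn j0 k.
have kj : (k <= j)%N by rewrite leq_maxr.
have je : e j <= e k * `|z - a|.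
  by apply: le_trans j0e; apply: e_le; rewrite leq_maxl.
have FQ : `|(F z - F a) / (z - a) - (Q j).[z]| <= 2 * e k.
  have -> : (F z - F a) / (z - a) - (Q j).[z] =
      ((F z - (P j).[z]) - (F a - (P j).[a])) / (z - a).
    have -> : (P j).[z] = (P j).[a] + (z - a) * (Q j).[z].
      by rewrite {1}PQ !hornerE.
    by field; rewrite subr_eq0.
  rewrite normf_div ler_pdivrMr // (le_trans (ler_normB _ _)) //.
  rewrite -mulrA (_ : 2 * _ = e k * `|z - a| + e k * `|z - a|); last by ring.
  have kj2 w : `|w| <= (m0 + k)%:R -> `|w| <= (m0 + j + 2)%:R.
    move=> wk; rewrite (le_trans wk) // ler_nat -addnA leq_add2l.
    by rewrite (leq_trans kj) ?leq_addr.
  rewrite lerD // (le_trans (FP _ _ _)) // kj2 // (le_trans am0) //.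
  by rewrite ler_nat leq_addr.
rewrite -(subrK (Q j).[z] ((F z - F a) / _)) -addrA.
rewrite (le_trans (ler_normD _ _)) //.
have -> : 6 * e k = 2 * e k + 2 * (e k + e k) by ring.
rewrite lerD // distrC (le_trans (QQ _ _ _ kj zk)) //.
by rewrite ler_pM2l // lerD2l e_le.
Qed.

Lemma entire_continuous F z : entire F -> {for z, continuous (F : C^o -> C^o)}.
Proof.
move=> eF; have [G eG FG] := entire_division z eF.
have [m zm] := norm_nat_bound z.
have [K K0 GK] := papprox_bounded (eG m.+1).
apply/(@cvgrPdist_le _ C^o _ (nbhs (z : C^o))) => eps eps0.
apply/(@nbhs_normP _ C^o).
have eK : 0 < eps + K by rewrite addr_gt0.
(* This radius is at most 1, which keeps [w] in the disc of radius [m + 1], and its product with [K]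
   is at most [eps]. *)
exists (eps / (eps + K)) => /=; first exact: divr_gt0.
move=> w /= /ltW; rewrite distrC => wz.
rewrite distrC (FG w) [F z + _]addrC addrK normrM.
have GwK : `|G w| <= K.
  apply: GK; rewrite -(subrK z w) (le_trans (ler_normD _ _)) //.
  rewrite -[m.+1]add1n natrD lerD // (le_trans wz) //.
  by rewrite ler_pdivrMr // mul1r lerDl ltW.
apply: (@le_trans _ _ (eps / (eps + K) * K)); first exact: ler_pM.
by rewrite mulrAC ler_pdivrMr // ler_wpM2l ?(ltW eps0) // lerDr ltW.
Qed.

(** The difference quotient at [z] is the function [G] of [entire_division], again entire and hence
    continuous. *)
Lemma entire_derivable F z : entire F -> derivable (F : C^o -> C^o) z 1.
Proof.
move=> eF; have [G eG FG] := entire_division z eF.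
apply/cvg_ex; exists (G z); have /= Gz := @entire_continuous G z eG.
have GS : cvg_to ((fun h : C^o => G (h + z) : C^o) @ 0^') (nbhs (G z : C^o)).
  apply: cvg_within_filter.
  apply: (@cvg_comp C^o C^o C^o (+%R^~ z) G (nbhs (0 : C^o)) (nbhs (z : C^o))).
    rewrite -[X in _ `=>` nbhs X]add0r.
    by apply: (@cvgD _ C^o); [exact: cvg_id|exact: cvg_cst].
  exact: Gz.
apply: cvg_trans GS; apply: near_eq_cvg.
apply/nbhs_normP; exists 1 => //= h _ h0.
by rewrite /= FG [h *: 1]mulr1 addrK [F z + _]addrC addrK /GRing.scale /= mulKf.
Qed.
End PolynomialApproximation.

(** * Linear differential equations *)

Section L1Norm.
Context {R : realType}.
Local Notation C := R[i].

(** Unlike the norm of [C], which is [C]-valued, this one has values in [R]; it suits paths with a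
    real parameter, whose real and imaginary parts are differentiated separately. *)
Definition n1 (z : C) : R := `|complex.Re z| + `|complex.Im z|.

Lemma n1_ge0 z : 0 <= n1 z. Proof. exact: addr_ge0. Qed.

Lemma n1_0 : n1 0 = 0. Proof. by rewrite /n1 /= !normr0 addr0. Qed.

Lemma n1D z w : n1 (z + w) <= n1 z + n1 w.
Proof. by rewrite /n1 !raddfD /= addrACA lerD // ler_normD. Qed.

Lemma n1M z w : n1 (z * w) <= n1 z * n1 w.
Proof.
case: z w => [a b] [c d]; rewrite /n1 /= mulrDl !mulrDr -!normrM.
have := ler_normB (a * c) (b * d); have := ler_normD (a * d) (b * c).
lra.
Qed.

Lemma n1_sum (I : Type) (s : seq I) (F : I -> C) :
  n1 (\sum_(i <- s) F i) <= \sum_(i <- s) n1 (F i).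
Proof.
elim: s => [|i s IH]; first by rewrite !big_nil n1_0.
by rewrite !big_cons (le_trans (n1D _ _)) // lerD2l.
Qed.

Lemma real_norm (t : R) : `|t%:C| = `|t|%:C :> C.
Proof. by rewrite normc_def /= expr0n addr0 sqrtr_sqr. Qed.

Lemma norm_le_n1 z : `|z| <= (n1 z)%:C.
Proof.
rewrite {1}[z]complexE (le_trans (ler_normD _ _)) // normrM.
have -> : `|'i : C| = 1 by rewrite normc_def /= expr0n expr1n add0r sqrtr1.
by rewrite mul1r !real_norm -rmorphD.
Qed.

Lemma n1_le_norm z : (n1 z)%:C <= 2 * `|z|.
Proof.
rewrite /n1 rmorphD mulr_natl mulr2n lerD ?normc_ge_Re //.
have -> : `|z| = `|z * 'i|.
  rewrite normrM (_ : `|'i : C| = 1) ?mulr1 //.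
  by rewrite normc_def /= expr0n expr1n add0r sqrtr1.
by rewrite -normrN -ReiNIm normc_ge_Re.
Qed.

Context {m : nat}.
Implicit Types A B : 'M[C]_m.

Definition mxn1 A : R := \sum_i \sum_j n1 (A i j).

Lemma mxn1_ge0 A : 0 <= mxn1 A.
Proof. by apply: sumr_ge0 => i _; apply: sumr_ge0 => j _; exact: n1_ge0. Qed.

Lemma mxn1_entry A i j : n1 (A i j) <= mxn1 A.
Proof.
rewrite /mxn1 (bigD1 i) //= (bigD1 j) //= -addrA lerDl.
by rewrite addr_ge0 // sumr_ge0 // => *; rewrite ?sumr_ge0 // => *; exact: n1_ge0.
Qed.

Lemma mxn1D A B : mxn1 (A + B) <= mxn1 A + mxn1 B.
Proof.
rewrite /mxn1 -big_split ler_sum // => i _; rewrite -big_split ler_sum // => j _.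
by rewrite mxE n1D.
Qed.

Lemma mxn1Z (a : C) A : mxn1 (a *: A) <= n1 a * mxn1 A.
Proof.
rewrite /mxn1 mulr_sumr ler_sum // => i _; rewrite mulr_sumr ler_sum // => j _.
by rewrite mxE n1M.
Qed.

Lemma mxn1M A B : mxn1 (A *m B) <= mxn1 A * mxn1 B.
Proof.
rewrite /mxn1 mulr_suml ler_sum // => i _.
apply: (@le_trans _ _ (\sum_j \sum_k n1 (A i k) * n1 (B k j))).
  apply: ler_sum => j _; rewrite mxE (le_trans (n1_sum _ _)) //.
  by apply: ler_sum => k _; rewrite n1M.
rewrite exchange_big mulr_suml ler_sum // => k _; rewrite -mulr_sumr.
rewrite ler_wpM2l ?n1_ge0 // [leRHS](bigD1 k) //= lerDl sumr_ge0 // => *.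
by rewrite sumr_ge0 // => *; exact: n1_ge0.
Qed.

Lemma mxn1_le A (K : R) :
  (forall i j, n1 (A i j) <= K) -> mxn1 A <= (m * m)%:R * K.
Proof.
move=> AK; apply: (@le_trans _ _ (\sum_(i < m) \sum_(j < m) K)).
  by apply: ler_sum => i _; apply: ler_sum => j _.
by rewrite !sumr_const !card_ord -mulrnA mulr_natl.
Qed.
End L1Norm.

Section SegmentDerivative.
Context {R : realType}.
Local Notation C := R[i].

Definition cder (h : R -> C) (t : R) (d : C) : Prop :=
  is_derive t 1 (fun s => complex.Re (h s)) (complex.Re d) /\
  is_derive t 1 (fun s => complex.Im (h s)) (complex.Im d).

Lemma cder_cst c t : cder (fun=> c) t 0.
Proof. by split; exact: is_derive_cst. Qed.

Lemma cderD h k t d e : cder h t d -> cder k t e ->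
  cder (fun s => h s + k s) t (d + e).
Proof.
move=> [? ?] [? ?]; split; rewrite raddfD.
  under eq_fun do rewrite raddfD; exact: is_deriveD.
under eq_fun do rewrite raddfD; exact: is_deriveD.
Qed.

Lemma cderZ c h t d : cder h t d -> cder (fun s => c * h s) t (c * d).
Proof.
have ReM (z w : C) : complex.Re (z * w) =
  complex.Re z * complex.Re w - complex.Im z * complex.Im w by case: z w => ? ? [].
have ImM (z w : C) : complex.Im (z * w) =
  complex.Re z * complex.Im w + complex.Im z * complex.Re w by case: z w => ? ? [].
move=> [dr di]; split.
  under eq_fun do rewrite ReM; rewrite ReM.
  by apply: is_deriveB; exact: is_deriveZ.
under eq_fun do rewrite ImM; rewrite ImM.
by apply: is_deriveD; exact: is_deriveZ.
Qed.

Lemma cder_sum (I : Type) (s : seq I) (h : I -> R -> C) t (d : I -> C) :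
  (forall i, cder (h i) t (d i)) ->
  cder (fun x => \sum_(i <- s) h i x) t (\sum_(i <- s) d i).
Proof.
move=> hd; elim: s => [|i s IH].
  under eq_fun do rewrite big_nil; rewrite big_nil; exact: cder_cst.
under eq_fun do rewrite big_cons; rewrite big_cons; exact: cderD.
Qed.

Lemma is_derive_segment_continuous (f : R -> R) (df : R -> R) (a b : R) :
  (forall t, a <= t <= b -> is_derive t 1 f (df t)) ->
  {within `[a, b], continuous f}.
Proof.
move=> fd; apply: derivable_within_continuous => t.
by rewrite in_itv => /fd [].
Qed.

Lemma is_derive_segment_bound (f df : R -> R) (a b K : R) : a <= b ->
  (forall t, a <= t <= b -> is_derive t 1 f (df t)) ->
  (forall t, a <= t <= b -> `|df t| <= K) ->
  `|f b - f a| <= K * (b - a).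
Proof.
move=> ab fd dfK.
have [||t tab ->] := @MVT_segment R f df a b ab.
- move=> t; rewrite in_itv => /andP[/ltW at' /ltW tb]; by apply: fd; rewrite at' tb.
- exact: is_derive_segment_continuous fd.
- rewrite in_itv /= in tab.
  by rewrite normrM [X in _ * X]ger0_norm ?subr_ge0 // ler_wpM2r ?subr_ge0 ?dfK.
Qed.

Context {m : nat}.
Implicit Types H Psi F : R -> 'M[C]_m.

Definition mder H (t : R) (D : 'M[C]_m) : Prop :=
  forall i j, cder (fun s => H s i j) t (D i j).

Lemma mderD H F t D E : mder H t D -> mder F t E ->
  mder (fun s => H s + F s) t (D + E).
Proof.
move=> HD FE i j; rewrite mxE; under eq_fun do rewrite mxE; exact: cderD.
Qed.

Lemma mderMl A H t D : mder H t D -> mder (fun s => A *m H s) t (A *m D).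
Proof.
move=> HD i j; rewrite mxE; under eq_fun do rewrite mxE.
by apply: cder_sum => k; exact: cderZ.
Qed.

(** The constant lost when the mean value inequality is applied to each entry separately: [m * m]
    entries with two real components each. *)
Definition mxdim : R := (m * m)%:R * 2.

Lemma mder_bound H (D : R -> 'M[C]_m) (a b K : R) : a <= b ->
  (forall t, a <= t <= b -> mder H t (D t)) ->
  (forall t, a <= t <= b -> mxn1 (D t) <= K) ->
  mxn1 (H b - H a) <= mxdim * K * (b - a).
Proof.
move=> ab HD DK; rewrite /mxdim -!mulrA; apply: mxn1_le => i j.
rewrite !mxE /n1 !raddfB /= mulr_natl mulr2n.
have bnd t : a <= t <= b -> `|complex.Re (D t i j)| <= K /\
    `|complex.Im (D t i j)| <= K.
  move=> /DK DtK; have := le_trans (mxn1_entry (D t) i j) DtK.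
  rewrite /n1; have := normr_ge0 (complex.Re (D t i j)).
  by have := normr_ge0 (complex.Im (D t i j)); split; lra.
apply: lerD.
  apply: (@is_derive_segment_bound (fun t => complex.Re (H t i j))
    (fun t => complex.Re (D t i j))) => // t tab.
    by have [] := HD t tab i j.
  by have [] := bnd t tab.
apply: (@is_derive_segment_bound (fun t => complex.Im (H t i j))
  (fun t => complex.Im (D t i j))) => // t tab.
  by have [] := HD t tab i j.
by have [] := bnd t tab.
Qed.

Lemma sum_continuous (T : topologicalType) (I : Type) (s : seq I)
    (f : I -> T -> R) :
  (forall i, continuous (f i)) -> continuous (fun t => \sum_(i <- s) f i t).
Proof.
move=> fc; elim: s => [|i s IH].
  by under eq_fun do rewrite big_nil; exact: cst_continuous.
under eq_fun do rewrite big_cons.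
by move=> t; apply: (@continuousD _ R^o); [exact: fc|exact: IH].
Qed.

Lemma mder_mxn1_max H (D : R -> 'M[C]_m) (a b : R) : a <= b ->
  (forall t, a <= t <= b -> mder H t (D t)) ->
  exists2 c, a <= c <= b & forall t, a <= t <= b -> mxn1 (H t) <= mxn1 (H c).
Proof.
move=> ab HD; have [|c cab cmax] := @EVT_max R (fun t => mxn1 (H t)) a b ab.
  apply: (@sum_continuous (subspace `[a, b])) => i.
  apply: (@sum_continuous (subspace `[a, b])) => j x.
  rewrite /n1 /continuous_at; apply: (@cvgD _ R^o).
    apply: (continuous_comp _ (@norm_continuous _ _ _)).
    apply: (@is_derive_segment_continuous _
      (fun t => complex.Re (D t i j)) a b _ x) => t tab.
    by have [] := HD t tab i j.
  apply: (continuous_comp _ (@norm_continuous _ _ _)).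
  apply: (@is_derive_segment_continuous _
    (fun t => complex.Im (D t i j)) a b _ x) => t tab.
  by have [] := HD t tab i j.
by exists c => [|t tab]; [rewrite in_itv in cab|apply: cmax; rewrite in_itv].
Qed.

Section LinearODE.
Variables (F Psi : R -> 'M[C]_m) (B : R -> 'M[C]_m) (z : C) (a b c q : R).
Hypothesis ab : a <= b.
Hypothesis FB : forall t, a <= t <= b -> mder F t (z *: (F t *m B t)).
Hypothesis PsiB : forall t, a <= t <= b -> mder Psi t (B t).
Hypothesis Bc : forall t, a <= t <= b -> mxn1 (B t) <= c.
Hypothesis c0 : 0 <= c.
Hypothesis qE : n1 z * mxdim * c * (b - a) <= q.
Hypothesis q1 : 2 * q <= 1.

Let dim0 : 0 <= mxdim. Proof. by rewrite mulr_ge0. Qed.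

Let rhs_bound (A : 'M[C]_m) t K : a <= t <= b -> mxn1 A <= K ->
  mxn1 (z *: (A *m B t)) <= n1 z * (K * c).
Proof.
move=> tab AK; rewrite (le_trans (mxn1Z _ _)) // ler_wpM2l ?n1_ge0 //.
by rewrite (le_trans (mxn1M _ _)) // ler_pM ?mxn1_ge0 ?Bc.
Qed.

Let q_bound K t : 0 <= K -> a <= t <= b ->
  mxdim * (n1 z * (K * c)) * (t - a) <= q * K.
Proof.
move=> K0 /andP[at' tb]; rewrite (le_trans _ (ler_wpM2r K0 qE)) //.
rewrite [leRHS](_ : _ = mxdim * (n1 z * (K * c)) * (b - a)); last by ring.
by rewrite ler_wpM2l ?lerB // !mulr_ge0 ?n1_ge0.
Qed.

Let sub_bound t K : (forall s, a <= s <= b -> mxn1 (F s) <= K) ->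
  a <= t <= b -> mxn1 (F t - F a) <= q * K.
Proof.
move=> FK tab; have K0 : 0 <= K.
  by apply: le_trans (FK a _); rewrite ?mxn1_ge0 ?lexx ?ab.
apply: le_trans (q_bound K0 tab); case/andP: (tab) => at' tb.
have sub s : a <= s <= t -> a <= s <= b.
  by case/andP=> -> st; rewrite (le_trans st).
apply: (mder_bound at') => s /sub sab; first exact: FB.
by apply: rhs_bound => //; exact: FK.
Qed.

(** Where the norm of [F] is maximal, say at [s], the mean value inequality bounds [F s - F a] by
    [q] times the norm of [F s], and [2 * q <= 1] lets this be absorbed. *)
Lemma ode_bound t : a <= t <= b -> mxn1 (F t) <= 2 * mxn1 (F a).
Proof.
have [s sab smax] := mder_mxn1_max ab FB.
move=> /smax Fts; apply: (le_trans Fts).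
have := sub_bound smax sab; have := mxn1D (F s - F a) (F a).
rewrite subrK; have := mxn1_ge0 (F s); have : 0 <= (1 - 2 * q) * mxn1 (F s).
  by rewrite mulr_ge0 ?mxn1_ge0 ?subr_ge0.
lra.
Qed.

(** The function [F - z F(a) Psi] has derivative [z (F - F(a)) B], in which [F - F(a)] is already of
    order [q]; integration contributes a second factor [q]. *)
Lemma ode_first_order :
  mxn1 (F b - F a *m (1%:M + z *: (Psi b - Psi a))) <= 2 * q ^+ 2 * mxn1 (F a).
Proof.
pose G t := F t + (- (z *: F a)) *m Psi t.
have -> : F b - F a *m (1%:M + z *: (Psi b - Psi a)) = G b - G a.
  rewrite /G mulmxDr mulmx1 -scalemxAr mulmxBr !mulNmx -!scalemxAl scalerBr.
  by rewrite !opprD !opprK !addrA; congr (_ + _); rewrite addrAC.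
have bb : a <= b <= b by rewrite ab lexx.
rewrite [leRHS](_ : _ = q * (q * (2 * mxn1 (F a)))); last by ring.
have q0 : 0 <= q by apply: le_trans qE; rewrite !mulr_ge0 ?n1_ge0 ?subr_ge0.
apply: le_trans (q_bound _ bb); last by rewrite !mulr_ge0 ?mxn1_ge0.
apply: (@mder_bound _ (fun t => z *: ((F t - F a) *m B t)) _ _ _ ab) => t tab.
  rewrite mulmxBl scalerBr /G [X in _ - X]scalemxAl -mulNmx.
  by apply: mderD; [exact: FB|apply: mderMl; exact: PsiB].
by apply: rhs_bound => //; apply: sub_bound => //; exact: ode_bound.
Qed.
End LinearODE.
End SegmentDerivative.

Section QuadraticDerivative.
Context {R : realType}.
Local Notation C := R[i].

Lemma quadratic_is_derive (h : C -> C) (K : C) : 0 < K ->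
  (forall z, `|z| <= 1 -> `|h z| <= K * `|z| ^+ 2) ->
  is_derive (0 : C^o) 1 (h : C^o -> C^o) 0.
Proof.
move=> K0 hK; have h0 : h 0 = 0.
  apply/eqP; rewrite -normr_eq0 eq_le normr_ge0 andbT.
  by rewrite (le_trans (hK _ _)) ?normr0 // expr0n mulr0.
have H : cvg_to ((fun t : C^o => t^-1 *: ((h \o shift 0) (t *: 1) - h 0) : C^o)
    @ 0^') (nbhs (0 : C^o)).
  apply/(@cvgrPdist_le _ C^o) => e e0.
  apply/(@nbhs_normP _ C^o); exists (e / (e + K)) => /=.
    by rewrite divr_gt0 // addr_gt0.
  move=> t /= + t0; rewrite sub0r normrN => /ltW te.
  have eK : 0 < e + K by rewrite addr_gt0.
  rewrite sub0r normrN h0 subr0 addr0 [t *: 1]mulr1 normrZ normfV.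
  rewrite ler_pdivrMl ?normr_gt0 //.
  rewrite (le_trans (hK _ _)) //.
    by rewrite (le_trans te) // ler_pdivrMr // mul1r lerDl ltW.
  rewrite expr2 mulrCA ler_wpM2l // (le_trans (ler_wpM2l (ltW K0) te)) //.
  by rewrite mulrCA ger_pMr // ler_pdivrMr // mul1r lerDr ltW.
by apply: DeriveDef; [apply/cvg_ex; exists 0|exact: (@cvg_lim C^o)].
Qed.

Definition mxderiv p q (G : C -> 'M[C]_(p, q)) (a : C) (D : 'M[C]_(p, q)) :=
  forall i j, is_derive (a : C^o) 1 (fun z : C^o => G z i j : C^o) (D i j : C^o).

Lemma mxderiv_cst p q (A : 'M[C]_(p, q)) a : mxderiv (fun=> A) a 0.
Proof. by move=> i j; rewrite mxE; exact: is_derive_cst. Qed.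

Lemma mxderivD p q (G H : C -> 'M[C]_(p, q)) a D E :
  mxderiv G a D -> mxderiv H a E -> mxderiv (fun z => G z + H z) a (D + E).
Proof.
move=> GD HE i j; rewrite mxE; under eq_fun do rewrite mxE; exact: is_deriveD.
Qed.

Lemma is_derive_big_sum (I : Type) (s : seq I) (h : I -> C^o -> C^o) (a : C^o) d :
  (forall i, is_derive a 1 (h i) (d i)) ->
  is_derive a 1 (fun z => \sum_(i <- s) h i z) (\sum_(i <- s) d i).
Proof.
move=> hd; elim: s => [|i s IH].
  under eq_fun do rewrite big_nil; rewrite big_nil; exact: is_derive_cst.
under eq_fun do rewrite big_cons; rewrite big_cons; exact: is_deriveD.
Qed.

Lemma mxderivM p q r (G : C -> 'M[C]_(p, q)) (H : C -> 'M[C]_(q, r)) a D E :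
  mxderiv G a D -> mxderiv H a E ->
  mxderiv (fun z => G z *m H z) a (D *m H a + G a *m E).
Proof.
move=> GD HE i j; rewrite !mxE -big_split /=; under eq_fun do rewrite mxE.
apply: is_derive_big_sum => k.
have := is_deriveM (GD i k) (HE k j); rewrite addrC /GRing.scale /=.
by rewrite [H a k j * _]mulrC.
Qed.

Lemma mxderivZ p q (g : C -> C) (G : C -> 'M[C]_(p, q)) (a d : C) D :
  is_derive (a : C^o) 1 (g : C^o -> C^o) d -> mxderiv G a D ->
  mxderiv (fun z => g z *: G z) a (d *: G a + g a *: D).
Proof.
move=> gd GD i j; rewrite !mxE; under eq_fun do rewrite mxE.
have := is_deriveM gd (GD i j); rewrite addrC /GRing.scale /=.
by rewrite [G a i j * _]mulrC.
Qed.

Lemma mxderiv_ext p q (G H : C -> 'M[C]_(p, q)) (a : C) D :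
  (\forall z \near nbhs (a : C^o), G z = H z) -> mxderiv G a D -> mxderiv H a D.
Proof.
move=> GH GD i j; apply: near_eq_is_derive (GD i j); rewrite ?oner_eq0 //.
by near=> z; rewrite (near GH z).
Unshelve. all: by end_near.
Qed.

Lemma derive1_val (h : C^o -> C^o) (a : C^o) d : is_derive a 1 h d ->
  derive1 h a = d.
Proof. by move=> hd; rewrite derive1E derive_val. Qed.

End QuadraticDerivative.

(** * Dependence of a linear equation on its parameter *)

Section MatrixApproximation.
Context {R : realType} {m : nat}.
Local Notation C := R[i].

Definition mxpapprox (rho : nat) (F : C -> 'M[C]_m) := forall e : R, 0 < e ->
  exists P : 'M[{poly C}]_m, forall z, `|z| <= rho%:R ->
    mxn1 (F z - map_mx (horner^~ z) P) <= e.

Lemma n1_le_of_norm (w : C) (K : R) : `|w| <= K%:C -> n1 w <= 2 * K.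
Proof.
move=> wK; rewrite -lecR (le_trans (n1_le_norm w)) // rmorphM rmorph_nat.
by rewrite ler_pM2l.
Qed.

Lemma mxpapproxP rho (F : C -> 'M[C]_m) :
  (forall i j, papprox rho (fun z => F z i j)) <-> mxpapprox rho F.
Proof.
split=> [aF e e0|aF i j e e0]; last first.
  have eR : (complex.Re e)%:C = e by apply/RRe_real/ger0_real/ltW.
  have e0R : 0 < complex.Re e by rewrite -ltcR eR.
  have [P FP] := aF _ e0R.
  exists (P i j) => z zr; rewrite -eR (le_trans (norm_le_n1 _)) // lecR.
  have := mxn1_entry (F z - map_mx (horner^~ z) P) i j.
  by rewrite !mxE => /le_trans; apply; apply: FP.
have d0 : 0 < e / 2 / ((m * m).+1)%:R by rewrite !divr_gt0.
have /choice[P FP] (ij : 'I_m * 'I_m) : exists P : {poly C}, forall z,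
    `|z| <= rho%:R -> `|F z ij.1 ij.2 - P.[z]| <= (e / 2 / ((m * m).+1)%:R)%:C.
  by apply: aF; rewrite ltcR.
exists (\matrix_(i, j) P (i, j)) => z zr.
have := @mxn1_le R m (F z - map_mx (horner^~ z) (\matrix_(i, j) P (i, j)))
  (2 * (e / 2 / ((m * m).+1)%:R)).
move=> /(_ _)/le_trans; apply => [i j|].
  by rewrite !mxE; apply: n1_le_of_norm; exact: (FP (i, j)).
rewrite -!mulrA [2 * _]mulrCA mulVKf ?pnatr_eq0 //.
rewrite mulrCA ler_piMr ?(ltW e0) // ler_pdivrMr ?ltr0n // mul1r ler_nat //.
Qed.

Lemma mxpapprox_bounded rho (F : C -> 'M[C]_m) : mxpapprox rho F ->
  exists2 K : R, 0 <= K & forall z, `|z| <= rho%:R -> mxn1 (F z) <= K.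
Proof.
move=> /mxpapproxP aF.
have /choice[K FK] (ij : 'I_m * 'I_m) : exists K : R, forall z,
    `|z| <= rho%:R -> n1 (F z ij.1 ij.2) <= K.
  have [K K0 FK] := papprox_bounded (aF ij.1 ij.2).
  exists (2 * complex.Re K) => z /FK FzK; apply: n1_le_of_norm.
  by rewrite RRe_real // ger0_real // ltW.
exists (\sum_i \sum_j `|K (i, j)|) => [|z zr].
  by apply: sumr_ge0 => i _; apply: sumr_ge0.
apply: ler_sum => i _; apply: ler_sum => j _.
by apply: le_trans (ler_norm _); exact: (FK (i, j)).
Qed.

Variables (F : C -> R -> 'M[C]_m) (Psi B : R -> 'M[C]_m) (rho : nat) (c : R).
Hypothesis c0 : 0 <= c.
Hypothesis FB : forall z t, `|z| <= rho%:R -> 0 <= t <= 1 ->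
  mder (F z) t (z *: (F z t *m B t)).
Hypothesis PsiB : forall t, 0 <= t <= 1 -> mder Psi t (B t).
Hypothesis Bc : forall t, 0 <= t <= 1 -> mxn1 (B t) <= c.

Let q := 2 * rho%:R * @mxdim R m * c.
Hypothesis q1 : 2 * q <= 1.

Let q0 : 0 <= q. Proof. by rewrite /q /mxdim !mulr_ge0. Qed.

Let n1_disc (z : C) : `|z| <= rho%:R -> n1 z <= 2 * rho%:R.
Proof. by move=> zr; apply: n1_le_of_norm; rewrite rmorph_nat. Qed.

Let qz_le (z : C) (h : R) : `|z| <= rho%:R -> 0 <= h ->
  n1 z * @mxdim R m * c * h <= q * h.
Proof.
move=> /n1_disc zr h0; rewrite !ler_wpM2r // /mxdim !mulr_ge0 //.
Qed.

(* Explicit Euler scheme: each step multiplies by 1 + z (Psi t' - Psi t),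
   which is polynomial in z. *)
Lemma ode_papprox : mxpapprox rho (fun z => F z 0) -> mxpapprox rho (fun z => F z 1).
Proof.
move=> aF e e0; have [K K0 FK] := mxpapprox_bounded aF.
(* The [N] steps amplify errors by at most [(1 + x) ^ N <= expR q]. One half of [e] is spent on the
   initial approximation, the other on the local errors, whose sum [N (4 K x^2) = 4 K q^2 / N]
   determines the choice of [N0]. *)
have E0 := expR_gt0 q; pose e' := e / 2 / expR q.
have e'0 : 0 < e' by rewrite !divr_gt0.
have {aF} [P0 FP0] := aF e' e'0.
have [N0 N0e] := nat_bound (4 * K * q ^+ 2 / e').
pose N := N0.+1; have N_gt0 : 0 < N%:R :> R by rewrite ltr0n.
pose x := q / N%:R; have x0 : 0 <= x by rewrite divr_ge0.
pose t k : R := k%:R / N%:R.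
have t01 k : (k <= N)%N -> 0 <= t k <= 1.
  by move=> kN; rewrite divr_ge0 //= ler_pdivrMr // mul1r ler_nat.
have tS k : t k.+1 - t k = N%:R^-1.
  by rewrite /t -mulrBl -addn1 natrD addrAC subrr add0r mul1r.
have step k : (k <= N)%N -> exists P : 'M[{poly C}]_m, forall z,
    `|z| <= rho%:R -> mxn1 (F z (t k) - map_mx (horner^~ z) P) <=
      (e' + k%:R * (4 * K * x ^+ 2)) * (1 + x) ^+ k.
  elim: k => [|k IH] kN.
    exists P0 => z zr; rewrite /t !mul0r addr0 expr0 mulr1; exact: FP0.
  have [P FP] := IH (ltnW kN).
  pose Delta := Psi (t k.+1) - Psi (t k).
  exists (P *m (1%:M + 'X *: map_mx polyC Delta)) => z zr.
  have -> : map_mx (horner^~ z) (P *m (1%:M + 'X *: map_mx polyC Delta)) =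
      map_mx (horner^~ z) P *m (1%:M + z *: Delta).
    apply/matrixP => i j; rewrite !mxE horner_sum; apply: eq_bigr => l _.
    rewrite !mxE hornerM !hornerE; case: (l == j); rewrite ?hornerE //.
  have -> : F z (t k.+1) - map_mx (horner^~ z) P *m (1%:M + z *: Delta) =
      (F z (t k.+1) - F z (t k) *m (1%:M + z *: Delta)) +
      (F z (t k) - map_mx (horner^~ z) P) *m (1%:M + z *: Delta).
    by rewrite mulmxBl addrA subrK.
  have [k0 k1] : 0 <= t k <= 1 /\ 0 <= t k.+1 <= 1.
    by split; apply: t01; rewrite // ltnW.
  have tk : t k <= t k.+1 by rewrite -subr_ge0 tS invr_ge0.
  have sub s : t k <= s <= t k.+1 -> 0 <= s <= 1.
    move=> /andP[ks sk]; case/andP: k0 => k0 _; case/andP: k1 => _ k1.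
    by rewrite (le_trans k0 ks) (le_trans sk k1).
  (* Local error: [ode_first_order] gives [2 x^2] times the norm of [F z (t k)], which [ode_bound]
     on the whole interval limits to [2 K]. *)
  have A1 : mxn1 (F z (t k.+1) - F z (t k) *m (1%:M + z *: Delta)) <=
      4 * K * x ^+ 2.
    have FtK : mxn1 (F z (t k)) <= 2 * K.
      have q' : n1 z * @mxdim R m * c * (1 - 0) <= q.
        by rewrite subr0 -[leRHS]mulr1 qz_le.
      have := ode_bound ler01 (fun s ss => FB zr ss) Bc c0 q' q1 k0.
      by move=> /le_trans; apply; rewrite ler_pM2l // FK.
    have := @ode_first_order R m (F z) Psi B z (t k) (t k.+1) c x tk.
    move=> /(_ (fun s ss => FB zr (sub s ss)) (fun s ss => PsiB (sub s ss))
      (fun s ss => Bc (sub s ss)) c0) /(_ _ _)/le_trans; apply.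
    - by rewrite tS qz_le // invr_ge0.
    - rewrite (le_trans _ q1) // ler_pM2l // /x ler_pdivrMr //.
      by rewrite ler_peMr // ler1n.
    - have -> : 4 * K * x ^+ 2 = 2 * x ^+ 2 * (2 * K) by ring.
      by rewrite ler_wpM2l // mulr_ge0 // exprn_ge0.
  have A2 : mxn1 ((F z (t k) - map_mx (horner^~ z) P) *m (1%:M + z *: Delta)) <=
      (e' + k%:R * (4 * K * x ^+ 2)) * (1 + x) ^+ k * (1 + x).
    have zD : n1 z * mxn1 Delta <= x.
      have := mder_bound tk (fun s ss => PsiB (sub s ss)) (fun s ss => Bc (sub s ss)).
      move=> /(ler_wpM2l (n1_ge0 z))/le_trans; apply; rewrite tS.
      have := @qz_le z N%:R^-1 zr; rewrite invr_ge0 ler0n => /(_ isT).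
      by rewrite /x !mulrA.
    rewrite mulmxDr mulmx1 -scalemxAr (le_trans (mxn1D _ _)) //.
    rewrite (le_trans (lerD (lexx _) (mxn1Z _ _))) //.
    rewrite (le_trans (lerD (lexx _) (ler_wpM2l (n1_ge0 z) (mxn1M _ _)))) //.
    rewrite mulrCA -[X in X + _]mulr1 -mulrDr ler_pM ?mxn1_ge0 ?FP //.
      by rewrite addr_ge0 // mulr_ge0 ?n1_ge0 ?mxn1_ge0.
    by rewrite lerD2l.
  rewrite (le_trans (mxn1D _ _)) // (le_trans (lerD A1 A2)) //.
  rewrite -subr_ge0 -[k.+1%:R]natr1.
  rewrite [X in 0 <= X](_ : _ = 4 * K * x ^+ 2 * ((1 + x) ^+ k.+1 - 1)).
    by rewrite !mulr_ge0 ?exprn_ge0 // subr_ge0 exprn_ege1 // lerDl.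
  by rewrite [(1 + x) ^+ k.+1]exprSr; ring.
have [P FP] := step N (leqnn _); exists P => z zr.
have tN : t N = 1 by rewrite /t divff // gt_eqF.
move: (FP z zr); rewrite tN => /le_trans; apply.
have xN : (1 + x) ^+ N <= expR q.
  apply: (@le_trans _ _ (expR x ^+ N)).
    by rewrite lerXn2r ?nnegrE ?addr_ge0 ?expR_ge0 // expR_ge1Dx.
  by rewrite -expRM_natl /x mulrC divfK // gt_eqF.
have K2 : N%:R * (4 * K * x ^+ 2) <= e'.
  have -> : N%:R * (4 * K * x ^+ 2) = 4 * K * q ^+ 2 / N%:R.
    by rewrite /x; field; rewrite gt_eqF.
  move: N0e; rewrite ler_pdivrMr // => N0e; rewrite ler_pdivrMr // (le_trans N0e) //.
  by rewrite mulrC ler_pM2l // ler_nat.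
apply: (@le_trans _ _ ((e' + e') * expR q)).
  apply: ler_pM => //; last by rewrite lerD2l.
    by rewrite addr_ge0 ?(ltW e'0) // !mulr_ge0 // exprn_ge0.
  by rewrite exprn_ge0 // addr_ge0.
by rewrite /e' -mulrDl -splitr divfK // gt_eqF.
Qed.

(** On the whole interval [ode_first_order] has an error quadratic in [n1 z], so that [F z 1] and
    [F z 0 (1 + z (Psi 1 - Psi 0))] have the same derivative at 0. *)
Lemma ode_deriv0 D : (1 <= rho)%N -> mxpapprox rho (fun z => F z 0) ->
  F 0 0 = 1%:M -> mxderiv (F^~ 0) 0 D -> mxderiv (F^~ 1) 0 (D + (Psi 1 - Psi 0)).
Proof.
move=> rho1 aF F00 FD; have [K K0 FK] := mxpapprox_bounded aF.
have disc (z : C) : `|z| <= 1 -> `|z| <= rho%:R.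
  by move=> z1; rewrite (le_trans z1) // ler1n.
pose Delta := Psi 1 - Psi 0.
pose h z := F z 1 - F z 0 *m (1%:M + z *: Delta).
have hq z : `|z| <= 1 -> mxn1 (h z) <= 2 * (n1 z * @mxdim R m * c) ^+ 2 * K.
  move=> z1; have q' : n1 z * @mxdim R m * c * (1 - 0) <= n1 z * @mxdim R m * c.
    by rewrite subr0 mulr1.
  have q1' : 2 * (n1 z * @mxdim R m * c) <= 1.
    rewrite (le_trans _ q1) // ler_pM2l //.
    by have := qz_le (disc z z1) ler01; rewrite !mulr1.
  have := ode_first_order ler01 (fun s ss => FB (disc z z1) ss) PsiB Bc c0 q' q1'.
  move=> /le_trans; apply; rewrite ler_wpM2l ?FK ?disc // mulr_ge0 //.
  by rewrite exprn_ge0 // /mxdim !mulr_ge0 ?n1_ge0.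
have hD : mxderiv h 0 0.
  move=> i j; rewrite mxE.
  (* The 8 is the 2 of [ode_first_order] times the square of the 2 in [n1 z <= 2 |z|]; the summand 1
     only ensures positivity. *)
  pose k : R := 8 * (@mxdim R m * c) ^+ 2 * K + 1.
  have k0 : 0 <= 8 * (@mxdim R m * c) ^+ 2 * K.
    by rewrite !mulr_ge0 // exprn_ge0 // /mxdim !mulr_ge0.
  apply: (@quadratic_is_derive _ _ k%:C).
    by rewrite ltcR /k ltr_wpDl.
  move=> z z1; apply: (le_trans (norm_le_n1 _)).
  have nz : (n1 z)%:C ^+ 2 <= (2 * `|z|) ^+ 2.
    by rewrite lerXn2r ?nnegrE ?n1_le_norm ?mulr_ge0 // ler0c n1_ge0.
  apply: (@le_trans _ _ ((8 * (@mxdim R m * c) ^+ 2 * K)%:C * `|z| ^+ 2)); last first.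
    by rewrite ler_wpM2r ?exprn_ge0 // lecR /k lerDl.
  apply: (@le_trans _ _ ((2 * (@mxdim R m * c) ^+ 2 * K)%:C * (n1 z)%:C ^+ 2)).
    rewrite -rmorphXn -rmorphM lecR (le_trans (mxn1_entry _ _ _)) //.
    by rewrite (le_trans (hq z z1)) // le_eqVlt; apply/orP; left; apply/eqP; ring.
  apply: le_trans (ler_wpM2l _ nz) _.
    by rewrite ler0c !mulr_ge0 // exprn_ge0 // /mxdim !mulr_ge0.
  by rewrite le_eqVlt; apply/orP; left; apply/eqP; rewrite !rmorphM /= !rmorph_nat; ring.
have -> : F^~ 1 = fun z => h z + F z 0 *m (1%:M + z *: Delta).
  by apply/funext => z; rewrite /h subrK.
have -> : D + (Psi 1 - Psi 0) =
    0 + (D *m (1%:M + 0 *: Delta) + F 0 0 *m (0 + (1 *: Delta + 0 *: 0))).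
  by rewrite F00 mul1mx scale0r addr0 mulmx1 scale1r scaler0 addr0 !add0r.
apply: mxderivD => //; apply: mxderivM => //.
apply: mxderivD; first exact: mxderiv_cst.
by apply: (@mxderivZ _ _ _ id); exact: mxderiv_cst.
Qed.

End MatrixApproximation.

(** * Lorentz space and simple factors *)

Section LorentzAlgebra.
Context {K : numFieldType} {n : nat}.
Implicit Types (x y a b : 'cV[K]_n) (mu nu : K) (w l u : 'cV[K]_(n + 2)).
Implicit Types A B : 'M[K]_(n + 2).

Let two0 : (2 : K) != 0. Proof. by rewrite pnatr_eq0. Qed.

Lemma clvec_coef x i : clvec x [set i]%SET = x i 0.
Proof.
rewrite /clvec sum_ffunE (bigD1 i) //= big1 => [|j ji].
  by rewrite addr0 !ffunE eqxx /GRing.scale /= mulr1.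
rewrite !ffunE (_ : _ == _ = false) /GRing.scale /= ?mulr0 //.
by apply/negbTE; apply: contra ji => /eqP/set1_inj ->.
Qed.

Lemma clvec_inj : injective (@clvec K n).
Proof.
move=> x y xy; apply/colP => i.
by rewrite -(clvec_coef x) -(clvec_coef y) xy.
Qed.

Lemma clvecD x y : clvec (x + y) = clvec x + clvec y.
Proof.
rewrite /clvec -big_split; apply: eq_bigr => i _; by rewrite mxE scalerDl.
Qed.

Lemma clvecZ k x : clvec (k *: x) = k *: clvec x.
Proof.
by rewrite /clvec scaler_sumr; apply: eq_bigr => i _; rewrite mxE scalerA.
Qed.

Lemma clvecN x : clvec (- x) = - clvec x.
Proof. by rewrite -scaleN1r clvecZ scaleN1r. Qed.

Lemma clvecB x y : clvec (x - y) = clvec x - clvec y.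
Proof. by rewrite clvecD clvecN. Qed.

Lemma dotC x y : dot x y = dot y x.
Proof. by apply: eq_bigr => i _; rewrite mulrC. Qed.

Lemma dotDl x y a : dot (x + y) a = dot x a + dot y a.
Proof. by rewrite -big_split; apply: eq_bigr => i _; rewrite mxE mulrDl. Qed.

Lemma dotZl k x y : dot (k *: x) y = k * dot x y.
Proof. by rewrite mulr_sumr; apply: eq_bigr => i _; rewrite mxE mulrA. Qed.

Lemma dotDr x y a : dot a (x + y) = dot a x + dot a y.
Proof. by rewrite !(dotC a) dotDl. Qed.

Lemma dotZr k x y : dot y (k *: x) = k * dot y x.
Proof. by rewrite !(dotC y) dotZl. Qed.

Lemma dotNl x y : dot (- x) y = - dot x y.
Proof. by rewrite -scaleN1r dotZl mulN1r. Qed.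

Lemma dotNr x y : dot y (- x) = - dot y x.
Proof. by rewrite -scaleN1r dotZr mulN1r. Qed.

Lemma dot0l x : dot 0 x = 0.
Proof. by rewrite -[0](scale0r (0 : 'cV[K]_n)) dotZl mul0r. Qed.

Lemma dot0r x : dot x 0 = 0. Proof. by rewrite dotC dot0l. Qed.

Definition dotE := (dotDl, dotDr, dotNl, dotNr, dotZl, dotZr, dot0l, dot0r).

Lemma clvec_sq x : clvec x * clvec x = (- dot x x) *: 1.
Proof.
have := clvec_anticomm x x; rewrite -mulr2n -scaler_nat -mulrN -scalerA.
exact: (scalerI two0).
Qed.

(** The left factor is moved past [clvec y] by the Clifford relation. Thus the quadratic term of the
    Riccati equation is again a vector, and the equation can be handled in coordinates. *)
Lemma clvec_sandwich x y :
  clvec x * clvec y * clvec x = clvec (dot x x *: y - (2 * dot x y) *: x).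
Proof.
have : clvec x * clvec y = (- (2 * dot x y)) *: 1 - clvec y * clvec x.
  by rewrite -clvec_anticomm addrK.
move=> ->; rewrite mulrBl -scalerAl mul1r -mulrA clvec_sq -scalerAr mulr1.
by rewrite clvecB !clvecZ !scaleNr opprK addrC.
Qed.

Lemma lvecE w : w = lvec (lpart w) (lmu w) (lnu w).
Proof.
rewrite -[LHS]vsubmxK; congr col_mx; apply/colP => i; rewrite !mxE.
by case: i => [[|[|//]] ?]; rewrite /= /lmu /lnu mxE;
  congr (fun_of_matrix w _ _); apply: val_inj.
Qed.

Lemma lpart_lvec x mu nu : lpart (lvec x mu nu) = x.
Proof. by rewrite /lpart col_mxKu. Qed.

Lemma lmu_lvec x mu nu : lmu (lvec x mu nu) = mu.
Proof. by rewrite /lmu /lvec col_mxKd mxE. Qed.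

Lemma lnu_lvec x mu nu : lnu (lvec x mu nu) = nu.
Proof. by rewrite /lnu /lvec col_mxKd mxE. Qed.

Lemma lvecD x mu nu y mu' nu' :
  lvec x mu nu + lvec y mu' nu' = lvec (x + y) (mu + mu') (nu + nu').
Proof.
rewrite /lvec add_col_mx; congr col_mx; apply/colP => i; rewrite !mxE.
by case: ifP.
Qed.

Lemma lvecZ k x mu nu : k *: lvec x mu nu = lvec (k *: x) (k * mu) (k * nu).
Proof.
rewrite /lvec scale_col_mx; congr col_mx; apply/colP => i; rewrite !mxE.
by case: ifP.
Qed.

Lemma lvec_inj x mu nu y mu' nu' : lvec x mu nu = lvec y mu' nu' ->
  [/\ x = y, mu = mu' & nu = nu'].
Proof.
move=> E; split.
- by rewrite -(lpart_lvec x mu nu) E lpart_lvec.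
- by rewrite -(lmu_lvec x mu nu) E lmu_lvec.
- by rewrite -(lnu_lvec x mu nu) E lnu_lvec.
Qed.

Lemma rho_lvec x mu nu : rho *m lvec x mu nu = lvec x (- mu) (- nu).
Proof.
rewrite /rho /lvec mul_block_col mul1mx !mul0mx addr0 add0r mulNmx mul1mx.
by congr col_mx; apply/colP => i; rewrite !mxE; case: ifP.
Qed.

Lemma rho2 : rho *m rho = 1%:M :> 'M[K]_(n + 2).
Proof.
rewrite /rho mulmx_block !mulmx0 !mul0mx !mulmx1 mulNmx mul1mx opprK.
by rewrite !addr0 add0r -scalar_mx_block.
Qed.

Lemma lform_lvec x mu nu y mu' nu' :
  lform (lvec x mu nu) (lvec y mu' nu') = dot x y - (mu * nu' + nu * mu') / 2.
Proof. by rewrite /lform !(lpart_lvec, lmu_lvec, lnu_lvec). Qed.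

(* The action of offdiag (clvec a) (clvec b) on columns (x, mu, nu). *)
Definition adm a b : 'M[K]_(n + 2) :=
  block_mx 0 (\matrix_(i, j) if j == 0 then - b i 0 else a i 0)
    (\matrix_(i, j) if i == 0 then 2 * a j 0 else - (2 * b j 0)) 0.

Lemma adm_lvec a b y mu nu : adm a b *m lvec y mu nu =
  lvec (nu *: a - mu *: b) (2 * dot a y) (- (2 * dot b y)).
Proof.
rewrite /adm /lvec mul_block_col !mul0mx add0r addr0.
congr col_mx; apply/colP => i; rewrite !mxE.
  by rewrite !big_ord_recl big_ord0 !mxE /= addr0; ring.
case: ifP => i0; rewrite /dot mulr_sumr -?sumrN; apply: eq_bigr => j _.
  by rewrite mxE i0 mulrA.
by rewrite mxE i0 mulNr mulrA.
Qed.

Lemma admD a b a' b' : adm (a + a') (b + b') = adm a b + adm a' b'.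
Proof.
rewrite /adm add_block_mx !addr0; congr block_mx; apply/matrixP => i j;
  rewrite !mxE; case: ifP => _; ring.
Qed.

Lemma admZ k a b : adm (k *: a) (k *: b) = k *: adm a b.
Proof.
rewrite /adm scale_block_mx !scaler0; congr block_mx; apply/matrixP => i j;
  rewrite !mxE; case: ifP => _; ring.
Qed.

Lemma admB a b a' b' : adm (a - a') (b - b') = adm a b - adm a' b'.
Proof. by rewrite -scaleN1r -[- b']scaleN1r admD admZ scaleN1r. Qed.

Lemma acts_as_adm a b : acts_as (offdiag (clvec a) (clvec b)) (adm a b).
Proof.
move=> w; rewrite [in LHS](lvecE w) adm_lvec /lmx !(lpart_lvec, lmu_lvec, lnu_lvec).
have e1 : clvec (lpart w) * clvec a + clvec a * clvec (lpart w) =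
  - (2 * dot a (lpart w))%:A by rewrite clvec_anticomm dotC scaleNr.
have e2 : clvec (lpart w) * clvec b + clvec b * clvec (lpart w) =
  - (2 * dot b (lpart w))%:A by rewrite clvec_anticomm dotC scaleNr.
apply/matrixP => i j; rewrite !mxE !big_ord_recl !big_ord0 !mxE /=.
case: i => [[|[|//]] ?]; case: j => [[|[|//]] ?]; rewrite /= ?mul0r ?mulr0
  ?addr0 ?add0r.
- by rewrite clvecB !clvecZ -scalerAl -scalerAr mul1r mulr1.
- by rewrite mulrN -opprD addrC e1 opprK.
- by rewrite mulNr opprK addrC e2 scaleNr.
- by rewrite clvecB !clvecZ -scalerAl -scalerAr mul1r mulr1 opprB.
Qed.

Lemma lmx_inj : injective (@lmx K n).
Proof.
move=> w w' E; rewrite (lvecE w) (lvecE w').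
have E1 i j : lmx w i j = lmx w' i j by rewrite E.
have := E1 0 0; have := E1 0 1; have := E1 1 0; rewrite !mxE /=.
have inj : injective (fun k : K => k%:A : clifford K n).
  move=> k k' /ffunP/(_ finset.set0); rewrite !ffunE eqxx /GRing.scale /=.
  by rewrite !mulr1.
by move=> /inj -> /inj -> /clvec_inj ->.
Qed.

(** Together with [acts_as_adm] this turns the equation of the extended frame, stated through
    commutators, into an equation between matrices over [C]. *)
Lemma acts_as_inj X A B : acts_as X A -> acts_as X B -> A = B.
Proof.
move=> XA XB; apply/matrixP => i j.
have : A *m delta_mx j 0 = B *m delta_mx j (0 : 'I_1).
  by apply: lmx_inj; rewrite XA XB.
by move=> /colP/(_ i); rewrite -!colE !mxE.
Qed.

Definition gram : 'M[K]_(n + 2) :=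
  block_mx 1%:M 0 0 (\matrix_(i < 2, j < 2) if i == j then 0 else - 2^-1).
Definition gramV : 'M[K]_(n + 2) :=
  block_mx 1%:M 0 0 (\matrix_(i < 2, j < 2) if i == j then 0 else - 2).

Lemma gram_lvec x mu nu : gram *m lvec x mu nu = lvec x (- (nu / 2)) (- (mu / 2)).
Proof.
rewrite /gram /lvec mul_block_col mul1mx !mul0mx addr0 add0r.
congr col_mx; apply/colP => i; rewrite !mxE !big_ord_recl big_ord0 !mxE /=.
by case: i => [[|[|//]] ?]; rewrite /= mul0r ?addr0 ?add0r mulNr mulrC.
Qed.

Lemma gramV_lvec x mu nu : gramV *m lvec x mu nu = lvec x (- (2 * nu)) (- (2 * mu)).
Proof.
rewrite /gramV /lvec mul_block_col mul1mx !mul0mx addr0 add0r.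
congr col_mx; apply/colP => i; rewrite !mxE !big_ord_recl big_ord0 !mxE /=.
by case: i => [[|[|//]] ?]; rewrite /= mul0r ?addr0 ?add0r mulNr.
Qed.

Lemma mulmx_lvec_ext A B : (forall x mu nu, A *m lvec x mu nu = B *m lvec x mu nu) ->
  A = B.
Proof.
move=> AB; apply/matrixP => i j.
have : A *m delta_mx j 0 = B *m delta_mx j (0 : 'I_1).
  by rewrite (lvecE (delta_mx j 0)) AB.
by move=> /colP/(_ i); rewrite -!colE !mxE.
Qed.

Lemma gramVK : gramV *m gram = 1%:M.
Proof.
apply: mulmx_lvec_ext => x mu nu; rewrite -mulmxA gram_lvec gramV_lvec mul1mx.
by congr lvec; rewrite mulrN opprK mulrC divfK.
Qed.

Lemma gramKV : gram *m gramV = 1%:M.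
Proof. exact: mulmx1C gramVK. Qed.

Lemma gram_tr : gram^T = gram.
Proof.
rewrite /gram tr_block_mx trmx1 !trmx0; congr block_mx.
by apply/matrixP => i j; rewrite !mxE eq_sym.
Qed.

Lemma gramV_tr : gramV^T = gramV.
Proof.
rewrite /gramV tr_block_mx trmx1 !trmx0; congr block_mx.
by apply/matrixP => i j; rewrite !mxE eq_sym.
Qed.

Lemma lformE w u : lform w u = (w^T *m gram *m u) 0 0.
Proof.
rewrite (lvecE w) (lvecE u) lform_lvec -mulmxA gram_lvec /lvec tr_col_mx.
rewrite mul_row_col !mxE !big_ord_recl big_ord0 !mxE /= /dot.
under [in RHS]eq_bigr => i _ do rewrite mxE.
by field.
Qed.

Lemma lform_mx w u : w^T *m gram *m u = (lform w u)%:M.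
Proof. by rewrite lformE -mx11_scalar. Qed.

Lemma lformC w u : lform w u = lform u w.
Proof. by rewrite /lform dotC; congr (_ - _ / _); ring. Qed.

Lemma lformDl w u l : lform (w + u) l = lform w l + lform u l.
Proof. by rewrite !lformE linearD /= !mulmxDl mxE. Qed.

Lemma lformZl k w u : lform (k *: w) u = k * lform w u.
Proof. by rewrite !lformE linearZ /= -!scalemxAl mxE. Qed.

Lemma lformDr w u l : lform l (w + u) = lform l w + lform l u.
Proof. by rewrite !(lformC l) lformDl. Qed.

Lemma lformZr k w u : lform w (k *: u) = k * lform w u.
Proof. by rewrite !(lformC w) lformZl. Qed.

Lemma lform0r w : lform w 0 = 0.
Proof. by rewrite lformE mulmx0 mxE. Qed.

Lemma lform0l w : lform 0 w = 0.
Proof. by rewrite lformC lform0r. Qed.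

Lemma lform_nondeg w : (forall u, lform w u = 0) -> w = 0.
Proof.
move=> w0; have : w^T *m gram = 0.
  apply/rowP => j; have := w0 (delta_mx j 0).
  by rewrite lformE -colE !mxE.
move=> /(congr1 (mulmx^~ gramV)); rewrite -mulmxA gramKV mulmx1 mul0mx.
by move=> /(congr1 trmx); rewrite trmxK trmx0.
Qed.

Lemma lform_rho w u : lform (rho *m w) (rho *m u) = lform w u.
Proof.
by rewrite (lvecE w) (lvecE u) !rho_lvec !lform_lvec !mulrNN.
Qed.

Lemma lform_rhoC w u : lform (rho *m w) u = lform w (rho *m u).
Proof. by rewrite -[RHS]lform_rho mulmxA rho2 mul1mx. Qed.

(* The adjoint with respect to lform, not the adjugate. *)
Definition adj A : 'M[K]_(n + 2) := gramV *m A^T *m gram.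

Lemma lform_adj A w u : lform (A *m w) u = lform w (adj A *m u).
Proof.
rewrite !lformE trmx_mul /adj !mulmxA.
by rewrite -[w^T *m gram *m gramV]mulmxA gramKV mulmx1.
Qed.

Lemma adjK A : adj (adj A) = A.
Proof.
rewrite /adj !trmx_mul trmxK gram_tr gramV_tr !mulmxA gramVK mul1mx.
by rewrite -mulmxA gramVK mulmx1.
Qed.

Lemma orthogonalP A : orthogonal_mx A <-> adj A *m A = 1%:M.
Proof.
split=> [oA|AA w u]; last by rewrite lform_adj mulmxA AA mul1mx.
apply/eqP; rewrite -subr_eq0; apply/eqP/mulmx_lvec_ext => x mu nu.
rewrite mul0mx; apply: lform_nondeg => w.
rewrite lformC mulmxBl mul1mx -scaleN1r lformDr lformZr -mulmxA -lform_adj oA.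
by rewrite mulN1r subrr.
Qed.

Lemma orthogonal_adjr A : orthogonal_mx A -> A *m adj A = 1%:M.
Proof. by move=> /orthogonalP/mulmx1C. Qed.

Lemma orthogonal_mul A B : orthogonal_mx A -> orthogonal_mx B ->
  orthogonal_mx (A *m B).
Proof. by move=> oA oB w u; rewrite -!mulmxA oA oB. Qed.

Lemma orthogonal_adj A : orthogonal_mx A -> orthogonal_mx (adj A).
Proof. by move=> oA; apply/orthogonalP; rewrite adjK orthogonal_adjr. Qed.

(** When [l] is null, so is [rho *m l], and pairing a vector with [rho *m l] sees only its component
    along [l]; division by the pairing of [l] with [rho *m l] normalises it. Likewise for
    [projm]. *)
Definition projp l : 'M[K]_(n + 2) :=
  (lform l (rho *m l))^-1 *: (l *m (rho *m l)^T *m gram).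
Definition projm l : 'M[K]_(n + 2) :=
  (lform l (rho *m l))^-1 *: (rho *m l *m l^T *m gram).

Lemma projp_mul l w : projp l *m w =
  (lform (rho *m l) w / lform l (rho *m l)) *: l.
Proof.
rewrite /projp -!scalemxAl -!mulmxA [_^T *m _]mulmxA lform_mx mul_mx_scalar.
by rewrite scalerA mulrC.
Qed.

Lemma projm_mul l w : projm l *m w =
  (lform l w / lform l (rho *m l)) *: (rho *m l).
Proof.
rewrite /projm -!scalemxAl -!mulmxA [_^T *m _]mulmxA lform_mx.
by rewrite !mul_mx_scalar -scalemxAr scalerA mulrC.
Qed.

(* The operator equal to a, c and b on L, (L + rho L)^perp and rho L. *)
Definition splitting l (a c b : K) : 'M[K]_(n + 2) :=
  c%:M + (a - c) *: projp l + (b - c) *: projm l.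

Lemma splitting_mul l (a c b : K) w : splitting l a c b *m w = c *: w +
  ((a - c) * (lform (rho *m l) w / lform l (rho *m l))) *: l +
  ((b - c) * (lform l w / lform l (rho *m l))) *: (rho *m l).
Proof.
rewrite /splitting !mulmxDl mul_scalar_mx -[(_ *: projp l) *m w]scalemxAl.
rewrite -[(_ *: projm l) *m w]scalemxAl projp_mul projm_mul.
by rewrite !scalerA.
Qed.

Section Splitting.
Variable l : 'cV[K]_(n + 2).
Hypothesis ll0 : lform l l = 0.
Hypothesis lrl : lform l (rho *m l) != 0.

Let rll : lform (rho *m l) l = lform l (rho *m l). Proof. exact: lformC. Qed.
Let rlrl0 : lform (rho *m l) (rho *m l) = 0. Proof. by rewrite lform_rho. Qed.

Lemma mulmx_ext A B : (forall w, A *m w = B *m w) -> A = B.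
Proof. by move=> AB; apply: mulmx_lvec_ext => *. Qed.

Lemma splittingM (a c b a' c' b' : K) :
  splitting l a c b *m splitting l a' c' b' = splitting l (a * a') (c * c') (b * b').
Proof.
apply: mulmx_ext => w; rewrite -mulmxA !splitting_mul.
rewrite !lformDr !lformZr rlrl0 rll ll0; move: lrl.
move: (lform l (rho *m l)) (lform (rho *m l) w) (lform l w) (rho *m l).
by move=> s X Y v s0; apply/colP => i; rewrite !mxE; field.
Qed.

Lemma splitting1 : splitting l 1 1 1 = 1%:M.
Proof. by rewrite /splitting subrr !scale0r !addr0. Qed.

Lemma rho_projp : rho *m projp l *m rho = projm l.
Proof.
apply: mulmx_ext => w; rewrite -!mulmxA projp_mul projm_mul -scalemxAr.
by rewrite lform_rho.
Qed.

Lemma rho_projm : rho *m projm l *m rho = projp l.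
Proof.
apply: mulmx_ext => w; rewrite -!mulmxA projp_mul projm_mul -scalemxAr.
by rewrite mulmxA rho2 mul1mx lform_rhoC.
Qed.

Lemma rho_splitting (a c b : K) : rho *m splitting l a c b *m rho = splitting l b c a.
Proof.
rewrite /splitting !mulmxDr !mulmxDl -[rho *m (_ *: projp l)]scalemxAr.
rewrite -[rho *m (_ *: projm l)]scalemxAr.
rewrite -[(_ *: (rho *m projp l)) *m rho]scalemxAl.
rewrite -[(_ *: (rho *m projm l)) *m rho]scalemxAl rho_projp rho_projm.
by rewrite mul_mx_scalar -scalemxAl rho2 scalemx1 addrAC.
Qed.

(** The form pairs L with rho L, so taking adjoints exchanges the two outer eigenvalues, just as
    conjugation by [rho] does. *)
Lemma adj_splitting (a c b : K) : adj (splitting l a c b) = splitting l b c a.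
Proof.
apply: mulmx_ext => w; apply/eqP; rewrite -subr_eq0; apply/eqP/lform_nondeg => u.
rewrite -scaleN1r lformDl lformZl lformC -lform_adj !splitting_mul.
rewrite !lformDl !lformZl [lform w u]lformC; field.
exact: lrl.
Qed.

(** The components of a vector along [l] and [rho *m l] are read off by pairing it with [rho *m l]
    and [l], so any projections for the decomposition agree with the explicit formulas. *)
Lemma projections_splitting (L : {vspace 'cV[K]_(n + 2)}) pip pi0 pim :
  L = <[l]>%VS ->
  (forall w, [/\ pip *m w \in L,
    forall u, u \in L ->
      lform (pi0 *m w) u = 0 /\ lform (pi0 *m w) (rho *m u) = 0,
    exists2 u, u \in L & pim *m w = rho *m u &
    w = pip *m w + pi0 *m w + pim *m w]) ->
  forall a b : K, a *: pip + pi0 + b *: pim = splitting l a 1 b.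
Proof.
move=> -> H a b; apply: mulmx_ext => w.
have [/vlineP[c pE] p0 [_ /vlineP[d ->] mE] wE] := H w.
have [p0l p0r] := p0 l (memv_line l).
rewrite -scalemxAr in mE; rewrite pE mE in wE.
have c_eq : lform (rho *m l) w = c * lform l (rho *m l).
  by rewrite wE !lformDr !lformZr rlrl0 rll [lform _ (pi0 *m w)]lformC p0r mulr0 !addr0.
have d_eq : lform l w = d * lform l (rho *m l).
  by rewrite wE !lformDr !lformZr ll0 [lform _ (pi0 *m w)]lformC p0l mulr0 !add0r.
rewrite splitting_mul c_eq d_eq !mulfK // !mulmxDl -!scalemxAl pE mE.
rewrite [in RHS]wE scale1r; move: (rho *m l) (pi0 *m w) => v u.
by apply/colP => i; rewrite !mxE; ring.
Qed.
End Splitting.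

End LorentzAlgebra.

(** * Continuous and entire matrix functions of a complex variable *)

Section ComplexContinuity.
Context {R : realType}.
Local Notation C := R[i].

(* A copy of continuity on C, as a normed space over itself, that unification
   does not unfold. *)
Variant ccont (f : C -> C) : Prop := Ccont of continuous (f : C^o -> C^o).

Lemma ccont_cst a : ccont (fun=> a). Proof. by split; exact: cst_continuous. Qed.

Lemma ccontD f g : ccont f -> ccont g -> ccont (fun z => f z + g z).
Proof.
by move=> [cf] [cg]; split=> z; exact: (@continuousD _ C^o C^o f g z (cf z) (cg z)).
Qed.

Lemma ccontM f g : ccont f -> ccont g -> ccont (fun z => f z * g z).
Proof.
by move=> [cf] [cg]; split=> z; exact: (@continuousM _ C^o f g z (cf z) (cg z)).
Qed.

Lemma ccont_sum (I : Type) (s : seq I) (F : I -> C -> C) :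
  (forall i, ccont (F i)) -> ccont (fun z => \sum_(i <- s) F i z).
Proof.
move=> cF; elim: s => [|i s IH].
  by under eq_fun do rewrite big_nil; exact: ccont_cst.
by under eq_fun do rewrite big_cons; apply: ccontD.
Qed.

Lemma ccont_comp f g : ccont f -> ccont g -> ccont (fun z => g (f z)).
Proof.
by move=> [cf] [cg]; split=> z; exact: (@continuous_comp C^o C^o C^o f g z (cf z) (cg _)).
Qed.

(** Some punctured neighbourhood of [z] avoids the finite set [S]; there the functions agree, and
    their limits at [z] are unique. *)
Lemma continuous_eq_cofinite (f g : C -> C) (S : set C) : finite_set S ->
  ccont f -> ccont g ->
  (forall z, ~ S z -> f z = g z) -> forall z, f z = g z.
Proof.
move=> finS [cf] [cg] fg z.
have hC : hausdorff_space C^o by exact: norm_hausdorff.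
have acc : accessible_space C^o by exact: hausdorff_accessible.
have clS : closed ((S `\ z) : set C^o).
  have clF : forall A : set C^o, finite_set A -> closed A.
    exact/accessible_finite_set_closed.
  by apply: clF; apply: sub_finite_set finS => w [].
have nS : nbhs (z : C^o) (~` (S `\ z)).
  by apply: open_nbhs_nbhs; split; [exact: closed_openC|case=> _ /(_ erefl)].
have fz : cvg_to ((f : C^o -> C^o) @ (z : C^o)^') (nbhs (f z : C^o)).
  by apply: cvg_within_filter; exact: cf.
have gz : cvg_to ((g : C^o -> C^o) @ (z : C^o)^') (nbhs (g z : C^o)).
  by apply: cvg_within_filter; exact: cg.
apply: (cvg_unique hC fz); rewrite /=.
move: gz; apply: cvg_trans; apply: near_eq_cvg; rewrite near_withinE.
apply: filterS nS => w nw wz; rewrite fg // => Sw; apply: nw; split => //.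
by move=> /= E; rewrite E eqxx in wz.
Qed.

Definition mxcont p q (F : C -> 'M[C]_(p, q)) := forall i j, ccont (fun z => F z i j).

Lemma mxcont_cst p q (A : 'M[C]_(p, q)) : mxcont (fun=> A).
Proof. by move=> i j; exact: ccont_cst. Qed.

Lemma mxcontD p q (F G : C -> 'M[C]_(p, q)) :
  mxcont F -> mxcont G -> mxcont (fun z => F z + G z).
Proof. by move=> cF cG i j; under eq_fun do rewrite mxE; exact: ccontD. Qed.

Lemma mxcontM p q r (F : C -> 'M[C]_(p, q)) (G : C -> 'M[C]_(q, r)) :
  mxcont F -> mxcont G -> mxcont (fun z => F z *m G z).
Proof.
move=> cF cG i j; under eq_fun do rewrite mxE.
by apply: ccont_sum => k; exact: ccontM.
Qed.

Lemma mxcontZ p q (f : C -> C) (F : C -> 'M[C]_(p, q)) :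
  ccont f -> mxcont F -> mxcont (fun z => f z *: F z).
Proof. by move=> cf cF i j; under eq_fun do rewrite mxE; exact: ccontM. Qed.

Lemma mxcont_tr p q (F : C -> 'M[C]_(p, q)) : mxcont F -> mxcont (fun z => (F z)^T).
Proof. by move=> cF i j; under eq_fun do rewrite mxE; exact: cF. Qed.

Lemma mxcont_eq p q (F G : C -> 'M[C]_(p, q)) (S : set C) : finite_set S ->
  mxcont F -> mxcont G -> (forall z, ~ S z -> F z = G z) -> forall z, F z = G z.
Proof.
move=> finS cF cG FG z; apply/matrixP => i j.
apply: (continuous_eq_cofinite finS (cF i j) (cG i j)) => w /FG.
by move=> ->.
Qed.

Lemma mxcont_comp p q (F : C -> 'M[C]_(p, q)) (f : C -> C) :
  ccont f -> mxcont F -> mxcont (fun z => F (f z)).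
Proof. by move=> cf cF i j; exact: (@ccont_comp f (fun w => F w i j)). Qed.

Lemma ccont_isometry (f : C -> C) :
  (forall z w, `|f z - f w| = `|z - w|) -> ccont f.
Proof.
move=> fi; split=> z; apply/(@cvgrPdist_le _ C^o _ (nbhs (z : C^o))) => e e0.
apply/(@nbhs_normP _ C^o); exists e => //= w /= /ltW zw.
by rewrite fi.
Qed.

Lemma ccont_conj : ccont (fun z => Num.conj z).
Proof. by apply: ccont_isometry => z w; rewrite -rmorphB norm_conjC. Qed.

Lemma ccont_opp : ccont -%R.
Proof. by apply: ccont_isometry => z w; rewrite opprK addrC distrC. Qed.

Lemma mxcont_conj p q (F : C -> 'M[C]_(p, q)) : mxcont F ->
  mxcont (fun z => map_mx (fun w : C => Num.conj w) (F z)).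
Proof.
move=> cF i j; under eq_fun do rewrite mxE.
by apply: ccont_comp; [exact: cF|exact: ccont_conj].
Qed.

Lemma ccont_horner (P : {poly C}) : ccont (horner P).
Proof. by split=> z; apply: entire_continuous => m; exact: papprox_poly. Qed.

Lemma derivable_continuous_C (f : C -> C) :
  (forall z, derivable (f : C^o -> C^o) z 1) -> ccont f.
Proof. by move=> df; split=> z; apply/differentiable_continuous/derivable1_diffP. Qed.

Lemma Gplus_mxcont n (g : C -> 'M[C]_(n + 2)) : Gplus g -> mxcont g.
Proof. by move=> [hg _ _ _ _] i j; apply: derivable_continuous_C => z; exact: hg. Qed.

Lemma mxcont_adj n (F : C -> 'M[C]_(n + 2)) : mxcont F -> mxcont (fun z => adj (F z)).
Proof.
move=> cF; apply: mxcontM; last exact: mxcont_cst.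
by apply: mxcontM; [exact: mxcont_cst|exact: mxcont_tr].
Qed.

Definition mxentire p q (F : C -> 'M[C]_(p, q)) := forall i j, entire (fun z => F z i j).

Lemma mxentire_cst p q (A : 'M[C]_(p, q)) : mxentire (fun=> A).
Proof. by move=> i j m; exact: papprox_cst. Qed.

Lemma mxentireD p q (F G : C -> 'M[C]_(p, q)) :
  mxentire F -> mxentire G -> mxentire (fun z => F z + G z).
Proof. by move=> eF eG i j m; under eq_fun do rewrite mxE; apply: papproxD;
  [exact: eF|exact: eG]. Qed.

Lemma mxentireM p q r (F : C -> 'M[C]_(p, q)) (G : C -> 'M[C]_(q, r)) :
  mxentire F -> mxentire G -> mxentire (fun z => F z *m G z).
Proof.
move=> eF eG i j m; under eq_fun do rewrite mxE.
by apply: papprox_sum => k; apply: papproxM; [exact: eF|exact: eG].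
Qed.

Lemma mxentireZ p q (f : C -> C) (F : C -> 'M[C]_(p, q)) :
  entire f -> mxentire F -> mxentire (fun z => f z *: F z).
Proof.
move=> ef eF i j m; under eq_fun do rewrite mxE.
by apply: papproxM; [exact: ef|exact: eF].
Qed.

Lemma mxentire_tr p q (F : C -> 'M[C]_(p, q)) :
  mxentire F -> mxentire (fun z => (F z)^T).
Proof. by move=> eF i j; under eq_fun do rewrite mxE; exact: eF. Qed.

Lemma mxentire_oppz p q (F : C -> 'M[C]_(p, q)) :
  mxentire F -> mxentire (fun z => F (- z)).
Proof.
move=> eF i j m; exact: (@papprox_oppz _ m (fun z => F z i j) (eF i j m)).
Qed.

Lemma mxentire_adj n (F : C -> 'M[C]_(n + 2)) :
  mxentire F -> mxentire (fun z => adj (F z)).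
Proof.
move=> eF; apply: mxentireM; last exact: mxentire_cst.
by apply: mxentireM; [exact: mxentire_cst|exact: mxentire_tr].
Qed.

Lemma mxentire_cont p q (F : C -> 'M[C]_(p, q)) : mxentire F -> mxcont F.
Proof. by move=> eF i j; split=> z; exact: (@entire_continuous _ (fun z => F z i j)). Qed.

Lemma mxentire_division p q (F : C -> 'M[C]_(p, q)) a : mxentire F ->
  exists2 G, mxentire G & forall z, F z = F a + (z - a) *: G z.
Proof.
move=> eF.
have /choice[G HG] (ij : 'I_p * 'I_q) : exists G, entire G /\
    forall z, F z ij.1 ij.2 = F a ij.1 ij.2 + (z - a) * G z.
  by have [G eG FG] := entire_division a (eF ij.1 ij.2); exists G.
exists (fun z => \matrix_(i, j) G (i, j) z) => [i j|z].
  by under eq_fun do rewrite mxE; have [] := HG (i, j).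
by apply/matrixP => i j; rewrite !mxE; have [_ ->] := HG (i, j).
Qed.
End ComplexContinuity.

(** * Simple factors and their symmetries *)

Section SimpleFactor.
Context {C : numClosedFieldType} {n : nat}.
Implicit Types (l : 'cV[C]_(n + 2)) (z : C).
Variable alpha : C.
Hypothesis alpha0 : alpha != 0.

Definition sfactor l z : 'M[C]_(n + 2) :=
  splitting l ((alpha - z) / (alpha + z)) 1 ((alpha + z) / (alpha - z)).

Definition exceptional : set C := [set` [:: alpha; - alpha]].

Lemma exceptional_finite : finite_set exceptional.
Proof. exact: finite_seq. Qed.

Lemma not_exceptional z : ~ exceptional z -> alpha - z != 0 /\ alpha + z != 0.
Proof.
move=> zE; split; apply/eqP => E; apply: zE; rewrite /exceptional /= !inE.
  by move/eqP: E; rewrite subr_eq0 eq_sym => ->.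
by move/eqP: E; rewrite addr_eq0 -eqr_oppLR eq_sym => ->; rewrite orbT.
Qed.

Lemma sfactorN l z : sfactor l (- z) =
  splitting l ((alpha + z) / (alpha - z)) 1 ((alpha - z) / (alpha + z)).
Proof. by rewrite /sfactor opprK. Qed.

Lemma rho_sfactor l z : lform l (rho *m l) != 0 ->
  rho *m sfactor l z *m rho = sfactor l (- z).
Proof. by move=> l0; rewrite sfactorN rho_splitting. Qed.

Lemma sfactor0 l : sfactor l 0 = 1%:M.
Proof. by rewrite /sfactor subr0 addr0 divff // splitting1. Qed.

Section Null.
Variable l : 'cV[C]_(n + 2).
Hypothesis ll0 : lform l l = 0.
Hypothesis lrl : lform l (rho *m l) != 0.

Lemma sfactorK z : ~ exceptional z -> sfactor l (- z) *m sfactor l z = 1%:M.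
Proof.
move=> /not_exceptional[z1 z2]; rewrite sfactorN /sfactor splittingM // mulr1.
by rewrite !mulrA !divfK // !divff // splitting1.
Qed.

Lemma sfactor_orthogonal z : ~ exceptional z -> orthogonal_mx (sfactor l z).
Proof.
move=> zE; apply/orthogonalP; rewrite {1}/sfactor adj_splitting // -sfactorN.
exact: sfactorK.
Qed.

End Null.

Local Notation cj := (map_mx (Num.conj : C -> C)).

Lemma conj_lform (u w : 'cV[C]_(n + 2)) :
  Num.conj (lform u w) = lform (cj u) (cj w).
Proof.
rewrite /lform rmorphB rmorphM rmorphD !rmorphM fmorphV rmorph_nat /dot.
rewrite rmorph_sum /lmu /lnu !mxE; congr (_ - _).
by apply: eq_bigr => i _; rewrite !mxE rmorphM.
Qed.

Lemma conj_rho : cj rho = rho :> 'M[C]_(n + 2).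
Proof.
by rewrite /rho map_block_mx !raddf0 raddfN /= !map_scalar_mx rmorph1.
Qed.

Lemma conj_gram : cj gram = gram :> 'M[C]_(n + 2).
Proof.
rewrite /gram map_block_mx !raddf0 map_scalar_mx rmorph1; congr block_mx.
apply/matrixP => i j; rewrite !mxE; case: ifP => _; first exact: rmorph0.
by rewrite rmorphN fmorphV rmorph_nat.
Qed.

Lemma conj_rhomul l : cj (rho *m l) = rho *m cj l.
Proof. by rewrite map_mxM conj_rho. Qed.

Lemma conj_outer (k : C) (u w : 'cV[C]_(n + 2)) :
  cj (k *: (u *m w^T *m gram)) = Num.conj k *: (cj u *m (cj w)^T *m gram).
Proof. by rewrite map_mxZ !map_mxM -map_trmx conj_gram. Qed.

Lemma conj_combination (c a b : C) (A B : 'M[C]_(n + 2)) :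
  cj (c%:M + a *: A + b *: B) =
  (Num.conj c)%:M + Num.conj a *: cj A + Num.conj b *: cj B.
Proof. by rewrite !map_mxD !map_mxZ map_scalar_mx. Qed.

(** Both real forms without the sign of [alpha ^ 2]. In the second case conjugation exchanges L with
    rho L and also, as it negates [alpha], the two coefficients of the simple factor; so the factor
    is compatible with conjugation in either case. *)
Definition reality l := (Num.conj alpha = alpha /\ cj l = l) \/
  (Num.conj alpha = - alpha /\ cj l = rho *m l).

Lemma sfactor_conj l z : lform l (rho *m l) != 0 -> reality l ->
  cj (sfactor l z) = sfactor l (Num.conj z).
Proof.
move=> lrl rl; have cs : Num.conj (lform l (rho *m l)) = lform l (rho *m l).
  rewrite conj_lform conj_rhomul; case: rl => -[_ ->] //.
  by rewrite mulmxA rho2 mul1mx lformC.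
have [pE mE] : (Num.conj alpha = alpha -> cj l = l ->
      cj (projp l) = projp l /\ cj (projm l) = projm l) /\
    (cj l = rho *m l -> cj (projp l) = projm l /\ cj (projm l) = projp l).
  have cs' : Num.conj (lform l (rho *m l))^-1 = (lform l (rho *m l))^-1.
    by rewrite -[in RHS]cs; exact: fmorphV.
  rewrite /projp /projm !conj_outer cs' conj_rhomul.
  by split=> [_ ->|->] //; rewrite mulmxA rho2 mul1mx.
rewrite /sfactor /splitting conj_combination rmorph1.
have conjB1 (x y : C) : Num.conj (x / y - 1) = Num.conj x / Num.conj y - 1.
  by rewrite rmorphB rmorph1 fmorph_div.
have cD : Num.conj (alpha + z) = Num.conj alpha + Num.conj z by rewrite rmorphD.
have cB : Num.conj (alpha - z) = Num.conj alpha - Num.conj z by rewrite rmorphB.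
rewrite !conjB1 cD cB.
case: rl => -[ca cl]; first by have [-> ->] := pE ca cl; rewrite ca.
have [-> ->] := mE cl; rewrite ca.
have N1 : - alpha - Num.conj z = - (alpha + Num.conj z) by rewrite opprD.
have N2 : - alpha + Num.conj z = - (alpha - Num.conj z) by rewrite opprB addrC.
by rewrite N1 N2 !invrN !mulrNN addrAC.
Qed.
End SimpleFactor.

(** * Cancellation of the poles *)

Section DressingKernel.
Context {C : numClosedFieldType} {n : nat}.
Implicit Types (F : 'M[C]_(n + 2)) (l : 'cV[C]_(n + 2)).

Definition proj0 l : 'M[C]_(n + 2) := 1%:M - projp l - projm l.

Lemma splittingE l (a b : C) :
  splitting l a 1 b = a *: projp l + proj0 l + b *: projm l.
Proof.
rewrite /splitting /proj0; move: (projp l) (projm l) => A B.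
by apply/matrixP => i j; rewrite !mxE; ring.
Qed.

(** The nine blocks are sorted by their poles: for [t = (alpha + z) / (alpha - z)] those with [t]
    are singular at [alpha], those with [s] at [- alpha], and the three diagonal blocks nowhere. *)
Lemma splitting_sandwich m (P O Q P' O' Q' F : 'M[C]_m) (s t : C) : s * t = 1 ->
  (s *: P + O + t *: Q) *m F *m (t *: P' + O' + s *: Q') =
  (P *m F *m P' + O *m F *m O' + Q *m F *m Q') +
  (t *: (O *m F *m P' + Q *m F *m O') + t ^+ 2 *: (Q *m F *m P')) +
  (s *: (P *m F *m O' + O *m F *m Q') + s ^+ 2 *: (P *m F *m Q')).
Proof.
move=> st; rewrite !mulmxDl !mulmxDr -!scalemxAl -!scalemxAr !scalerA st.
rewrite [t * s]mulrC st.
move: (P *m F *m P') (P *m F *m O') (P *m F *m Q') (O *m F *m P')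
  (O *m F *m O') (O *m F *m Q') (Q *m F *m P') (Q *m F *m O') (Q *m F *m Q').
by move=> *; apply/matrixP => i j; rewrite !mxE; ring.
Qed.

Variables l lh : 'cV[C]_(n + 2).
Hypothesis ll0 : lform l l = 0.
Hypothesis lrl : lform l (rho *m l) != 0.
Hypothesis lhlh0 : lform lh lh = 0.
Hypothesis lhrl : lform lh (rho *m lh) != 0.

Let c := (lform l (rho *m l))^-1.
Let c' := (lform lh (rho *m lh))^-1.

(* What remains of the terms with a pole at z = alpha in the product of F by the
   simple factors of l and lh, once F lh = l + (z - alpha) G and
   adj F l = lh + (z - alpha) H have been used to cancel that pole. *)
Definition dressing_kernel (alpha z : C) (G H : 'cV[C]_(n + 2)) : 'M[C]_(n + 2) :=
  - (alpha + z) *: (c' *: (proj0 l *m G *m ((rho *m lh)^T *m gram)) +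
                    c *: (rho *m l *m (H^T *m gram *m proj0 lh))) +
  (- ((alpha + z) ^+ 2 / 2)) *: ((G^T *m gram *m G) 0 0 *:
    ((c * c') *: (rho *m l *m ((rho *m lh)^T *m gram)))).

Lemma proj0_self : proj0 l *m l = 0.
Proof.
rewrite /proj0 !mulmxBl mul1mx projp_mul projm_mul ll0 mul0r scale0r subr0.
by rewrite lformC divff // scale1r subrr.
Qed.

Lemma tr_proj0 : lh^T *m gram *m proj0 lh = 0.
Proof.
rewrite /proj0 !mulmxBr mulmx1 /projp /projm; move: lhrl.
move: (rho *m lh) => v v0; rewrite -!scalemxAr !mulmxA !lform_mx lhlh0.
rewrite -!mulmxA !mul_scalar_mx scale0r scaler0 subr0 scalerA.
by rewrite mulVf // scale1r subrr.
Qed.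

Lemma tr_adj F : (adj F *m l)^T *m gram = l^T *m gram *m F.
Proof.
rewrite /adj !trmx_mul trmxK gram_tr gramV_tr -!mulmxA gramVK mulmx1.
by rewrite !mulmxA.
Qed.

(** Each simple pole is cancelled by one zero: [proj0 l] kills the value [l] of [F *m lh] at
    [alpha], and [proj0 lh] kills, from the right, the value [lh] of [adj F *m l]. The double pole
    needs two zeros of the pairing of [l] with [F *m lh]. *)
Lemma dressing_kernelE F G H alpha z : alpha - z != 0 ->
  lform (F *m lh) (F *m lh) = 0 ->
  F *m lh = l + (z - alpha) *: G -> adj F *m l = lh + (z - alpha) *: H ->
  let t := (alpha + z) / (alpha - z) in
  t *: (proj0 l *m F *m projp lh + projm l *m F *m proj0 lh) +
    t ^+ 2 *: (projm l *m F *m projp lh) = dressing_kernel alpha z G H.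
Proof.
move=> z1 FF0 FG FH t.
have z2 : z - alpha != 0 by rewrite -opprB oppr_eq0.
(* The second zero for the double pole: [F *m lh] and [l] are both null, so expanding the form on
   [l + (z - alpha) G] shows that [lform l G] vanishes at [alpha]. *)
have lG : lform l G = - ((z - alpha) * lform G G / 2).
  have : (z - alpha) * (2 * lform l G + (z - alpha) * lform G G) = 0.
    rewrite -FF0 FG !lformDl !lformDr !lformZl !lformZr ll0 [lform G l]lformC; ring.
  move/eqP; rewrite mulf_eq0 (negPf z2) /= addr_eq0 => /eqP E.
  by apply: (mulfI (_ : (2 : C) != 0)); rewrite ?pnatr_eq0 // E; field.
have E1 : proj0 l *m F *m projp lh =
    (z - alpha) *: (c' *: (proj0 l *m G *m ((rho *m lh)^T *m gram))).
  rewrite /projp -scalemxAr -!mulmxA [F *m (lh *m _)]mulmxA FG.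
  rewrite [(l + _) *m _]mulmxDl [proj0 l *m (_ + _)]mulmxDr.
  rewrite [proj0 l *m (l *m _)]mulmxA proj0_self mul0mx add0r.
  by rewrite -scalemxAl -scalemxAr scalerA mulrC -scalerA.
have E2 : projm l *m F *m proj0 lh =
    (z - alpha) *: (c *: (rho *m l *m (H^T *m gram *m proj0 lh))).
  have tD : (lh + (z - alpha) *: H)^T = lh^T + (z - alpha) *: H^T.
    by rewrite linearD linearZ.
  have tE : l^T *m gram *m F *m proj0 lh = (z - alpha) *: (H^T *m gram *m proj0 lh).
    rewrite -tr_adj FH tD [(lh^T + _) *m _]mulmxDl [(_ + _) *m proj0 lh]mulmxDl.
    by rewrite tr_proj0 add0r -!scalemxAl.
  rewrite /projm -!scalemxAl; move: tE; rewrite -!mulmxA => ->.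
  by rewrite -!scalemxAr scalerA mulrC -scalerA.
have E3 : projm l *m F *m projp lh = (- ((z - alpha) ^+ 2 / 2)) *:
    (lform G G *: ((c * c') *: (rho *m l *m ((rho *m lh)^T *m gram)))).
  rewrite /projm /projp -!scalemxAl -!scalemxAr -!mulmxA.
  rewrite [F *m (lh *m _)]mulmxA FG [gram *m (_ *m _)]mulmxA [l^T *m _]mulmxA.
  rewrite [l^T *m (gram *m _)]mulmxA lform_mx lformDr ll0 add0r lformZr lG.
  rewrite mul_scalar_mx -!scalemxAr !scalerA; congr (_ *: _).
  by rewrite -/c -/c'; ring.
rewrite E1 E2 E3 -scalerDr !scalerA /dressing_kernel -lformE scalerA scalerA.
by congr (_ *: _ + _ *: _); rewrite /t; field.
Qed.

Lemma rho_proj0 m : lform m (rho *m m) != 0 -> rho *m proj0 m *m rho = proj0 m.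
Proof.
move=> m0; rewrite /proj0 !mulmxBr !mulmxBl mulmx1 rho2 rho_projp rho_projm.
by rewrite addrAC.
Qed.

Lemma rho_sandwich (X F Y : 'M[C]_(n + 2)) :
  rho *m (X *m F *m Y) *m rho =
  (rho *m X *m rho) *m (rho *m F *m rho) *m (rho *m Y *m rho).
Proof.
rewrite !mulmxA; congr (_ *m _ *m _).
by rewrite -[_ *m rho *m rho]mulmxA rho2 mulmx1 -[_ *m rho *m rho]mulmxA rho2 mulmx1.
Qed.

Lemma rho_combination (t s : C) (X Y W : 'M[C]_(n + 2)) :
  rho *m (t *: (X + Y) + s *: W) *m rho =
  t *: (rho *m X *m rho + rho *m Y *m rho) + s *: (rho *m W *m rho).
Proof. by rewrite !mulmxDr !mulmxDl -!scalemxAr -!scalemxAl !mulmxDr !mulmxDl. Qed.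

(** Conjugation by [rho] swaps the outer projections, and replacing [z] by [- z] swaps [s] and [t].
    Hence the terms singular at [- alpha] are the [rho]-conjugates, at [- z], of those singular at
    [alpha], and one kernel serves for both poles. *)
Lemma dressing_formula F Fm G H Gm Hm alpha z :
  alpha - z != 0 -> alpha + z != 0 -> rho *m Fm *m rho = F ->
  lform (F *m lh) (F *m lh) = 0 -> lform (Fm *m lh) (Fm *m lh) = 0 ->
  F *m lh = l + (z - alpha) *: G -> adj F *m l = lh + (z - alpha) *: H ->
  Fm *m lh = l + (- z - alpha) *: Gm -> adj Fm *m l = lh + (- z - alpha) *: Hm ->
  sfactor alpha l z *m F *m sfactor alpha lh (- z) =
  (projp l *m F *m projp lh + proj0 l *m F *m proj0 lh + projm l *m F *m projm lh)
  + dressing_kernel alpha z G H + rho *m dressing_kernel alpha (- z) Gm Hm *m rho.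
Proof.
move=> z1 z2 FmF F0 Fm0 FG FH FmG FmH.
rewrite sfactorN /sfactor !splittingE splitting_sandwich; last first.
  by rewrite mulrA divfK // divff.
rewrite (dressing_kernelE z1 F0 FG FH).
have z2' : alpha - - z != 0 by rewrite opprK.
rewrite -(dressing_kernelE z2' Fm0 FmG FmH) opprK.
rewrite rho_combination !rho_sandwich FmF.
rewrite !rho_proj0 // !rho_projp !rho_projm.
by rewrite [_ + projp l *m F *m proj0 lh]addrC.
Qed.
End DressingKernel.

(** * Existence of the factorisation *)

Section SimpleFactorLoop.
Context {R : realType} {n : nat}.
Local Notation C := R[i].
Implicit Types (l : 'cV[C]_(n + 2)) (z : C).
Variable alpha : C.
Hypothesis alpha0 : alpha != 0.

Lemma sfactor_Gminus l : lform l l = 0 -> lform l (rho *m l) != 0 ->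
  reality alpha l -> Gminus (sfactor alpha l).
Proof.
move=> ll0 lrl rl; pose q : {poly C} := Poly [:: alpha ^+ 2; 0; -1].
have qs : polyseq q = [:: alpha ^+ 2; 0; -1] by rewrite (@PolyK _ 0) //= oppr_eq0 oner_eq0.
have qE z : q.[z] = (alpha - z) * (alpha + z) by rewrite horner_Poly /=; ring.
have exc z : q.[z] != 0 -> ~ exceptional alpha z.
  rewrite qE mulf_eq0 negb_or => /andP[z1 z2]; rewrite /exceptional /= !inE.
  by case/orP => /eqP E; move: z1 z2; rewrite E ?subrr ?subrr ?eqxx.
(* The coefficients of 1, [z] and [z ^ 2] in [(alpha - z)^2 projp + (alpha^2 - z^2) proj0 + (alpha +
   z)^2 projm]. *)
exists (\matrix_(i, j) Poly [:: alpha ^+ 2 * (i == j)%:R;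
  2 * alpha * (projm l i j - projp l i j);
  2 * (projp l i j + projm l i j) - (i == j)%:R]), q; split.
- by rewrite qE subr0 addr0 mulf_neq0.
- by move=> i j; rewrite mxE qs (leq_trans (size_Poly _)).
- move=> z qz; have := qz; rewrite qE mulf_eq0 negb_or => /andP[z1 z2].
  rewrite /sfactor /splitting; move: (projp l) (projm l) => A B.
  apply/matrixP => i j; rewrite !mxE horner_Poly /= -mulr_natr.
  by field; rewrite z1 z2.
split.
- by move=> z /exc; exact: sfactor_orthogonal.
- exact: sfactor0.
- by move=> z _ _; rewrite rho_sfactor.
- by move=> z _ _; rewrite -sfactor_conj.
Qed.

Lemma entireM (f g : C -> C) : entire f -> entire g -> entire (fun z => f z * g z).
Proof. by move=> ef eg m; apply: papproxM; [exact: ef|exact: eg]. Qed.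

Lemma mxentireMcl p q r (A : 'M[C]_(p, q)) (F : C -> 'M[C]_(q, r)) :
  mxentire F -> mxentire (fun z => A *m F z).
Proof. exact: mxentireM (mxentire_cst A). Qed.

Lemma mxentireMcr p q r (A : 'M[C]_(q, r)) (F : C -> 'M[C]_(p, q)) :
  mxentire F -> mxentire (fun z => F z *m A).
Proof. by move=> eF; exact: mxentireM eF (mxentire_cst A). Qed.

Lemma is_derive_ratio (s : C) : (s = 1) \/ (s = -1) ->
  is_derive (0 : C^o) 1 (fun z : C^o => (alpha - s * z) / (alpha + s * z) : C^o)
    (- 2 * s / alpha).
Proof.
move=> s1; have lin (t : C) :
    is_derive (0 : C^o) 1 (fun z : C^o => alpha + t * z : C^o) t.
  have := is_deriveD (is_derive_cst (alpha : C^o) (0 : C^o) (1 : C^o))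
    (is_deriveZ t (is_derive_id (0 : C^o) (1 : C^o))).
  by rewrite add0r [t *: 1]mulr1.
have linV : is_derive (0 : C^o) 1 (fun z : C^o => (alpha + s * z)^-1 : C^o)
    (- s / alpha ^+ 2).
  have [d1 d2] := lin s; have a0 : alpha + s * 0 != 0 by rewrite mulr0 addr0.
  apply: DeriveDef; first exact: (@derivableV C C^o (fun z => alpha + s * z)).
  rewrite (@deriveV C C^o (fun z => alpha + s * z)) // d2 mulr0 addr0.
  by rewrite /GRing.scale /= mulNr mulrC mulNr.
have -> : - 2 * s / alpha = alpha *: (- s / alpha ^+ 2 : C^o) + alpha^-1 *: (- s : C^o).
  by rewrite /GRing.scale /=; field.
have := is_deriveM (lin (- s)) linV; rewrite !mulr0 !addr0.
by under eq_fun do rewrite mulNr.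
Qed.

Lemma deriv0_eq (g : C -> 'M[C]_(n + 2)) D : mxderiv g 0 D -> Defs.deriv0 g = D.
Proof. by move=> gD; apply/matrixP => i j; rewrite mxE; exact: derive1_val. Qed.

Lemma mxderiv_splitting l (a b : C -> C) (da db : C) :
  is_derive (0 : C^o) 1 (a : C^o -> C^o) da ->
  is_derive (0 : C^o) 1 (b : C^o -> C^o) db ->
  mxderiv (fun z => splitting l (a z) 1 (b z)) 0 (da *: projp l + db *: projm l).
Proof.
move=> ad bd i j; rewrite /splitting.
have -> : (fun z : C^o => (1%:M + (a z - 1) *: projp l + (b z - 1) *: projm l) i j : C^o) =
    (fun z : C^o => (1%:M - projp l - projm l : 'M[C]_(n + 2)) i j +
       (projp l i j * a z + projm l i j * b z) : C^o).
  apply/funext => z; move: (projp l) (projm l) => A B; rewrite !mxE; ring.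
have -> : (da *: projp l + db *: projm l) i j =
    0 + (projp l i j *: (da : C^o) + projm l i j *: (db : C^o)) :> C^o.
  by move: (projp l) (projm l) => A B; rewrite !mxE /GRing.scale /=; ring.
exact: is_deriveD.
Qed.

Lemma is_derive_ratioN :
  is_derive (0 : C^o) 1 (fun z : C^o => (alpha - z) / (alpha + z) : C^o) (- 2 / alpha).
Proof.
have := @is_derive_ratio 1 (or_introl erefl); rewrite mulr1.
by under eq_fun do rewrite mul1r.
Qed.

Lemma is_derive_ratioP :
  is_derive (0 : C^o) 1 (fun z : C^o => (alpha + z) / (alpha - z) : C^o) (2 / alpha).
Proof.
have := @is_derive_ratio (-1) (or_intror erefl); rewrite mulrNN mulr1.
by under eq_fun do rewrite mulN1r opprK.
Qed.

Lemma mxderiv_sfactor l :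
  mxderiv (sfactor alpha l) 0 ((2 / alpha) *: (projm l - projp l)).
Proof.
rewrite scalerBr addrC -scaleNr -mulNr.
exact: mxderiv_splitting is_derive_ratioN is_derive_ratioP.
Qed.

Lemma mxderiv_sfactorN l :
  mxderiv (fun z => sfactor alpha l (- z)) 0 ((2 / alpha) *: (projp l - projm l)).
Proof.
under eq_fun do rewrite sfactorN; rewrite scalerBr -scaleNr -mulNr.
exact: mxderiv_splitting is_derive_ratioP is_derive_ratioN.
Qed.

Lemma mul3_eq (A B D A' B' D' : 'M[C]_(n + 2)) :
  A = A' -> B = B' -> D = D' -> A *m B *m D = A' *m B' *m D'.
Proof. by move=> -> -> ->. Qed.

Lemma mul3K (A B D E : 'M[C]_(n + 2)) : D *m E = 1%:M -> A *m B *m D *m E = A *m B.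
Proof. by move=> DE; rewrite -[LHS]mulmxA DE mulmx1. Qed.

Lemma conj_mul3 (A B D : 'M[C]_(n + 2)) :
  conj_mx (A *m B *m D) = conj_mx A *m conj_mx B *m conj_mx D.
Proof. by rewrite /conj_mx !map_mxM. Qed.

Section Factorisation.
Variables (Phi : C -> 'M[C]_(n + 2)) (l lh : 'cV[C]_(n + 2)).
Hypothesis Phi_plus : Gplus Phi.
Hypothesis Phi_entire : mxentire Phi.
Hypothesis Phi_lh : Phi alpha *m lh = l.
Hypothesis ll0 : lform l l = 0.
Hypothesis lrl : lform l (rho *m l) != 0.
Hypothesis lhrl : lform lh (rho *m lh) != 0.
Hypothesis lreal : reality alpha l.
Hypothesis lhreal : reality alpha lh.

(* The factorisation is p_l Phi = (p_l Phi p_lh^-1) p_lh, where the first factor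
   is entire because Phi alpha maps lh to l. *)
Lemma sharp_sfactor : exists2 hp, sharp (sfactor alpha l) Phi hp &
  Defs.deriv0 hp = Defs.deriv0 (sfactor alpha l) + Defs.deriv0 Phi +
    (2 / alpha) *: (projp lh - projm lh).
Proof.
have [Phi_hol Phi_orth Phi0 Phi_rho Phi_conj] := Phi_plus.
have lhlh0 : lform lh lh = 0 by rewrite -(Phi_orth alpha) Phi_lh.
have [G eG FG] : exists2 G, mxentire G &
    forall z, Phi z *m lh = l + (z - alpha) *: G z.
  have [|G eG FG] := @mxentire_division _ _ _ (fun z => Phi z *m lh) alpha.
    exact: mxentireM Phi_entire (mxentire_cst lh).
  by exists G => // z; rewrite FG Phi_lh.
have [H eH FH] : exists2 H, mxentire H &
    forall z, adj (Phi z) *m l = lh + (z - alpha) *: H z.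
  have [|H eH FH] := @mxentire_division _ _ _ (fun z => adj (Phi z) *m l) alpha.
    exact: mxentireM (mxentire_adj Phi_entire) (mxentire_cst l).
  exists H => // z; rewrite FH -[in adj _ *m l]Phi_lh mulmxA.
  by have /orthogonalP -> := Phi_orth alpha; rewrite mul1mx.
pose kern z := dressing_kernel l lh alpha z (G z) (H z).
pose hp z := (projp l *m Phi z *m projp lh + proj0 l *m Phi z *m proj0 lh +
  projm l *m Phi z *m projm lh) + kern z + rho *m kern (- z) *m rho.
have hpE z : ~ exceptional alpha z ->
    hp z = sfactor alpha l z *m Phi z *m sfactor alpha lh (- z).
  move=> /not_exceptional[z1 z2]; rewrite /hp /kern.
  have F0 w : lform (Phi w *m lh) (Phi w *m lh) = 0 by rewrite Phi_orth.
  have PhiN : rho *m Phi (- z) *m rho = Phi z by rewrite Phi_rho opprK.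
  exact: (esym (dressing_formula ll0 lrl lhlh0 lhrl z1 z2 PhiN (F0 z) (F0 (- z))
    (FG z) (FH z) (FG (- z)) (FH (- z)))).
have e_lin : entire (fun z => alpha + z).
  by move=> m; apply: papproxD; [exact: papprox_cst|
    have := @papprox_poly R m 'X; under eq_fun do rewrite hornerX].
have ecst (a : C) : entire (fun=> a) by move=> m; exact: papprox_cst.
have kern_entire : mxentire kern.
  rewrite /kern /dressing_kernel; apply: mxentireD.
    apply: mxentireZ.
      under eq_fun do rewrite -mulN1r; exact: entireM.
    apply: mxentireD; apply: (@mxentireZ _ _ _ (fun=> _)) => //.
      by apply: mxentireMcr; exact: mxentireMcl.
    apply: (@mxentireM _ _ _ _ (fun=> _)); first exact: mxentire_cst.
    by do 2![apply: mxentireMcr]; exact: mxentire_tr.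
  apply: mxentireZ.
    under eq_fun do rewrite expr2 -mulrA -mulN1r; apply: entireM => //.
    by apply: entireM => //; exact: entireM.
  apply: mxentireZ; last exact: mxentire_cst.
  have := @mxentireM _ _ _ _ (fun z => (G z)^T *m gram) G _ eG; apply.
  by apply: mxentireMcr; exact: mxentire_tr.
have hp_entire : mxentire hp.
  rewrite /hp; apply: mxentireD; last first.
    by apply: mxentireMcr; apply: mxentireMcl; exact: mxentire_oppz.
  have eS (X Y : 'M[C]_(n + 2)) : mxentire (fun z => X *m Phi z *m Y).
    by apply: mxentireMcr; exact: mxentireMcl.
  apply: mxentireD kern_entire.
  exact: mxentireD (mxentireD (eS _ _) (eS _ _)) (eS _ _).
have hp_cont := mxentire_cont hp_entire; clearbody hp kern.
(* The defining properties of [Gplus] hold for the three factors away from the poles; the set of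
   poles is stable under negation and conjugation, and continuity of [hp] fills it in. *)
have Ex := exceptional_finite alpha.
have nN z : ~ exceptional alpha z -> ~ exceptional alpha (- z).
  by move=> zE zN; apply: zE; move: zN; rewrite /exceptional /= !inE eqr_oppLR
    eqr_opp orbC.
have ca : Num.conj alpha = alpha \/ Num.conj alpha = - alpha.
  by case: lreal => -[? _]; [left|right].
have nC z : ~ exceptional alpha z -> ~ exceptional alpha (Num.conj z).
  move=> zE zC; apply: zE; move: zC; rewrite /exceptional /= !inE.
  have cc : Num.conj (Num.conj z) = z by rewrite conjCK.
  have cN : Num.conj (- alpha) = - Num.conj alpha by rewrite rmorphN.
  by case: ca => ca /orP[] /eqP E; rewrite -cc E ?cN ca ?opprK eqxx ?orbT.
have hp_orth z : orthogonal_mx (hp z).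
  apply/orthogonalP; move: z; apply: (mxcont_eq Ex).
  - by apply: mxcontM => //; exact: mxcont_adj.
  - exact: mxcont_cst.
  - move=> z zE; apply/orthogonalP; rewrite (hpE z zE).
    have o1 := sfactor_orthogonal ll0 lrl zE.
    have o2 := sfactor_orthogonal lhlh0 lhrl (nN z zE).
    exact: orthogonal_mul (orthogonal_mul o1 (Phi_orth z)) o2.
have E0 : ~ exceptional alpha 0.
  by rewrite /exceptional /= !inE ![0 == _]eq_sym oppr_eq0 (negPf alpha0).
have hp0 : hp 0 = 1%:M.
  by rewrite (hpE 0 E0) oppr0 !(sfactor0 alpha0) Phi0 !mul1mx.
have hp_rho : forall z, rho *m hp z *m rho = hp (- z).
  apply: (mxcont_eq Ex).
  - exact: mxcontM (mxcontM (mxcont_cst rho) hp_cont) (mxcont_cst rho).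
  - by apply: mxcont_comp => //; exact: ccont_opp.
  - move=> z zE; rewrite (hpE z zE) (hpE _ (nN z zE)) rho_sandwich.
    exact: mul3_eq (rho_sfactor _ z lrl) (Phi_rho z) (rho_sfactor _ (- z) lhrl).
have hp_conj : forall z, conj_mx (hp z) = hp (Num.conj z).
  apply: (mxcont_eq Ex).
  - exact: mxcont_conj.
  - by apply: mxcont_comp => //; exact: ccont_conj.
  - move=> z zE; rewrite (hpE z zE) (hpE _ (nC z zE)) conj_mul3.
    have cN : Num.conj (- z) = - Num.conj z by rewrite rmorphN.
    rewrite -cN; exact: mul3_eq (sfactor_conj z lrl lreal) (Phi_conj z)
      (sfactor_conj (- z) lhrl lhreal).
exists hp.
  split.
    split; [|exact: hp_orth|exact: hp0|exact: hp_rho|exact: hp_conj].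
    by move=> i j z; exact: (@entire_derivable _ (fun z => hp z i j) z (hp_entire i j)).
  exists (sfactor alpha lh); first exact: (sfactor_Gminus lhlh0 lhrl lhreal).
  apply: sub_finite_set Ex => z /= zE; apply: contrapT => zN; apply: zE.
  by rewrite (hpE z zN); exact: esym (mul3K _ _ (sfactorK lhlh0 lhrl zN)).
have Phi_der : mxderiv Phi 0 (Defs.deriv0 Phi).
  move=> i j; rewrite mxE derive1E; apply: DeriveDef => //; exact: Phi_hol.
rewrite (deriv0_eq (mxderiv_sfactor l)); apply: deriv0_eq.
(* All three factors are 1 at 0, so the product rule just adds their derivatives. The product agrees
   with [hp] on the disc of radius [|alpha|], which contains no pole. *)
have := mxderivM (mxderivM (mxderiv_sfactor l) Phi_der) (mxderiv_sfactorN lh).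
rewrite oppr0 !(sfactor0 alpha0) Phi0 !mul1mx !mulmx1; apply: mxderiv_ext.
have a_pos : 0 < `|alpha| by rewrite normr_gt0.
apply/(@nbhs_normP _ C^o); exists `|alpha| => // z /=; rewrite sub0r normrN => za.
rewrite hpE // /exceptional /= !inE => /orP[] /eqP E.
  by rewrite E ltxx in za.
by rewrite E normrN ltxx in za.
Qed.
End Factorisation.

End SimpleFactorLoop.

(** * Absence of a factorisation for a stable line *)

Section Converse.
Context {R : realType}.
Local Notation C := R[i].

Lemma root_finite (q : {poly C}) : q != 0 -> finite_set [set z | q.[z] = 0].
Proof.
move=> q0; have [r qE] := closed_field_poly_normal q.
apply: (sub_finite_set (B := [set` r])); last exact: finite_seq.
move=> z /= qz; rewrite -root_prod_XsubC /root.
move: qz; rewrite {1}qE hornerZ => /eqP.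
by rewrite mulf_eq0 lead_coef_eq0 (negPf q0).
Qed.

(** The roots of [q] are divided out one at a time: a root [a] of [q] is a root of [N], and after
    cancelling [z - a] the identity holds off [a], hence at [a] by continuity of [f]. *)
Lemma continuous_poly_quotient (N q : {poly C}) (f : C -> C) : q != 0 -> ccont f ->
  (forall z, N.[z] = q.[z] * f z) -> exists2 S, N = q * S & forall z, f z = S.[z].
Proof.
move=> q0 cf NqF.
have [S NS] : exists S, N = q * S.
  have [k] := ubnP (size q); elim: k q N q0 NqF => // k IH q N q0 NqF qk.
  have [sq|sq] := eqVneq (size q) 1%N.
    have /size_poly1P[c c0 ->] : size q == 1%N by rewrite sq.
    by exists (c^-1 *: N); rewrite mul_polyC scalerA divff // scale1r.
  have [a qa] := closed_rootP q sq.
  have [q1 qE] := factor_theorem q a qa.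
  have Na : root N a by rewrite /root NqF (rootP qa) mul0r.
  have [N1 NE] := factor_theorem N a Na.
  have q10 : q1 != 0 by apply: contra_neq q0 => E; rewrite qE E mul0r.
  have [| |S N1E] := IH q1 N1 q10.
  - apply: (continuous_eq_cofinite (finite_set1 a)); first exact: ccont_horner.
      by apply: ccontM => //; exact: ccont_horner.
    move=> z za; apply: (mulIf (_ : z - a != 0)).
      by rewrite subr_eq0; apply/eqP.
    have := NqF z; rewrite NE qE !hornerM hornerXsubC => ->.
    by rewrite mulrAC.
  - by rewrite -ltnS (leq_trans _ qk) // qE size_mul ?polyXsubC_eq0 // size_XsubC addn2.
  - by exists S; rewrite NE N1E qE mulrAC.
exists S => //; apply: (continuous_eq_cofinite (root_finite q0)) => //.
  exact: ccont_horner.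
move=> z /eqP qz; apply: (mulfI qz); by rewrite -NqF NS hornerM.
Qed.

Lemma quadratic_eq0 (S : {poly C}) (a : C) : a != 0 -> (size S <= 3)%N ->
  S.[0] = 0 -> S.[a] = 0 -> S.[- a] = 0 -> S = 0.
Proof.
move=> a0 sS S0 Sa Sna; apply: (@roots_geq_poly_eq0 _ S [:: 0; a; - a]).
- by rewrite /= /root S0 Sa Sna eqxx.
- rewrite /= !inE ![0 == _]eq_sym oppr_eq0 (negPf a0) /= andbT.
  by rewrite -addr_eq0 -mulr2n mulrn_eq0 (negPf a0).
- by [].
Qed.

Context {n : nat}.

Section Generic.
Context {K : numClosedFieldType}.
Variables (alpha : K) (l : 'cV[K]_(n + 2)).

(** The simple factor times [alpha^2 - z^2], which also makes sense at the poles, where only one of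
    the two outer projections survives. *)
Definition sfactor_num z : 'M[K]_(n + 2) :=
  splitting l ((alpha - z) ^+ 2) ((alpha - z) * (alpha + z)) ((alpha + z) ^+ 2).

Lemma splitting_cst k : splitting l k k k = k%:M.
Proof. by rewrite /splitting subrr !scale0r !addr0. Qed.

Lemma sfactor_numE z : ~ exceptional alpha z ->
  sfactor_num z = ((alpha - z) * (alpha + z)) *: sfactor alpha l z.
Proof.
move=> /not_exceptional[z1 z2]; rewrite /sfactor_num /sfactor /splitting.
move: (projp l) (projm l) => A B; apply/matrixP => i j; rewrite !mxE -mulr_natr.
by rewrite -[1 *+ _]mulr_natr; field; rewrite z1 z2.
Qed.

Lemma sfactor_num_adj z : lform l l = 0 -> lform l (rho *m l) != 0 ->
  adj (sfactor_num z) *m sfactor_num z = (((alpha - z) * (alpha + z)) ^+ 2)%:M.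
Proof.
move=> l0 l1; rewrite /sfactor_num adj_splitting // splittingM // -splitting_cst.
by congr splitting; ring.
Qed.

Lemma sfactor_num_form z w : lform l l = 0 -> lform l (rho *m l) != 0 ->
  lform (sfactor_num z *m w) (sfactor_num z *m w) =
  ((alpha - z) * (alpha + z)) ^+ 2 * lform w w.
Proof.
move=> l0 l1; rewrite lform_adj mulmxA sfactor_num_adj //.
by rewrite mul_scalar_mx lformZr.
Qed.

Lemma sfactor_num_at w : lform l (rho *m l) != 0 ->
  sfactor_num alpha *m w =
  (4 * alpha ^+ 2 * (lform l w / lform l (rho *m l))) *: (rho *m l).
Proof.
move=> l1; rewrite /sfactor_num splitting_mul subrr expr0n mul0r scale0r add0r.
rewrite subrr mul0r scale0r add0r subr0; congr (_ *: _); ring.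
Qed.

Lemma sfactor_num_atN w : lform l (rho *m l) != 0 ->
  sfactor_num (- alpha) *m w =
  (4 * alpha ^+ 2 * (lform (rho *m l) w / lform l (rho *m l))) *: l.
Proof.
move=> l1; rewrite /sfactor_num splitting_mul subrr expr0n mulr0 scale0r add0r.
rewrite subrr mul0r scale0r addr0 subr0 opprK; congr (_ *: _); ring.
Qed.

Lemma sfactor_num_at0 w : lform l (rho *m l) != 0 -> lform l w = 0 ->
  sfactor_num alpha *m w = 0.
Proof. by move=> l1 lw; rewrite sfactor_num_at // lw mul0r mulr0 scale0r. Qed.

Lemma sfactor_num_atN0 w : lform l (rho *m l) != 0 -> lform (rho *m l) w = 0 ->
  sfactor_num (- alpha) *m w = 0.
Proof. by move=> l1 lw; rewrite sfactor_num_atN // lw mul0r mulr0 scale0r. Qed.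

Lemma mulmx3A p (A B D : 'M[K]_(n + 2)) (w : 'M[K]_(n + 2, p)) :
  A *m B *m D *m w = A *m (B *m (D *m w)).
Proof. by rewrite !mulmxA. Qed.

Lemma sfactor_num0 : sfactor_num 0 = (alpha ^+ 2)%:M.
Proof. by rewrite /sfactor_num subr0 addr0 -expr2 splitting_cst. Qed.

(** The difference of [T w0] and [m w0] is orthogonal to the hyperplane orthogonal to [lh], so it is
    a multiple [k lh]; since [lh] is null, comparing the form on [T w0] and on [w0] leaves
    [2 m k = 0]. *)
Lemma null_hyperplane (T : 'M[K]_(n + 2)) (m : K) (lh w0 : 'cV[K]_(n + 2)) :
  m != 0 -> lform lh lh = 0 -> lform lh w0 = 1 ->
  (forall w, lform (T *m w) (T *m w) = m ^+ 2 * lform w w) ->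
  (forall w, lform lh w = 0 -> T *m w = m *: w) -> T *m w0 = m *: w0.
Proof.
move=> m0 lh0 lhw0 Tm Tlh.
have Tm2 w w' : lform (T *m w) (T *m w') = m ^+ 2 * lform w w'.
  have := Tm (w + w'); rewrite mulmxDr !lformDl !lformDr !Tm.
  rewrite [lform (T *m w') _]lformC [lform w' w]lformC => E.
  apply: (mulfI (_ : (2 : K) != 0)); first by rewrite pnatr_eq0.
  transitivity (m ^+ 2 * lform w w + lform (T *m w) (T *m w') +
    (lform (T *m w) (T *m w') + m ^+ 2 * lform w' w') -
    m ^+ 2 * lform w w - m ^+ 2 * lform w' w'); first by ring.
  by rewrite E; ring.
pose u := T *m w0 + (- m) *: w0.
have ul w : lform lh w = 0 -> lform u w = 0.
  move=> w0'; apply: (mulfI m0); rewrite mulr0 /u lformDl lformZl.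
  have := Tm2 w0 w; rewrite (Tlh w w0') lformZr => E.
  by rewrite mulrDr E; ring.
have uE : u = lform u w0 *: lh.
  apply/eqP; rewrite -subr_eq0; apply/eqP/lform_nondeg => w.
  rewrite -scaleNr lformDl lformZl.
  have : lform u (w + (- lform lh w) *: w0) = 0.
    by apply: ul; rewrite lformDr lformZr lhw0 mulr1 subrr.
  by rewrite lformDr lformZr => /eqP; rewrite addr_eq0 mulNr opprK => /eqP ->; ring.
set k := lform u w0 in uE.
have TE : T *m w0 = m *: w0 + k *: lh by rewrite -uE /u scaleNr addrC subrK.
have := Tm w0; rewrite TE !lformDl !lformDr !lformZl !lformZr lh0 lhw0.
rewrite [lform w0 lh]lformC lhw0 => E.
have /eqP : 2 * (m * k) = 0.
  by apply: (addrI (m ^+ 2 * lform w0 w0)); rewrite addr0 -[RHS]E; ring.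
rewrite !mulf_eq0 pnatr_eq0 (negPf m0) /= => /eqP ->.
by rewrite scale0r addr0.
Qed.
End Generic.

Lemma mxcont_splitting (l : 'cV[C]_(n + 2)) (a c b : C -> C) :
  ccont a -> ccont c -> ccont b -> mxcont (fun z => splitting l (a z) (c z) (b z)).
Proof.
move=> ca cc cb; rewrite /splitting.
have cB f g : ccont f -> ccont g -> ccont (fun z => f z - g z).
  move=> cf cg; apply: ccontD => //; under eq_fun do rewrite -mulN1r.
  by apply: ccontM => //; exact: ccont_cst.
apply: mxcontD; last by apply: mxcontZ; [exact: cB|exact: mxcont_cst].
apply: mxcontD; last by apply: mxcontZ; [exact: cB|exact: mxcont_cst].
under eq_fun do rewrite -scalemx1; apply: mxcontZ => //; exact: mxcont_cst.
Qed.

Lemma ccont_poly_eq (P : {poly C}) (f : C -> C) : (forall z, P.[z] = f z) -> ccont f.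
Proof. by move=> /funext <-; exact: ccont_horner. Qed.

(* If p_l Phi = hp hm, then S = (alpha^2 - z^2) hp^-1 p_l Phi is a polynomial of
   degree at most 2 in z.  For w orthogonal to lh, the values of S w at 0, alpha
   and - alpha are those of (alpha^2 - z^2) w; hence S = (alpha^2 - z^2) 1, which
   contradicts S alpha <> 0. *)
Lemma sharp_not_stable (alpha : C) (Phi hp : C -> 'M[C]_(n + 2))
    (l lh : 'cV[C]_(n + 2)) : alpha != 0 -> Gplus Phi ->
  Phi alpha *m lh = l -> lform l l = 0 -> lform l (rho *m l) != 0 ->
  rho *m lh = - lh -> ~ sharp (sfactor alpha l) Phi hp.
Proof.
move=> alpha0 PhiG Philh ll0 lrl rlh [hpG [hm [P [q [q0 szP hmE _]]] finE]].
have [_ Phi_orth Phi0 Phi_rho _] := PhiG; have [_ hp_orth hp0 _ _] := hpG.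
pose m z := (alpha - z) * (alpha + z).
pose phi z := adj (hp z) *m sfactor_num alpha l z *m Phi z.
pose mp : {poly C} := (alpha%:P - 'X) * (alpha%:P + 'X).
have mpE z : mp.[z] = m z by rewrite /mp !hornerE.
have szm : (size mp <= 3)%N.
  apply: (leq_trans (size_polyMleq _ _)); rewrite -ltnS.
  have s1 : (size (alpha%:P - 'X : {poly C})%R <= 2)%N.
    by rewrite -opprB size_polyN size_XsubC.
  have s2 : (size (alpha%:P + 'X : {poly C})%R <= 2)%N.
    by rewrite addrC -[alpha]opprK polyCN size_XsubC.
  have := leq_add s1 s2; case: (_ + _)%N => [|k] //.
have q_n0 : q != 0 by apply: contra_neq q0 => ->; rewrite horner0.
have cphi : mxcont phi.
  apply: mxcontM; last exact: Gplus_mxcont.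
  apply: mxcontM; first by apply: mxcont_adj; exact: Gplus_mxcont.
  apply: mxcont_splitting.
  - by apply: (@ccont_poly_eq ((alpha%:P - 'X) ^+ 2)) => z; rewrite !hornerE.
  - exact: ccont_poly_eq mpE.
  - by apply: (@ccont_poly_eq ((alpha%:P + 'X) ^+ 2)) => z; rewrite !hornerE.
(* Off a finite set [phi] is [alpha^2 - z^2] times [hm], that is [mp * P / q]; since [phi] is
   continuous, the quotient is a polynomial. Holomorphy of [hm] at infinity bounds the degree of [P]
   by that of [q], which leaves degree at most 2. *)
have phiS i j : exists S : {poly C}, (size S <= 3)%N /\ forall z, phi z i j = S.[z].
  have [|S NS phiE] := @continuous_poly_quotient (mp * P i j) q (fun z => phi z i j)
    q_n0 (cphi i j).
    move=> z; rewrite hornerM mpE.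
    pose E := exceptional alpha `|` [set z | q.[z] = 0] `|`
      [set z | sfactor alpha l z *m Phi z <> hp z *m hm z].
    have finEE : finite_set E.
      rewrite /E !finite_setU; split => //; split; last exact: root_finite.
      exact: exceptional_finite.
    move: z; apply: (continuous_eq_cofinite finEE).
    - apply: (@ccont_poly_eq (mp * P i j)) => z; by rewrite hornerM mpE.
    - by apply: ccontM; [exact: ccont_horner|exact: cphi].
    move=> z zE; have [z1 [z2 z3]] : ~ exceptional alpha z /\ q.[z] != 0 /\
        sfactor alpha l z *m Phi z = hp z *m hm z.
      split; first by move=> ?; apply: zE; left; left.
      split; first by apply/eqP => ?; apply: zE; left; right.
      by apply: contrapT => ?; apply: zE; right.
    have -> : phi z = m z *: hm z.
      rewrite /phi sfactor_numE // -scalemxAr -scalemxAl -mulmxA z3 mulmxA.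
      by have /orthogonalP -> := hp_orth z; rewrite mul1mx.
    by rewrite hmE // !mxE mulrCA [q.[z] * _]mulrC divfK.
  exists S; split => //; have [->|S0] := eqVneq S 0; first by rewrite size_poly0.
  have szq : (0 < size q)%N by rewrite size_poly_gt0.
  have szS : (0 < size S)%N by rewrite size_poly_gt0.
  have := size_polyMleq mp (P i j); rewrite NS size_mul //.
  have := szP i j; move: szm szq szS; clear.
  by move: (size mp) (size (P i j)) (size q) (size S) => *; lia.
have fix_perp w : lform lh w = 0 -> forall z, phi z *m w = m z *: w.
  move=> lw z; apply/matrixP => i k; rewrite [k]ord1 {k}.
  have /choice[S HS] (k : 'I_(n + 2)) := phiS i k.
  pose T := \sum_k S k * (w k 0)%:P - mp * (w i 0)%:P.
  have TE y : T.[y] = (phi y *m w) i 0 - (m y *: w) i 0.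
    rewrite /T hornerD hornerN hornerM hornerC mpE horner_sum !mxE; congr (_ - _).
    by apply: eq_bigr => k _; rewrite hornerM hornerC; have [_ ->] := HS k.
  suff T0 : T = 0.
    by apply/eqP; rewrite -subr_eq0 -TE T0 horner0.
  have val0 y : phi y *m w = m y *: w -> T.[y] = 0 by move=> E; rewrite TE E subrr.
  have mulC_size (p : {poly C}) (c : C) : (size p <= 3)%N -> (size (p * c%:P)%R <= 3)%N.
    by move=> sp; rewrite mulrC mul_polyC (leq_trans (size_scale_leq _ _)).
  apply: (quadratic_eq0 alpha0).
  - rewrite (leq_trans (size_polyD _ _)) // geq_max size_polyN mulC_size // andbT.
    rewrite (leq_trans (size_sum _ _ _)) //; apply/bigmax_leqP => k _.
    by apply: mulC_size; have [] := HS k.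
  - apply: val0; rewrite /phi hp0 Phi0 mulmx1 sfactor_num0 /m subr0 addr0 -expr2.
    by rewrite /adj trmx1 mulmx1 gramVK mul1mx mul_scalar_mx.
  - have e : lform l (Phi alpha *m w) = 0 by rewrite -Philh Phi_orth lw.
    apply: val0; rewrite /phi mulmx3A (sfactor_num_at0 _ lrl e) mulmx0.
    by rewrite /m subrr mul0r scale0r.
  - have e : lform (rho *m l) (Phi (- alpha) *m w) = 0.
      rewrite -Phi_rho -Philh mulmx3A lform_rho Phi_orth -lform_rhoC rlh.
      by rewrite -scaleN1r lformZl lw mulr0.
    apply: val0; rewrite /phi mulmx3A (sfactor_num_atN0 _ lrl e) mulmx0.
    by rewrite /m subrr mulr0 scale0r.
have lhlh0 : lform lh lh = 0 by rewrite -(Phi_orth alpha) Philh.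
have [w0 lw0] : exists w0, lform lh w0 = 1.
  have [w lw] : exists w, lform lh w != 0.
    apply: contrapT => H; move: lrl; rewrite -Philh.
    suff -> : lh = 0 by rewrite mulmx0 lform0l eqxx.
    apply: lform_nondeg => u; apply/eqP/negPn/negP => lu; apply: H.
    by exists u.
  by exists ((lform lh w)^-1 *: w); rewrite lformZr mulVf.
have phi_orth z w : lform (phi z *m w) (phi z *m w) = m z ^+ 2 * lform w w.
  rewrite /phi mulmx3A (orthogonal_adj (hp_orth z)).
  by rewrite (sfactor_num_form _ _ _ ll0 lrl) Phi_orth.
(* [null_hyperplane] requires [m z != 0], so it is applied off the poles, and the value at [alpha]
   follows by continuity. *)
have phi0 : phi alpha *m w0 = 0.
  have := @mxcont_eq _ _ _ (fun z => phi z *m w0) (fun z => m z *: w0) _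
    (exceptional_finite alpha) _ _ _ alpha; rewrite /m subrr mul0r scale0r; apply.
  - by apply: mxcontM => //; exact: mxcont_cst.
  - by apply: mxcontZ; [exact: ccont_poly_eq mpE|exact: mxcont_cst].
  - move=> z zE; have /not_exceptional[z1 z2] := zE.
    apply: (null_hyperplane (lh := lh)) => //; first by rewrite mulf_neq0.
    by move=> w lw; exact: fix_perp.
(* On the other hand, [phi alpha *m w0] is a nonzero multiple of the image of [rho *m l] under the
   invertible [adj (hp alpha)]. *)
have e : lform l (Phi alpha *m w0) = 1 by rewrite -Philh Phi_orth.
move: phi0; rewrite /phi mulmx3A (sfactor_num_at _ _ lrl) e -scalemxAr.
move/eqP; rewrite scaler_eq0 !mulf_eq0 invr_eq0 (negPf lrl) oner_eq0 pnatr_eq0.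
rewrite (negPf alpha0) /= => /eqP/(congr1 (mulmx (hp alpha))).
rewrite mulmxA orthogonal_adjr // mul1mx mulmx0 => rl0.
by move: lrl; rewrite rl0 lform0r eqxx.
Qed.
End Converse.

(** * Calculus on a surface *)

Section PlaneCalculus.
Context {R : realType}.
Local Notation T := ('rV[R]_2).
Implicit Types (U V : set T) (F G : T -> R) (k : nat).
Local Notation e_ j := (delta_mx 0 j : T).

Lemma Ck_sub k U V F : V `<=` U -> Ck k U F -> Ck k V F.
Proof.
move=> VU; elim: k F => [|k IH] F /=; first by move=> FU u /VU; exact: FU.
by move=> [dF DF]; split=> [u /VU|j]; [exact: dF|exact: IH].
Qed.

Lemma near_open_eq U F G u : open U -> (forall w, U w -> F w = G w) -> U u ->
  \forall w \near u, F w = G w.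
Proof. by move=> oU FG Uu; apply: filterS (open_nbhs_nbhs (conj oU Uu)). Qed.

(** For [differentiable_near_eq]: two functions with the same germ differ by one that vanishes near
    the point. *)
Lemma differentiable_near0 F u : (\forall w \near u, F w = 0) -> differentiable F u.
Proof.
move=> F0; have Fu : F u = 0 by exact: nbhs_singleton F0.
have z0 : continuous (\0 : {linear T -> R}) by exact: cst_continuous.
have E : F \o shift u = cst (F u) + (\0 : {linear T -> R}) +o_ 0 id.
  have H : \forall h \near (0 : T), F (h + u) = 0.
    by move: F0; rewrite (near_shift (0 : T) u) subr0.
  apply/eqaddoP => _ /posnumP[e]; near=> h.
  rewrite !fctE /= Fu addr0 subr0 (_ : F (h + u) = 0) ?normr0 ?mulr_ge0 //.
  by near: h.
by apply/diff_locallyP; rewrite (diff_unique z0 E).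
Unshelve. all: by end_near. Qed.

Lemma differentiable_near_eq F G u : (\forall w \near u, F w = G w) ->
  differentiable F u -> differentiable G u.
Proof.
move=> FG dF; have -> : G = F + (G - F) by rewrite addrC subrK.
apply: differentiableD => //; apply: differentiable_near0.
by apply: filterS FG => w FGw; rewrite !fctE FGw subrr.
Qed.

(** As [U] is open, agreement on [U] is agreement of germs, which passes to the partial derivatives
    in the induction. *)
Lemma Ck_ext k U F G : open U -> (forall w, U w -> F w = G w) -> Ck k U F -> Ck k U G.
Proof.
move=> oU; elim: k F G => [|k IH] F G FG /=.
  move=> FU u Uu; have E := near_open_eq oU FG Uu.
  rewrite /prop_for /continuous_at -(FG u Uu); apply: cvg_trans (FU u Uu).
  exact: near_eq_cvg E.
move=> [dF DF]; split=> [u Uu|j].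
  exact: differentiable_near_eq (near_open_eq oU FG Uu) (dF u Uu).
apply: (IH _ _ _ (DF j)) => w Uw.
exact: near_eq_derive (near_open_eq oU FG Uw).
Qed.

Lemma CkS k U F : Ck k.+1 U F -> Ck k U F.
Proof.
elim: k F => [|k IH] F [dF DF].
  by move=> u Uu; exact/differentiable_continuous/dF.
by split=> // j; exact/IH/DF.
Qed.

Lemma Ck_cst k U (a : R) : Ck k U (fun=> a).
Proof.
elim: k a => [|k IH] a /=; first by move=> u _; exact: cst_continuous.
split=> [u _|j]; first exact: differentiable_cst.
have -> : (fun u => 'D_(e_ j) (fun=> a) u) = (fun=> 0 : R) :> (T -> R).
  by apply/funext => u; rewrite derive_cst.
exact: IH.
Qed.

Lemma CkD k U F G : open U -> Ck k U F -> Ck k U G -> Ck k U (fun u => F u + G u).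
Proof.
move=> oU; elim: k F G => [|k IH] F G /=.
  by move=> FU GU u Uu; apply: continuousD; [exact: FU|exact: GU].
move=> [dF DF] [dG DG]; split=> [u Uu|j].
  by apply: differentiableD; [exact: dF|exact: dG].
apply: (Ck_ext oU _ (IH _ _ (DF j) (DG j))) => w Uw; rewrite /=.
by rewrite -deriveD //; apply: diff_derivable; [exact: dF|exact: dG].
Qed.

Lemma CkM k U F G : open U -> Ck k U F -> Ck k U G -> Ck k U (fun u => F u * G u).
Proof.
move=> oU; elim: k F G => [|k IH] F G.
  by move=> FU GU u Uu; apply: continuousM; [exact: FU|exact: GU].
move=> FU GU; have [FU' GU'] := (CkS FU, CkS GU).
case: FU GU => [dF DF] [dG DG]; split=> [u Uu|j].
  by apply: differentiableM; [exact: dF|exact: dG].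
apply: (Ck_ext oU _ (CkD oU (IH _ _ FU' (DG j)) (IH _ _ GU' (DF j)))) => w Uw /=.
rewrite (@deriveM _ _ F G w (e_ j)) //.
  by apply: diff_derivable; exact: dF.
by apply: diff_derivable; exact: dG.
Qed.

Lemma CkV k U F : open U -> (forall u, U u -> F u != 0) -> Ck k U F ->
  Ck k U (fun u => (F u)^-1).
Proof.
move=> oU F0; elim: k => [|k IH] FU.
  by move=> u Uu; apply: continuousV; [exact: F0|exact: FU].
have FV := IH (CkS FU); case: FU => dF DF; split=> [u Uu|j].
  by apply: differentiableV; [exact: dF|exact: F0].
have := CkM oU (Ck_cst k U (-1)) (CkM oU (CkM oU FV FV) (DF j)).
apply: (Ck_ext oU) => w Uw /=; rewrite deriveV ?F0 //; last first.
  by apply: diff_derivable; exact: dF.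
by rewrite mulN1r expr2 invfM /GRing.scale /= mulNr.
Qed.

Lemma derive_sum_coord F (u v : T) : differentiable F u ->
  'D_v F u = \sum_j v 0 j * 'D_(e_ j) F u.
Proof.
move=> dF; rewrite deriveE // {1}(row_sum_delta v) linear_sum.
by apply: eq_bigr => j _; rewrite linearZ /= deriveE.
Qed.

Lemma is_derive_line F (u v : T) (t : R) : differentiable F (u + t *: v) ->
  is_derive t 1 (fun s : R => F (u + s *: v))
    (\sum_j v 0 j * 'D_(e_ j) F (u + t *: v)).
Proof.
move=> dF; rewrite -derive_sum_coord //.
have dl : is_diff t (fun s : R => u + s *: v) (fun s => s *: v).
  have l1 : is_diff t ( *:%R^~ v) ( *:%R^~ v) by exact: is_diff_scalel.
  have := is_diffD (is_diff_cst u t) l1.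
  by rewrite add0r.
have [d1 d2] : is_diff t (F \o (fun s : R => u + s *: v))
    ('d F (u + t *: v) \o (fun s => s *: v)).
  by apply: is_diff_comp => //; exact: differentiableP.
apply: DeriveDef; first exact: diff_derivable.
by rewrite deriveE // d2 /= scale1r -deriveE.
Qed.

Lemma ball_segment (u0 u v : T) (d t : R) : ball u0 d u -> ball u0 d v ->
  0 <= t <= 1 -> ball u0 d (u + t *: (v - u)).
Proof.
rewrite -!ball_normE /= => ud vd /andP[t0 t1].
have -> : u0 - (u + t *: (v - u)) = (1 - t) *: (u0 - u) + t *: (u0 - v).
  by rewrite scalerBl scale1r !scalerBr !opprD !opprK; move: (t *: u0) (t *: u) (t *: v)
    => a b c; rewrite !addrA; apply/rowP => i; rewrite !mxE; ring.
apply: (le_lt_trans (ler_normD _ _)); rewrite !normrZ.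
rewrite (ger0_norm t0) ger0_norm ?subr_ge0 //.
(* For [t > 0] the strict inequality comes from the summand with the factor [t]. *)
have [->|t_n0] := eqVneq t 0; first by rewrite subr0 mul1r mul0r addr0.
have tp : 0 < t by rewrite lt_def t_n0.
have -> : d = (1 - t) * d + t * d by rewrite -mulrDl subrK mul1r.
apply: ler_ltD; last by rewrite ltr_pM2l.
by rewrite ler_wpM2l ?subr_ge0 // ltW.
Qed.

Lemma norm_coord_le (u : T) j : `|u 0 j| <= `|u|.
Proof. by rewrite [leRHS]mx_normrE; apply: le_bigmax (0, j). Qed.

End PlaneCalculus.

Section SurfaceCalculus.
Context {R : realType} {M : surface R}.
Implicit Types (U : set M) (F G : M -> R) (c : chart R M) (x : M).
Local Notation e_ j := (delta_mx 0 j : 'rV[R]_2).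

Lemma chart_image_open c U : atlas c -> open U -> open (cmap c @` (U `&` cdom c)).
Proof.
move=> ac oU; have [od oi K _ ci] := atlas_chart ac.
have -> : cmap c @` (U `&` cdom c) = (cmap c @` cdom c) `&` cinv c @^-1` U.
  apply/seteqP; split=> [_ [x [Ux dx] <-]|_ [[x dx <-]]] /=.
    by split; [exists x|rewrite /preimage /= K].
  by rewrite /preimage /= K // => Ux; exists x.
by move: ci; rewrite continuous_open_subspace // => /continuous_inP; apply.
Qed.

Lemma chart_nbhs c x (V : set 'rV[R]_2) : atlas c -> cdom c x ->
  nbhs (cmap c x) V -> nbhs x (cdom c `&` cmap c @^-1` V).
Proof.
move=> ac dx nV; have [od oi K cm _] := atlas_chart ac.
apply: filterI; first exact: open_nbhs_nbhs.
move: cm; rewrite continuous_open_subspace // => /(_ x); rewrite inE => /(_ dx).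
by move=> /(_ _ nV).
Qed.

Lemma chart_cancel c u : atlas c -> (cmap c @` cdom c) u ->
  cdom c (cinv c u) /\ cmap c (cinv c u) = u.
Proof. by move=> ac [x dx <-]; have [_ _ K _ _] := atlas_chart ac; rewrite K. Qed.

Lemma cinv_continuous_at c u : atlas c -> (cmap c @` cdom c) u ->
  {for u, continuous (cinv c)}.
Proof.
move=> ac du; have [_ oi _ _ ci] := atlas_chart ac.
by move: ci; rewrite continuous_open_subspace // => /(_ u); rewrite inE => /(_ du).
Qed.

Lemma chart_ball c x (V : set M) : atlas c -> cdom c x -> nbhs x V ->
  exists2 d : R, 0 < d & forall u, ball (cmap c x) d u ->
    (cmap c @` cdom c) u /\ V (cinv c u).
Proof.
move=> ac dx nV; have [od oi K cm ci] := atlas_chart ac.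
have ix : (cmap c @` cdom c) (cmap c x) by exists x.
have nW : nbhs (cmap c x) (cmap c @` cdom c) by exact: open_nbhs_nbhs.
have nV' : nbhs (cmap c x) (cinv c @^-1` V).
  by apply: (cinv_continuous_at ac ix); rewrite /= K.
have [d /= d0 H] := (nbhs_ballP _ _).1 (filterI nW nV').
by exists d => // u /H.
Qed.

Lemma smooth_on_sub U (V : set M) F : V `<=` U -> smooth_on U F -> smooth_on V F.
Proof.
move=> VU sF c ac k; apply: Ck_sub (sF c ac k).
by move=> _ [x [Vx dx] <-]; exists x => //; split => //; exact: VU.
Qed.

Lemma smooth_differentiable U F c x : smooth_on U F -> atlas c -> cdom c x -> U x ->
  differentiable (F \o cinv c) (cmap c x).
Proof. by move=> sF ac dx Ux; have [dF _] := sF c ac 1; apply: dF; exists x. Qed.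

Lemma smooth_pd_continuous U F c x j : smooth_on U F -> atlas c -> cdom c x -> U x ->
  {for cmap c x, continuous (fun u => 'D_(e_ j) (F \o cinv c) u)}.
Proof. by move=> sF ac dx Ux; have [_ DF] := sF c ac 1; apply: (DF j); exists x. Qed.

Lemma smooth_continuous U F x : smooth_on U F -> U x -> {for x, continuous F}.
Proof.
move=> sF Ux; have [c ac dx] := atlas_cover x.
have [od oi K cm ci] := atlas_chart ac.
have cF := differentiable_continuous (smooth_differentiable sF ac dx Ux).
have cc : {for x, continuous (cmap c)}.
  by move: cm; rewrite continuous_open_subspace // => /(_ x); rewrite inE; apply.
have := continuous_comp cc cF; rewrite /prop_for /continuous_at /= K //.
apply: cvg_trans; apply: near_eq_cvg.
by apply: filterS (open_nbhs_nbhs (conj od dx)) => y dy /=; rewrite K.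
Qed.

Lemma smooth_on_cst U (a : R) : smooth_on U (fun=> a).
Proof. by move=> c ac k; exact: Ck_cst. Qed.

Lemma smooth_onD U F G : open U -> smooth_on U F -> smooth_on U G ->
  smooth_on U (fun x => F x + G x).
Proof.
move=> oU sF sG c ac k.
exact: (CkD (chart_image_open ac oU) (sF c ac k) (sG c ac k)).
Qed.

Lemma smooth_onM U F G : open U -> smooth_on U F -> smooth_on U G ->
  smooth_on U (fun x => F x * G x).
Proof.
move=> oU sF sG c ac k.
exact: (CkM (chart_image_open ac oU) (sF c ac k) (sG c ac k)).
Qed.

Lemma smooth_onV U F : open U -> (forall x, U x -> F x != 0) -> smooth_on U F ->
  smooth_on U (fun x => (F x)^-1).
Proof.
move=> oU F0 sF c ac k.
apply: (CkV (chart_image_open ac oU) _ (sF c ac k)).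
have [_ _ K _ _] := atlas_chart ac.
by move=> _ [x [Ux dx] <-] /=; rewrite K // F0.
Qed.

Lemma smooth_on_sum U (I : Type) (s : seq I) (F : I -> M -> R) : open U ->
  (forall i, smooth_on U (F i)) -> smooth_on U (fun x => \sum_(i <- s) F i x).
Proof.
move=> oU sF; elim: s => [|i s IH].
  by under eq_fun do rewrite big_nil; exact: smooth_on_cst.
by under eq_fun do rewrite big_cons; exact: smooth_onD.
Qed.

Section PartialDerivatives.
Variables (U : set M) (c : chart R M) (x : M) (j : 'I_2).
Hypotheses (ac : atlas c) (dx : cdom c x) (Ux : U x).

Let der F (sF : smooth_on U F) : derivable (F \o cinv c) (cmap c x) (e_ j).
Proof. exact/diff_derivable/(smooth_differentiable sF). Qed.

Lemma pd_cst (a : R) : pd c j (fun=> a) x = 0.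
Proof. exact: derive_cst. Qed.

Lemma pdD F G : smooth_on U F -> smooth_on U G ->
  pd c j (fun y => F y + G y) x = pd c j F x + pd c j G x.
Proof. by move=> sF sG; rewrite /pd -deriveD //; exact: der. Qed.

Lemma pdM F G : smooth_on U F -> smooth_on U G ->
  pd c j (fun y => F y * G y) x = F x * pd c j G x + G x * pd c j F x.
Proof.
move=> sF sG; rewrite /pd.
rewrite (@deriveM _ _ (F \o cinv c) (G \o cinv c)); [|exact: der|exact: der].
by have [_ _ K _ _] := atlas_chart ac; rewrite /= K.
Qed.

Lemma pdV F : F x != 0 -> smooth_on U F ->
  pd c j (fun y => (F y)^-1) x = - pd c j F x / F x ^+ 2.
Proof.
have [_ _ K _ _] := atlas_chart ac => F0 sF; rewrite /pd.
rewrite (@deriveV _ _ (F \o cinv c)) /= ?K //; last exact: der.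
by rewrite /GRing.scale /= mulNr mulrC mulNr.
Qed.

Lemma pdZ (a : R) F : smooth_on U F -> pd c j (fun y => a * F y) x = a * pd c j F x.
Proof.
by move=> sF; rewrite pdM // ?pd_cst ?mulr0 ?addr0 //; exact: smooth_on_cst.
Qed.

Lemma pd_sum (I : Type) (s : seq I) (F : I -> M -> R) : open U ->
  (forall i, smooth_on U (F i)) ->
  pd c j (fun y => \sum_(i <- s) F i y) x = \sum_(i <- s) pd c j (F i) x.
Proof.
move=> oU sF; elim: s => [|i s IH].
  by under eq_fun do rewrite big_nil; rewrite big_nil pd_cst.
under eq_fun do rewrite big_cons; rewrite big_cons pdD ?IH //.
exact: smooth_on_sum.
Qed.
End PartialDerivatives.

Lemma pd_line U F c (u v : 'rV[R]_2) (t : R) : smooth_on U F -> atlas c ->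
  (cmap c @` cdom c) (u + t *: v) -> U (cinv c (u + t *: v)) ->
  is_derive t 1 (fun s : R => F (cinv c (u + s *: v)))
    (\sum_j v 0 j * pd c j F (cinv c (u + t *: v))).
Proof.
move=> sF ac du Uu; have [dc E] := chart_cancel ac du.
have := smooth_differentiable sF ac dc Uu; rewrite E => dF.
by have := is_derive_line dF; rewrite /pd E.
Qed.

(** Transport of [P] inside each [V] goes both ways, so both [P] and its negation define open
    subsets of [U], and the connected set [S] cannot meet both. *)
Lemma connected_locally_constant (U S : set M) (P : M -> Prop) : connected S ->
  S `<=` U ->
  (forall x, U x -> exists V, [/\ nbhs x V, V `<=` U &
     forall y z, V y -> V z -> P y -> P z]) ->
  forall x y, S x -> S y -> P x -> P y.
Proof.
move=> cS SU PV.
have oP (b : bool) : open [set x | U x /\ (if b then P x else ~ P x)].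
  rewrite openE => x [Ux Px]; have [V [nV VU VP]] := PV x Ux.
  have Vx : V x := nbhs_singleton nV.
  apply: filterS nV => y Vy; split; first exact: VU.
  by case: b Px => [/VP|nPx /VP Py]; [apply|apply: nPx; exact: Py].
move=> x y Sx Sy Px.
have E : S `&` [set x | U x /\ P x] = S.
  apply: cS; first by exists x; split => //; split => //; exact: SU.
    by exists [set x | U x /\ P x] => //; exact: (oP true).
  exists (~` [set x | U x /\ ~ P x]); first exact/open_closedC/(oP false).
  apply/seteqP; split=> [z [Sz [Uz Pz]]|z [Sz nz]]; split => //; first by case.
  by split; [exact: SU|apply: contrapT => nP; apply: nz; split => //; exact: SU].
by move: Sy; rewrite -E => -[_ []].
Qed.

Lemma simply_connected_connected : simply_connected R M -> connected [set: M].
Proof.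
move=> [pc _]; have [[x0 _]|M0] := pselect (exists x : M, True); last first.
  by move=> B [x _]; exfalso; apply: M0; exists x.
have -> : [set: M] = \bigcup_(S in [set S : set M | connected S /\ S x0]) S.
  apply/seteqP; split=> // y _; have [g [gc g0 g1]] := pc x0 y.
  exists (g @` `[0, 1]); last by exists 1; rewrite //= in_itv /= ler01 lexx.
  split; last by exists 0; rewrite //= in_itv /= ler01 lexx.
  apply: connected_continuous_connected gc; exact: segment_connected.
apply: bigcup_connected; last by move=> S [].
by exists x0 => S [].
Qed.

(** Makes the coefficients of an equation bounded on one coordinate ball; being convex, the ball
    contains the segments along which the equation is then integrated. *)
Lemma chart_ball_bound c x (V : set M) (I : Type) (s : seq I)
    (h : I -> 'rV[R]_2 -> R) : atlas c -> cdom c x -> nbhs x V ->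
  (forall i, {for cmap c x, continuous (h i)}) ->
  exists2 K : R, 0 <= K & exists2 d : R, 0 < d & forall u, ball (cmap c x) d u ->
    [/\ (cmap c @` cdom c) u, V (cinv c u) & \sum_(i <- s) `|h i u| <= K].
Proof.
move=> ac dx nV hc; pose H u := \sum_(i <- s) `|h i u|.
have Hc : {for cmap c x, continuous H}.
  rewrite /H; elim: {H} s => [|i s IH].
    rewrite (_ : (fun=> _) = fun=> 0); last by apply/funext => u; rewrite big_nil.
    exact: cst_continuous.
  rewrite (_ : (fun=> _) = fun u => `|h i u| + \sum_(k <- s) `|h k u|); last first.
    by apply/funext => u; rewrite big_cons.
  apply: (@continuousD _ R^o); last exact: IH.
  by apply: (continuous_comp (hc i)); exact: norm_continuous.
have [d1 d10 H1] := chart_ball ac dx nV.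
have H0 : 0 <= H (cmap c x) by apply: sumr_ge0.
have nH : nbhs (cmap c x) [set u | `|H (cmap c x) - H u| <= 1].
  by move/(@cvgrPdist_le _ R^o) : Hc; apply.
have [d2 /= d20 H2] := (nbhs_ballP _ _).1 nH.
exists (H (cmap c x) + 1); first by rewrite addr_ge0.
exists (Num.min d1 d2); first by rewrite lt_min d10 d20.
move=> u ud; have [u1 u2] : ball (cmap c x) d1 u /\ ball (cmap c x) d2 u.
  by split; apply: le_ball ud; rewrite ge_min lexx ?orbT.
have [? ?] := H1 u u1; split => //.
have := H2 u u2; rewrite /= ler_norml => /andP[]; rewrite -/(H u); lra.
Qed.

End SurfaceCalculus.

(** * The extended frame *)

Section FrameDerivative.
Context {R : realType} {M : surface R} {n : nat}.
Local Notation C := R[i].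
Implicit Types (c : chart R M) (a b : 'cV[R]_n).

Definition radm a b : 'M[C]_(n + 2) := adm (cvec a) (cvec b).

(** Values of the linear map [adm] on basis vectors: expanding in them reduces smoothness,
    derivatives and bounds of [radm] to those of the coordinates. *)
Let basis_adm (e : bool) (i : 'I_n) : 'M[R]_(n + 2) :=
  if e then adm (delta_mx i 0) 0 else adm 0 (delta_mx i 0).

Lemma adm_sum a b : adm a b =
  \sum_i (a i 0 *: basis_adm true i + b i 0 *: basis_adm false i).
Proof.
have E (v : 'cV[R]_n) : v = \sum_i v i 0 *: delta_mx i 0.
  by rewrite {1}[v]matrix_sum_delta; apply: eq_bigr => i _; rewrite big_ord1.
have A0 : adm 0 0 = 0 :> 'M[R]_(n + 2) by have := admZ 0 (0 : 'cV[R]_n) 0; rewrite !scale0r.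
have S (I : Type) (s : seq I) (F G : I -> 'cV[R]_n) :
    adm (\sum_(i <- s) F i) (\sum_(i <- s) G i) = \sum_(i <- s) adm (F i) (G i).
  elim: s => [|i s IH]; first by rewrite !big_nil A0.
  by rewrite !big_cons admD IH.
rewrite {1}(E a) {1}(E b) S; apply: eq_bigr => i _.
by rewrite -!admZ -admD !scaler0 addr0 add0r.
Qed.

Lemma radm_entry a b i k : radm a b i k =
  (\sum_m (a m 0 * basis_adm true m i k + b m 0 * basis_adm false m i k))%:C.
Proof.
have -> : radm a b = map_mx (real_complex R) (adm a b).
  apply/matrixP => i' k'; rewrite /radm /adm map_block_mx !map_mx0.
  congr (block_mx _ _ _ _ _ _); apply/matrixP => s t; rewrite !mxE;
    by case: ifP => _; rewrite ?rmorphN ?rmorphM ?rmorph_nat.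
rewrite mxE adm_sum summxE; congr (_%:C); apply: eq_bigr => m _.
by rewrite !mxE.
Qed.

Lemma Re_sum (I : Type) (s : seq I) (F : I -> C) :
  complex.Re (\sum_(i <- s) F i) = \sum_(i <- s) complex.Re (F i).
Proof.
elim: s => [|i s IH]; rewrite ?big_nil // !big_cons -IH.
by case: (F i); case: (\sum_(_ <- _) _).
Qed.

Lemma Im_sum (I : Type) (s : seq I) (F : I -> C) :
  complex.Im (\sum_(i <- s) F i) = \sum_(i <- s) complex.Im (F i).
Proof.
elim: s => [|i s IH]; rewrite ?big_nil // !big_cons -IH.
by case: (F i); case: (\sum_(_ <- _) _).
Qed.

Lemma mder_line m (U : set M) (H : M -> 'M[C]_m) c (u v : 'rV[R]_2) (t : R) :
  mxsmooth_on U H -> atlas c ->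
  (cmap c @` cdom c) (u + t *: v) -> U (cinv c (u + t *: v)) ->
  mder (fun s => H (cinv c (u + s *: v))) t
    (\sum_j (v 0 j)%:C *: mxpd c j H (cinv c (u + t *: v))).
Proof.
move=> sH ac du Uu i k; have [sR sI] := sH i k.
rewrite summxE; split; rewrite ?Re_sum ?Im_sum.
  apply: is_derive_eq (pd_line sR ac du Uu) _; apply: eq_bigr => j _.
  by rewrite !mxE /= mul0r subr0.
apply: is_derive_eq (pd_line sI ac du Uu) _; apply: eq_bigr => j _.
by rewrite !mxE /= mul0r addr0.
Qed.

Lemma mxn1_sum2 m (F : 'I_2 -> 'M[C]_m) (K : R) :
  (forall j, mxn1 (F j) <= K) -> mxn1 (\sum_j F j) <= 2 * K.
Proof.
move=> FK; rewrite !big_ord_recl big_ord0 addr0; apply: le_trans (mxn1D _ _) _.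
by rewrite mulr2n mulrDl mul1r lerD.
Qed.

Section Radm.
Variables (f fc : M -> 'cV[R]_n).
Hypotheses (sf : vsmooth_on setT f) (sfc : vsmooth_on setT fc).

Lemma radm_smooth : mxsmooth_on setT (fun x => radm (f x) (fc x)).
Proof.
have oT := @openT M.
move=> i k; under eq_fun do rewrite radm_entry.
under [X in _ /\ smooth_on _ X]eq_fun do rewrite radm_entry.
split; last exact: smooth_on_cst.
apply: smooth_on_sum => // m.
by apply: smooth_onD => //; apply: smooth_onM => //;
  first [exact: sf|exact: sfc|exact: smooth_on_cst].
Qed.

Lemma mxpd_entry m c j (H : M -> 'M[C]_m) x i k : mxpd c j H x i k =
  pd c j (fun y => complex.Re (H y i k)) x +i* pd c j (fun y => complex.Im (H y i k)) x.
Proof. by rewrite mxE. Qed.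

Lemma mxpd_radm c j x : atlas c -> cdom c x ->
  mxpd c j (fun x => radm (f x) (fc x)) x = radm (vpd c j f x) (vpd c j fc x).
Proof.
move=> ac dx; apply/matrixP => i k; have oT := @openT M.
have st (b e : bool) m :
    smooth_on setT (fun x => (if b then f else fc) x m 0 * basis_adm e m i k).
  apply: smooth_onM => //; last exact: smooth_on_cst.
  by case: b; [exact: sf|exact: sfc].
apply: etrans (mxpd_entry c j (fun x => radm (f x) (fc x)) x i k) _.
apply: esym; apply: etrans (radm_entry (vpd c j f x) (vpd c j fc x) i k) _; apply: esym.
have -> : (fun y => complex.Im (radm (f y) (fc y) i k)) = fun=> 0.
  by apply/funext => y; rewrite (radm_entry (f y) (fc y) i k).
have -> : (fun y => complex.Re (radm (f y) (fc y) i k)) =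
    fun y => \sum_m (f y m 0 * basis_adm true m i k + fc y m 0 * basis_adm false m i k).
  by apply/funext => y; rewrite (radm_entry (f y) (fc y) i k).
rewrite pd_cst; congr (_ +i* _).
rewrite (pd_sum j ac dx (U := setT)) // => [|m]; last first.
  by apply: smooth_onD => //; [exact: (st true)|exact: (st false)].
apply: eq_bigr => m _.
rewrite (pdD j ac dx I (st true true m) (st false false m)).
have E (b e : bool) : pd c j (fun y => (if b then f else fc) y m 0 * basis_adm e m i k) x =
    vpd c j (if b then f else fc) x m 0 * basis_adm e m i k.
  rewrite (pdM j ac dx (U := setT)) //; last 2 first.
  - by case: b; [exact: sf|exact: sfc].
  - exact: smooth_on_cst.
  by rewrite pd_cst mulr0 add0r mulrC mxE; case: b.
by rewrite (E true true) (E false false).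
Qed.

Lemma mxn1_radm : exists2 Ka : R, 0 <= Ka & forall a b (K : R),
  (forall i, `|a i 0| <= K) -> (forall i, `|b i 0| <= K) -> mxn1 (radm a b) <= K * Ka.
Proof.
pose ka i k : R := \sum_m (`|basis_adm true m i k| + `|basis_adm false m i k|).
have ka0 i k : 0 <= ka i k by apply: sumr_ge0 => m _; rewrite addr_ge0.
exists (\sum_i \sum_k ka i k); first by do 2 apply: sumr_ge0 => ? _.
move=> a b K aK bK; rewrite mulr_sumr; apply: ler_sum => i _.
rewrite mulr_sumr; apply: ler_sum => k _; rewrite radm_entry /n1 /= normr0 addr0.
rewrite mulr_sumr; apply: le_trans (ler_norm_sum _ _ _) _; apply: ler_sum => m _.
rewrite (le_trans (ler_normD _ _)) // !normrM mulrDr.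
by apply: lerD; apply: ler_wpM2r.
Qed.

End Radm.

Section Frame.
Variables (o : M) (f fc : M -> 'cV[R]_n) (Phi : M -> C -> 'M[C]_(n + 2)).
Hypotheses (sf : vsmooth_on setT f) (sfc : vsmooth_on setT fc).
Hypothesis frame : extended_frame o f fc Phi.

Local Notation Psi x := (radm (f x) (fc x)).

Lemma frame_plus x : Gplus (Phi x). Proof. by case: frame. Qed.

Lemma frame_orthogonal x z : orthogonal_mx (Phi x z).
Proof. by have [_ + _ _ _] := frame_plus x. Qed.

Lemma frame_mxpd z c j x : atlas c -> cdom c x ->
  mxpd c j (Phi^~ z) x = z *: (Phi x z *m radm (vpd c j f x) (vpd c j fc x)).
Proof.
move=> ac dx; have [_ _ _ /(_ z c x j ac dx) H] := frame.
have E : (z%:A)%:M *m psi_mx (vpd c j f x) (vpd c j fc x) =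
    offdiag (clvec (z *: cvec (vpd c j f x))) (clvec (z *: cvec (vpd c j fc x))).
  rewrite mul_scalar_mx !clvecZ; apply/matrixP => i k; rewrite !mxE.
  by case: ifP => _; case: ifP => _; rewrite ?mulr0 // -scalerAl mul1r.
move: H; rewrite E => /acts_as_inj/(_ (acts_as_adm _ _)); rewrite admZ => {E}E.
have /orthogonalP uA := frame_orthogonal x z.
have u : Phi x z \in unitmx by case/mulmx1_unit: uA.
by rewrite scalemxAr -E mulKVmx.
Qed.

(** On the chart segment from [x] to [y] the frame solves the linear equation with parameter [z], to
    which [ode_papprox] and [ode_deriv0] apply. How short the segment must be depends on [rho], so
    each radius is propagated separately. *)
Lemma frame_step (rho : nat) (x0 : M) : (1 <= rho)%N -> exists V : set M, nbhs x0 V /\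
  forall x y : M, V x -> V y ->
    mxpapprox rho (Phi x) /\ mxderiv (Phi x) 0 (Psi x - Psi o) ->
    mxpapprox rho (Phi y) /\ mxderiv (Phi y) 0 (Psi y - Psi o).
Proof.
move=> rho1; have [c ac dx0] := atlas_cover x0.
pose h (i : bool * ('I_2 * 'I_n)) (u : 'rV[R]_2) : R :=
  'D_(delta_mx 0 i.2.1) ((fun x => (if i.1 then f else fc) x i.2.2 0) \o cinv c) u.
have hc i : {for cmap c x0, continuous (h i)}.
  case: i => [e [j m]].
  have s : smooth_on setT (fun x => (if e then f else fc) x m 0).
    by case: e; [exact: sf|exact: sfc].
  exact: (smooth_pd_continuous s ac dx0 I).
have [K K0 [d d0 Kd]] := chart_ball_bound (enum {: bool * ('I_2 * 'I_n)})
  ac dx0 (@filterT _ (nbhs x0) _) hc.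
have [Ka Ka0 KaB] := mxn1_radm.
(* [T d'] is the quantity to be kept below 1 for the ODE estimates; the 4 comes from two
   coordinates, each changing by at most [2 d'] along the segment. *)
pose T : R := 2 * (2 * rho%:R * @mxdim R (n + 2) * (4 * (K * Ka))).
have T0 : 0 <= T by rewrite /T /mxdim !mulr_ge0.
pose d' := Num.min d (T + 1)^-1.
have T1 : 0 < T + 1 by rewrite ltr_wpDl.
have d'0 : 0 < d' by rewrite lt_min d0 invr_gt0.
have [_ _ K' _ _] := atlas_chart ac.
exists (cdom c `&` cmap c @^-1` ball (cmap c x0) d'); split.
  by apply: chart_nbhs => //; apply: nbhsx_ballx.
move=> x y [dx Bx] [dy By] [Ax Dx].
pose u := cmap c x; pose v := cmap c y - cmap c x.
pose p t := cinv c (u + t *: v).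
pose B t := \sum_j (v 0 j)%:C *: radm (vpd c j f (p t)) (vpd c j fc (p t)).
have p0 : p 0 = x by rewrite /p scale0r addr0 K'.
have p1 : p 1 = y by rewrite /p scale1r /u /v addrC subrK K'.
have seg t : 0 <= t <= 1 -> ball (cmap c x0) d' (u + t *: v).
  by move=> t01; exact: ball_segment.
have seg' t : 0 <= t <= 1 -> [/\ (cmap c @` cdom c) (u + t *: v),
    cdom c (p t) & forall j m, `|vpd c j f (p t) m 0| <= K /\ `|vpd c j fc (p t) m 0| <= K].
  move=> t01; have tB : ball (cmap c x0) d (u + t *: v).
    by apply: le_ball (seg t t01); rewrite ge_min lexx.
  have [du _ hK] := Kd _ tB; have [dp E] := chart_cancel ac du.
  split=> // j m.
  have Hi (i : bool * ('I_2 * 'I_n)) : `|h i (u + t *: v)| <= K.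
    apply: le_trans hK; rewrite big_enum (bigD1 i) //= lerDl.
    exact: sumr_ge0.
  by have := Hi (true, (j, m)); have := Hi (false, (j, m)); rewrite /h /= !mxE /pd E.
have vb j : `|v 0 j| <= 2 * d'.
  apply: le_trans (norm_coord_le _ _) _; rewrite mulr2n mulrDl mul1r.
  have -> : v = (cmap c x0 - cmap c x) - (cmap c x0 - cmap c y).
    by rewrite /v opprB [RHS]addrC addrA subrK.
  rewrite (le_trans (ler_normB _ _)) //.
  by move: Bx By; rewrite /= -ball_normE /= => bx by_; apply: lerD; apply: ltW.
have FB z t : `|z| <= rho%:R -> 0 <= t <= 1 ->
    mder (fun t => Phi (p t) z) t (z *: (Phi (p t) z *m B t)).
  move=> _ t01; have [du dp _] := seg' t t01.
  have [_ sPhi _ _] := frame.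
  have := mder_line (sPhi z) ac du I; congr (mder _ _ _).
  rewrite /B mulmx_sumr scaler_sumr; apply: eq_bigr => j _.
  by rewrite frame_mxpd // -scalemxAr !scalerA mulrC.
have PsiB t : 0 <= t <= 1 -> mder (fun t => Psi (p t)) t (B t).
  move=> t01; have [du dp _] := seg' t t01.
  have := mder_line (radm_smooth sf sfc) ac du I; congr (mder _ _ _).
  by apply: eq_bigr => j _; rewrite mxpd_radm.
have c0 : 0 <= 4 * d' * (K * Ka) by rewrite !mulr_ge0 // ltW.
have Bc t : 0 <= t <= 1 -> mxn1 (B t) <= 4 * d' * (K * Ka).
  move=> t01; have [_ _ vK] := seg' t t01.
  have -> : 4 * d' * (K * Ka) = 2 * (2 * d' * (K * Ka)) by ring.
  apply: mxn1_sum2 => j.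
  apply: le_trans (mxn1Z _ _) _; apply: ler_pM; rewrite ?n1_ge0 ?mxn1_ge0 //.
    by rewrite /n1 /= normr0 addr0.
  by apply: KaB => m; case: (vK j m).
have q1 : 2 * (2 * rho%:R * @mxdim R (n + 2) * (4 * d' * (K * Ka))) <= 1.
  have -> : 2 * (2 * rho%:R * @mxdim R (n + 2) * (4 * d' * (K * Ka))) = T * d'.
    by rewrite /T; ring.
  have d'T : d' <= (T + 1)^-1 by rewrite ge_min lexx orbT.
  apply: le_trans (ler_wpM2l T0 d'T) _; rewrite ler_pdivrMr // mul1r; lra.
have A1 := ode_papprox c0 FB PsiB Bc q1.
have D1 := ode_deriv0 c0 FB PsiB Bc q1.
move: A1 D1; rewrite p0 p1 => A1 D1; split; first exact: A1.
have [_ _ P0 _ _] := frame_plus x.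
have := D1 _ rho1 Ax P0 Dx; congr (mxderiv _ _ _).
by rewrite [LHS]addrC addrA subrK.
Qed.

Hypothesis connected_surface : connected [set: M].

Lemma frame_local (rho : nat) x : (1 <= rho)%N ->
  mxpapprox rho (Phi x) /\ mxderiv (Phi x) 0 (Psi x - Psi o).
Proof.
move=> rho1; have [_ _ Phio _] := frame.
have Phi1 : Phi o = fun=> 1%:M by apply/funext.
pose P x := mxpapprox rho (Phi x) /\ mxderiv (Phi x) 0 (Psi x - Psi o).
apply: (@connected_locally_constant _ _ setT setT P connected_surface _ _ o x) => //.
  move=> y _; have [V [nV VP]] := frame_step y rho1.
  by exists V; split=> // *; apply: VP; eassumption.
rewrite /P subrr Phi1; split; last exact: mxderiv_cst.
by apply/mxpapproxP => i j; exact: papprox_cst.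
Qed.

Lemma frame_entire x : mxentire (Phi x).
Proof.
move=> i j m; have [/mxpapproxP/(_ i j) H _] := frame_local (rho := m.+1) x isT.
move=> e /H[P PE]; exists P => z zm; apply: PE.
by rewrite (le_trans zm) // ler_nat.
Qed.

Lemma frame_deriv0 x : mxderiv (Phi x) 0 (Psi x - Psi o).
Proof. by have [] := frame_local (rho := 1) x isT. Qed.

End Frame.
End FrameDerivative.

(** * Null vectors and real forms *)

Section NullVectors.
Context {K : numFieldType} {n : nat}.
Implicit Types (y g : 'cV[K]_n) (alpha mu nu s r : K).

(** This is the term by which dressing changes psi. With [g = y / nu], the relation [(y, y) = mu nu]
    makes [- y / (alpha^2 mu)] the Clifford inverse of [alpha^2 g]. *)
Lemma projections_adm alpha y mu nu : alpha != 0 -> mu != 0 -> nu != 0 ->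
  dot y y = mu * nu ->
  let l := lvec y (alpha * mu) (alpha^-1 * nu) in
  (2 / alpha) *: (projp l - projm l) =
  adm (nu^-1 *: y) ((- (alpha ^+ 2 * mu))^-1 *: y).
Proof.
move=> a0 m0 v0 yy /=; apply: mulmx_lvec_ext => x m v.
have two0 : (2 : K) != 0 by rewrite pnatr_eq0.
rewrite -scalemxAl mulmxDl mulNmx projp_mul projm_mul adm_lvec rho_lvec.
rewrite !lform_lvec !lvecZ -[- lvec _ _ _]scaleN1r !lvecZ lvecD lvecZ yy !dotE.
have -> : mu * nu - (alpha * mu * - (alpha^-1 * nu) +
    alpha^-1 * nu * - (alpha * mu)) / 2 = 2 * mu * nu by field.
congr lvec.
- by apply/colP => i; rewrite !mxE; field; rewrite ?a0 ?m0 ?v0 ?two0 ?oppr_eq0 ?mulf_neq0.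
- by field; rewrite ?a0 ?m0 ?v0 ?two0.
- by field; rewrite ?a0 ?m0 ?v0 ?two0 ?oppr_eq0 ?mulf_neq0.
Qed.

Lemma clvec_inv r g s : r * s * dot g g = -1 -> (r *: clvec g)^-1 = clvec (s *: g).
Proof.
move=> E; have rs : (r *: clvec g) * clvec (s *: g) = 1.
  by rewrite clvecZ -scalerAl -scalerAr clvec_sq !scalerA mulrN E opprK scale1r.
have sr : clvec (s *: g) * (r *: clvec g) = 1.
  rewrite clvecZ -scalerAl -scalerAr clvec_sq !scalerA mulrN [s * r]mulrC E.
  by rewrite opprK scale1r.
have u : r *: clvec g \is a GRing.unit by apply/unitrP; exists (clvec (s *: g)).
by rewrite -[LHS]mulr1 -rs mulKr.
Qed.

End NullVectors.

Section RealForm.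
Context {R : realType} {n : nat}.
Local Notation C := R[i].
Variables (alpha : C) (r : R).
Hypotheses (alpha0 : alpha != 0) (alpha2 : alpha ^+ 2 = r%:C).
Implicit Types (y u x : 'cV[R]_n) (mu nu : R) (w l : 'cV[C]_(n + 2)).

(* The real form of C^(n+2) attached to alpha: R^(n+1,1) if alpha ^ 2 > 0, and
   R^n + i R^(1,1) if alpha ^ 2 < 0. *)
Definition emb y mu nu : 'cV[C]_(n + 2) :=
  lvec (cvec y) (alpha * mu%:C) (alpha^-1 * nu%:C).

Lemma cvecZ (t : R) y : cvec (t *: y) = t%:C *: cvec y.
Proof. by rewrite /cvec map_mxZ. Qed.

Lemma cvecD y x : cvec (y + x) = cvec y + cvec x.
Proof. by rewrite /cvec map_mxD. Qed.

Lemma dot_cvec x y : dot (cvec x) (cvec y) = (dot x y)%:C.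
Proof.
by rewrite /dot rmorph_sum; apply: eq_bigr => i _; rewrite !mxE rmorphM.
Qed.

Lemma alpha2_neq0 : r != 0.
Proof.
by apply: contraNneq (expf_neq0 2 alpha0) => r0; rewrite alpha2 r0.
Qed.

Lemma conj_real (t : R) : Num.conj (t%:C) = t%:C.
Proof. by exact: conjc_real. Qed.

Lemma conj_alpha : Num.conj alpha = alpha \/ Num.conj alpha = - alpha.
Proof.
have /eqP : Num.conj alpha ^+ 2 = alpha ^+ 2 by rewrite -rmorphXn /= alpha2 conj_real.
by rewrite eqf_sqr => /orP[]/eqP; [left|right].
Qed.

Lemma lform_emb y mu nu x mu' nu' :
  lform (emb y mu nu) (emb x mu' nu') = (dot y x - (mu * nu' + nu * mu') / 2)%:C.
Proof.
rewrite lform_lvec dot_cvec rmorphB fmorph_div rmorphD !rmorphM rmorph_nat /=.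
congr (_ - _ / _).
transitivity (alpha / alpha * (mu%:C * nu'%:C + nu%:C * mu'%:C)); first by field.
by rewrite divff // mul1r.
Qed.

Lemma rho_emb y mu nu : rho *m emb y mu nu = emb y (- mu) (- nu).
Proof. by rewrite rho_lvec /emb !rmorphN /= !mulrN. Qed.

Lemma conj_lvec (x : 'cV[C]_n) (mu nu : C) : map_mx Num.conj (lvec x mu nu) =
  lvec (map_mx Num.conj x) (Num.conj mu) (Num.conj nu).
Proof.
rewrite /lvec map_col_mx; congr col_mx; apply/colP => i; rewrite !mxE.
by case: ifP.
Qed.

Lemma conj_cvec y : map_mx Num.conj (cvec y) = cvec y.
Proof. by apply/colP => i; rewrite !mxE conj_real. Qed.

Lemma conj_fixed (z : C) : Num.conj z = z -> z = (complex.Re z)%:C.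
Proof. by move=> zz; rewrite RRe_real //; apply/CrealP. Qed.

Lemma reality_emb y mu nu : reality alpha (emb y mu nu).
Proof.
case: conj_alpha => aE; [left|right]; split=> //.
  by rewrite conj_lvec conj_cvec !rmorphM fmorphV /= !conj_real aE.
by rewrite rho_emb conj_lvec conj_cvec !rmorphM fmorphV /= !conj_real aE /emb
  !rmorphN /= invrN !mulrN !mulNr.
Qed.

Lemma embP w : reality alpha w -> w = emb (\col_i complex.Re (lpart w i 0))
  (complex.Re (alpha^-1 * lmu w)) (complex.Re (alpha * lnu w)).
Proof.
move=> H; have [E1 E2 E3] : [/\ map_mx Num.conj (lpart w) = lpart w,
    Num.conj (alpha^-1 * lmu w) = alpha^-1 * lmu w &
    Num.conj (alpha * lnu w) = alpha * lnu w].
  have cw : map_mx Num.conj w = lvec (map_mx Num.conj (lpart w)) (Num.conj (lmu w))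
      (Num.conj (lnu w)) by rewrite {1}(lvecE w) conj_lvec.
  case: H => -[aE]; rewrite cw => /esym; rewrite {1}(lvecE w) ?rho_lvec;
    move=> /lvec_inj[E1 E2 E3];
    by rewrite -E1 !rmorphM fmorphV /= aE -E2 -E3 ?invrN ?mulrNN.
rewrite {1}(lvecE w) /emb; congr lvec.
- apply/colP => i; have := congr1 (fun v : 'cV[C]_n => v i 0) E1.
  by rewrite [LHS]mxE => /conj_fixed {1}->; rewrite [RHS]mxE [in RHS]mxE.
- by rewrite -(conj_fixed E2) mulVKf.
- by rewrite -(conj_fixed E3) mulKf.
Qed.

Lemma null_line_emb u : null_line (alpha *: cvec u) = <[emb u (dot u u) 1]>%VS.
Proof.
rewrite /null_line /lv0 /lvinf lvecZ !lvecD !scaler0 !addr0 mulr0 mulr1 !add0r addr0.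
rewrite !dotE dot_cvec mulrA -expr2.
have -> : lvec (alpha *: cvec u) (alpha ^+ 2 * (dot u u)%:C) 1 =
    alpha *: emb u (dot u u) 1.
  by rewrite /emb lvecZ mulrA -expr2 mulrA divff // mul1r.
apply/eqP; rewrite eqEsubv -!memvE; apply/andP; split.
  by rewrite memvZ ?memv_line.
by rewrite -[X in X \in _](scalerK alpha0) memvZ ?memv_line.
Qed.

Lemma emb0 : emb 0 0 1 = alpha^-1 *: lv0.
Proof. by rewrite /emb /lv0 lvecZ /cvec map_mx0 !mulr0 scaler0 mulr1. Qed.

Lemma lightline_reality l : lightline r l -> reality alpha l.
Proof.
move=> [_ _ rp rn _].
case: (ltgtP r 0) alpha2_neq0 => // [r0|r0] _.
  have [x [mu [nu ->]]] := rn r0; right; split.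
    case: conj_alpha => // aE; exfalso.
    have : 0 <= alpha ^+ 2 by rewrite real_exprn_even_ge0 //; apply/CrealP.
    by rewrite alpha2 ler0c leNgt r0.
  by rewrite rho_lvec conj_lvec conj_cvec !rmorphM /= !conj_real conjCi !mulNr.
have [w ->] := rp r0; left; split.
  case: conj_alpha => // aE; exfalso.
  have ai : 'i * alpha \is Num.real by apply/CrealP; rewrite rmorphM /= conjCi aE mulrNN.
  have : 0 <= ('i * alpha) ^+ 2 by rewrite real_exprn_even_ge0.
  by rewrite exprMn sqrCi mulN1r alpha2 oppr_ge0 lecR leNgt r0.
by apply/colP => i; rewrite !mxE conj_real.
Qed.

Lemma dot_neq0 y : y != 0 -> dot y y != 0.
Proof.
move=> y0; rewrite psumr_eq0 => [|i _]; last by rewrite -expr2 sqr_ge0.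
apply: contraNN y0 => /allP H; apply/eqP/colP => i; rewrite mxE; apply/eqP.
by have := H i (mem_index_enum _); rewrite mulf_eq0 orbb.
Qed.

(** If [y = 0], then [rho] acts on [l] as -1, which is excluded. So [y] is nonzero, and
    [(y, y) = mu nu] with a definite left-hand side makes [nu] nonzero: the vector can be rescaled
    to [nu = 1]. *)
Lemma lightline_emb l : lightline r l ->
  exists2 u, u != 0 & <[l]>%VS = <[emb u (dot u u) 1]>%VS.
Proof.
move=> ll; have lE := embP (lightline_reality ll).
move: lE ll; move: (\col_i _) (complex.Re _) (complex.Re _) => y nu mu ->.
move=> [_ + _ _ nr]; rewrite lform_emb => /(congr1 (@complex.Re R)) /= /eqP.
have -> : (mu * nu + nu * mu) / 2 = mu * nu by field.
rewrite subr_eq0 => /eqP yy.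
have y0 : y != 0.
  apply/eqP => y0; apply: (nr (-1)); rewrite rho_emb y0 /emb !rmorphN /= scaleN1r.
  by rewrite -scaleN1r lvecZ /cvec map_mx0 scaler0 !mulN1r !mulrN.
have yy0 := dot_neq0 y0.
have nu0 : nu != 0 by apply: contraNneq yy0 => n0; rewrite yy n0 mulr0.
exists (nu^-1 *: y); first by rewrite scaler_eq0 negb_or invr_eq0 nu0.
have -> : emb y mu nu = nu%:C *: emb (nu^-1 *: y) (dot (nu^-1 *: y) (nu^-1 *: y)) 1.
  rewrite /emb lvecZ cvecZ scalerA -rmorphM divff // scale1r; congr lvec.
    rewrite mulrCA -rmorphM !dotE yy; congr (_ * _%:C).
    by field.
  by rewrite mulr1 mulrC.
have nuC : nu%:C != 0 by rewrite fmorph_eq0.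
apply/eqP; rewrite eqEsubv -!memvE; apply/andP; split.
  by rewrite memvZ ?memv_line.
by rewrite -[X in X \in _](scalerK nuC) memvZ ?memv_line.
Qed.

Lemma lightline_neq0 l u : lightline r l -> <[l]>%VS = <[emb u (dot u u) 1]>%VS ->
  u != 0.
Proof.
move=> [l0 _ _ _ nr] E; apply/eqP => u0.
have : l \in <[emb u (dot u u) 1]>%VS by rewrite -E memv_line.
move=> /vlineP[k lk]; apply: (nr (-1)).
rewrite lk u0 dot0l emb0 /lv0 -!scalemxAr rho_lvec rmorphN /= scaleN1r -!scalerN.
by congr (_ *: (_ *: _)); rewrite -scaleN1r lvecZ scaler0 mulr0 oppr0 mulr1.
Qed.

(** Conjugating [Phi alpha *m lh = l] gives an equation at the conjugate of [alpha]. If that is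
    [- alpha], the symmetry under [rho] leads back to [alpha], and injectivity of [Phi alpha]
    determines the conjugate of [lh]. *)
Lemma frame_reality (Phi : C -> 'M[C]_(n + 2)) l lh : Gplus Phi -> reality alpha l ->
  Phi alpha *m lh = l -> reality alpha lh.
Proof.
move=> [_ oPhi _ rPhi cPhi] lr E.
have /orthogonalP K := oPhi alpha.
have inj w w' : Phi alpha *m w = Phi alpha *m w' -> w = w'.
  by move=> H; rewrite -[w]mul1mx -K -mulmxA H mulmxA K mul1mx.
have cE : Phi (Num.conj alpha) *m map_mx Num.conj lh = map_mx Num.conj l.
  by rewrite -E map_mxM -cPhi.
case: lr => -[aE lE]; [left|right]; split=> //.
  by apply: inj; rewrite E -[RHS]lE -cE aE.
have : rho *m (Phi (- alpha) *m map_mx Num.conj lh) = l.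
  by rewrite -aE cE lE mulmxA rho2 mul1mx.
rewrite -rPhi !mulmxA rho2 mul1mx -mulmxA -{1}E => /inj H.
by rewrite -[in RHS]H mulmxA rho2 mul1mx.
Qed.

End RealForm.

(** * The Riccati equation *)

Section SurfaceComponents.
Context {R : realType} {M : surface R}.
Implicit Types (c : chart R M) (U : set M).

Lemma chart_segment_connected c (u v : 'rV[R]_2) : atlas c ->
  (forall t, 0 <= t <= 1 -> (cmap c @` cdom c) (u + t *: v)) ->
  connected ((fun t : R => cinv c (u + t *: v)) @` `[0, 1]).
Proof.
move=> ac H; apply: connected_continuous_connected; first exact: segment_connected.
apply: continuous_in_subspaceT => t; rewrite inE /= in_itv /= => /H ct.
apply: (continuous_comp (f := fun t : R => u + t *: v)); last exact: cinv_continuous_at.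
by apply: continuousD; [exact: cst_continuous|exact: scalel_continuous].
Qed.

(** The surface is locally connected: a small coordinate ball lies in [U], and segments join its
    centre to its points. *)
Lemma open_connected_component U x : open U -> open (connected_component U x).
Proof.
move=> oU; rewrite openE => z Dz; have Uz := connected_component_sub Dz.
have [c ac dz] := atlas_cover z.
have [d d0 Bd] := chart_ball ac dz (open_nbhs_nbhs (conj oU Uz)).
have [_ _ K _ _] := atlas_chart ac.
apply: filterS (chart_nbhs ac dz (nbhsx_ballx (cmap c z) d d0)) => y [dy By].
apply: connected_component_trans Dz _.
pose s t := cinv c (cmap c z + t *: (cmap c y - cmap c z)).
have seg t : 0 <= t <= 1 -> ball (cmap c z) d (cmap c z + t *: (cmap c y - cmap c z)).
  by move=> t01; apply: ball_segment => //; exact: ballxx.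
apply: (@connected_component_max _ U (s @` `[0, 1])).
- by exists 0; rewrite /= ?in_itv /= ?lexx ?ler01 // /s scale0r addr0 K.
- by move=> _ [t + <-]; rewrite /= in_itv /= => /seg/Bd[].
- by apply: chart_segment_connected => // t /seg/Bd[].
- by exists 1; rewrite /= ?in_itv /= ?lexx ?ler01 // /s scale1r addrC subrK K.
Qed.

End SurfaceComponents.

Section Riccati.
Context {R : realType} {M : surface R} {n : nat}.
Implicit Types (f fc : M -> 'cV[R]_n) (r : R) (U : set M).

Lemma riccati_sub U (V : set M) r f fc g : V `<=` U ->
  riccati U r f fc g -> riccati V r f fc g.
Proof.
move=> VU [sg dg]; split=> [i|c x j ac dx Vx]; first exact: smooth_on_sub (sg i).
by apply: dg => //; exact: VU.
Qed.

(* The Riccati equation is the projectivisation of a linear system. *)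
Lemma riccati_ratio U r f fc (y : M -> 'cV[R]_n) (a b : M -> R) : open U ->
  vsmooth_on U y -> smooth_on U a ->
  (forall x, U x -> a x != 0) -> (forall x, U x -> a x * b x = - r * dot (y x) (y x)) ->
  (forall c j x, atlas c -> cdom c x -> U x ->
    vpd c j y x = - (a x *: vpd c j f x + b x *: vpd c j fc x)) ->
  (forall c j x, atlas c -> cdom c x -> U x ->
    pd c j a x = 2 * r * dot (vpd c j fc x) (y x)) ->
  riccati U r f fc (fun x => (a x)^-1 *: y x).
Proof.
move=> oU sy sa a0 ab dy da; have sV := smooth_onV oU a0 sa; split=> [i|c x j ac dx Ux].
  under eq_fun do rewrite mxE; exact: smooth_onM.
rewrite clvec_sandwich -clvecZ -clvecB; congr clvec; apply/colP => i; rewrite !mxE.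
have -> : (fun y0 => ((a y0)^-1 *: y y0) i 0) = fun z => (a z)^-1 * y z i 0.
  by apply/funext => z; rewrite mxE.
rewrite (pdM j ac dx Ux sV (sy i)) (pdV j ac dx Ux (a0 x Ux) sa) da //.
have /colP/(_ i) := dy c j x ac dx Ux; rewrite mxE => ->.
rewrite !mxE !dotE [dot (vpd _ _ _ _) _]dotC.
have ax := a0 x Ux; have abx := ab x Ux.
move: (pd c j _ x) (pd c j _ x) (dot (y x) (vpd _ _ _ _)) abx => B F d.
move: (dot (y x) (y x)) (y x i 0) => yy yi abx.
(* The relation between [a] and [b] turns the coefficient [- b / a] of dfc into [r (y, y) / a^2],
   the coefficient [r (g, g)] in the expanded sandwich product. *)
transitivity ((- (- r * yy)) / a x ^+ 2 * B - 2 * r * d * yi / a x ^+ 2 - F); last by field.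
by rewrite -abx; field.
Qed.

Lemma riccati_inverse r (y : 'cV[R]_n) (a b : R) : a != 0 -> b != 0 ->
  a * b = - r * dot y y ->
  clvec (b^-1 *: y) = (r *: clvec (a^-1 *: y))^-1.
Proof.
move=> a0 b0 ab; rewrite (@clvec_inv _ _ _ _ (a / b)) ?scalerA.
  by congr clvec; congr (_ *: _); field; rewrite a0 b0.
rewrite !dotE; transitivity (- (- r * dot y y) / (a * b)); first by field; rewrite a0 b0.
by rewrite -ab mulNr divff // mulf_neq0.
Qed.

Lemma norm_sum2 (F : 'I_2 -> R) (K : R) :
  (forall j, `|F j| <= K) -> `|\sum_j F j| <= 2 * K.
Proof.
move=> FK; rewrite !big_ord_recl big_ord0 addr0; apply: le_trans (ler_normD _ _) _.
by rewrite mulr2n mulrDl mul1r lerD.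
Qed.

Section Uniqueness.
Variables (D : set M) (r : R) (f fc g h : M -> 'cV[R]_n).
Hypotheses (oD : open D) (sfc : vsmooth_on setT fc).
Hypotheses (rg : riccati D r f fc g) (rh : riccati D r f fc h).

Let phi x := \sum_i ((g x i 0 - h x i 0) * (g x i 0 - h x i 0)).

Let sdiff i : smooth_on D (fun x => g x i 0 - h x i 0).
Proof.
have [[sg _] [sh _]] := (rg, rh).
under eq_fun do rewrite -mulN1r.
apply: smooth_onD => //; apply: smooth_onM => //; exact: smooth_on_cst.
Qed.

Let sphi : smooth_on D phi.
Proof. by apply: smooth_on_sum => // i; apply: smooth_onM. Qed.

Let phi_dot x : phi x = dot (g x - h x) (g x - h x).
Proof. by apply: eq_bigr => i _; rewrite !mxE. Qed.

Let phi0 x : phi x = 0 <-> g x = h x.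
Proof.
rewrite phi_dot; split=> [E|->]; last by rewrite subrr dot0l.
by apply/eqP; rewrite -subr_eq0; apply: contraPT E => /dot_neq0/eqP.
Qed.

(** The squared distance of two solutions satisfies a homogeneous linear equation, although the
    Riccati equation is quadratic; uniqueness is thereby reduced to the linear case. *)
Lemma riccati_difference c j x : atlas c -> cdom c x -> D x ->
  pd c j phi x = - 2 * r * dot (vpd c j fc x) (g x + h x) * phi x.
Proof.
move=> ac dx Dx; have [[sg dg] [sh dh]] := (rg, rh).
rewrite (pd_sum j ac dx Dx (index_enum _) oD) => [|i]; last exact: smooth_onM.
have E i : pd c j (fun y => g y i 0 - h y i 0) x = (vpd c j g x - vpd c j h x) i 0.
  have -> : (fun y => g y i 0 - h y i 0) = fun y => g y i 0 + -1 * h y i 0.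
    by apply/funext => y; rewrite mulN1r.
  rewrite (pdD j ac dx Dx (sg i)) ?(pdZ j ac dx Dx _ (sh i)) ?mulN1r ?mxE //.
  by apply: smooth_onM => //; exact: smooth_on_cst.
transitivity (2 * dot (g x - h x) (vpd c j g x - vpd c j h x)).
  rewrite /dot mulr_sumr; apply: eq_bigr => i _.
  rewrite (pdM j ac dx Dx (sdiff i) (sdiff i)) E !mxE.
  ring.
have V k (dk : clvec (vpd c j k x) =
    r *: (clvec (k x) * clvec (vpd c j fc x) * clvec (k x)) - clvec (vpd c j f x)) :
    vpd c j k x = r *: (dot (k x) (k x) *: vpd c j fc x -
      (2 * dot (k x) (vpd c j fc x)) *: k x) - vpd c j f x.
  by apply: clvec_inj; rewrite dk clvec_sandwich -clvecZ -clvecB.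
rewrite (V g (dg c x j ac dx Dx)) (V h (dh c x j ac dx Dx)) phi_dot.
move: (g x) (h x) (vpd c j fc x) (vpd c j f x) => G H B F.
by rewrite !dotE [dot H G]dotC [dot B G]dotC [dot B H]dotC; ring.
Qed.

(** Along a short chart segment [phi' = k phi] with [k] bounded by 1/2. If [phi] vanishes at one
    end, its maximum is at most half of itself, hence zero. *)
Lemma riccati_local x : D x -> exists V : set M, [/\ nbhs x V, V `<=` D &
  forall y z, V y -> V z -> g y = h y -> g z = h z].
Proof.
move=> Dx; have [[sg dg] [sh dh]] := (rg, rh).
have [c ac dx] := atlas_cover x; have [_ _ K' _ _] := atlas_chart ac.
pose H (i : 'I_2 * 'I_n) (u : 'rV[R]_2) : R :=
  `|'D_(delta_mx 0 i.1) ((fun x => fc x i.2 0) \o cinv c) u| *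
  `|g (cinv c u) i.2 0 + h (cinv c u) i.2 0|.
have Hc i : {for cmap c x, continuous (H i)}.
  have c1 := smooth_pd_continuous (j := i.1) (sfc i.2) ac dx I.
  have sgh : smooth_on D (fun x => g x i.2 0 + h x i.2 0) by exact: smooth_onD.
  have c2 := differentiable_continuous (smooth_differentiable sgh ac dx Dx).
  have n1 := continuous_comp c1 (@norm_continuous _ R^o _).
  have n2 := continuous_comp c2 (@norm_continuous _ R^o _).
  exact: (continuousM n1 n2).
have [K K0 [d d0 Kd]] := chart_ball_bound (enum {: 'I_2 * 'I_n}) ac dx
  (open_nbhs_nbhs (conj oD Dx)) Hc.
(* Chosen so that [T d' / 2] is the bound for [k]: two coordinates, each changing by at most [2 d'],
   times the coefficient of [riccati_difference]. *)
pose T := 8 * (2 * `|r| * K).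
have T0 : 0 <= T by rewrite !mulr_ge0.
have T1 : 0 < T + 1 by rewrite ltr_wpDl.
pose d' := Num.min d (T + 1)^-1.
have d'0 : 0 < d' by rewrite lt_min d0 invr_gt0.
have sub u : ball (cmap c x) d' u -> ball (cmap c x) d u.
  by apply: le_ball; rewrite ge_min lexx.
exists (cdom c `&` cmap c @^-1` ball (cmap c x) d'); split.
- by apply: chart_nbhs => //; exact: nbhsx_ballx.
- by move=> y [dy /sub/Kd[_ + _]]; rewrite K'.
move=> y z [dy By] [dz Bz] /phi0 Ey; apply/phi0.
pose u := cmap c y; pose v := cmap c z - cmap c y.
pose p t := cinv c (u + t *: v).
have p0 : p 0 = y by rewrite /p scale0r addr0 K'.
have p1 : p 1 = z by rewrite /p scale1r /u /v addrC subrK K'.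
have vb j : `|v 0 j| <= 2 * d'.
  apply: le_trans (norm_coord_le _ _) _; rewrite mulr2n mulrDl mul1r.
  have -> : v = (cmap c x - cmap c y) - (cmap c x - cmap c z).
    by rewrite /v opprB [RHS]addrC addrA subrK.
  rewrite (le_trans (ler_normB _ _)) //.
  by move: By Bz; rewrite /= -ball_normE /= => ? ?; apply: lerD; apply: ltW.
pose k t := \sum_j v 0 j * (- 2 * r * dot (vpd c j fc (p t)) (g (p t) + h (p t))).
have seg (t : R) : 0 <= t <= 1 -> [/\ (cmap c @` cdom c) (u + t *: v), D (p t) &
    `|k t| <= 2^-1].
  move=> t01; have [cu Dp HK] := Kd _ (sub _ (ball_segment By Bz t01)).
  split=> //; have [dp E] := chart_cancel ac cu.
  have B j : `|dot (vpd c j fc (p t)) (g (p t) + h (p t))| <= K.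
    apply: le_trans HK; rewrite big_enum /= 
      (eq_bigr (fun i => `|H (i.1, i.2) (u + t *: v)|)); last by case.
    rewrite -(pair_bigA _ (fun j i => `|H (j, i) (u + t *: v)|)) /= (bigD1 j) //=.
    rewrite -[leLHS]addr0; apply: lerD; last by do 2 apply: sumr_ge0 => ? _.
    apply: le_trans (ler_norm_sum _ _ _) _; apply: ler_sum => i _.
    rewrite [X in `|X * _|]mxE [X in `|_ * X|]mxE normrM /H [leRHS]ger0_norm ?mulr_ge0 //.
    by rewrite /pd E.
  have kB j : `|v 0 j * (- 2 * r * dot (vpd c j fc (p t)) (g (p t) + h (p t)))| <=
      2 * d' * (2 * `|r| * K).
    rewrite !normrM normrN normr_nat; apply: ler_pM; rewrite ?mulr_ge0 //.
    by apply: ler_wpM2l; rewrite ?mulr_ge0.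
  apply: le_trans (norm_sum2 kB) _.
  have -> : 2 * (2 * d' * (2 * `|r| * K)) = T * d' / 2.
    by rewrite /T; field.
  have d'T : d' <= (T + 1)^-1 by rewrite ge_min lexx orbT.
  have : T * d' <= 1.
    apply: le_trans (ler_wpM2l T0 d'T) _; rewrite ler_pdivrMr // mul1r; lra.
  lra.
have dphi (t : R) : 0 <= t <= 1 -> is_derive t 1 (phi \o p) (k t * phi (p t)).
  move=> t01; have [cu Dp _] := seg t t01; have [dp E] := chart_cancel ac cu.
  apply: is_derive_eq (pd_line sphi ac cu Dp) _.
  by rewrite /k mulr_suml; apply: eq_bigr => j _; rewrite riccati_difference // mulrA.
have ct := is_derive_segment_continuous dphi.
have [m m01 mx] := EVT_max ler01 ct.
move: m01; rewrite in_itv /= => /andP[m0 m1].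
have ph0 t : 0 <= phi (p t) by apply: sumr_ge0 => i _; rewrite -expr2 sqr_ge0.
have mx' (t : R) : 0 <= t <= 1 -> phi (p t) <= phi (p m).
  by move=> t01; apply: mx; rewrite in_itv.
have sm (t : R) : 0 <= t <= m -> 0 <= t <= 1 by move=> /andP[-> /le_trans ->].
have Bm (t : R) : 0 <= t <= m -> `|k t * phi (p t)| <= 2^-1 * phi (p m).
  move=> /sm t01; rewrite normrM (ger0_norm (ph0 t)); apply: ler_pM => //.
    by have [] := seg t t01.
  exact: mx'.
have := is_derive_segment_bound m0 (fun t tm => dphi t (sm t tm)) Bm.
rewrite /= p0 Ey !subr0 ger0_norm // => E.
have E2 : 2^-1 * phi (p m) * m <= 2^-1 * phi (p m).
  by rewrite ler_piMr // mulr_ge0.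
have := ph0 m; have := mx' 1; have := ph0 1; rewrite p1 ler01 lexx => z0 /(_ isT) zm.
lra.
Qed.

Lemma riccati_unique o : connected D -> D o -> g o = h o -> forall x, D x -> g x = h x.
Proof.
move=> cD Do Eo x Dx.
exact: (@connected_locally_constant _ _ D D (fun x => g x = h x) cD _ riccati_local o x).
Qed.

End Uniqueness.
End Riccati.

(** * Real parts of linear functionals of a matrix-valued map *)

Section LinearFunctionals.
Context {R : realType} {M : surface R}.
Local Notation C := R[i].

Lemma Re_linear m (U : set M) (H : M -> 'M[C]_m) (k : 'I_m -> 'I_m -> C) :
  open U -> mxsmooth_on U H ->
  smooth_on U (fun x => complex.Re (\sum_i \sum_j k i j * H x i j)) /\
  forall c d x, atlas c -> cdom c x -> U x ->
    pd c d (fun x => complex.Re (\sum_i \sum_j k i j * H x i j)) x =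
    complex.Re (\sum_i \sum_j k i j * mxpd c d H x i j).
Proof.
move=> oU sH.
pose F i j x := complex.Re (k i j) * complex.Re (H x i j) +
  - complex.Im (k i j) * complex.Im (H x i j).
have E (A : 'M[C]_m) : complex.Re (\sum_i \sum_j k i j * A i j) =
    \sum_i \sum_j (complex.Re (k i j) * complex.Re (A i j) +
      - complex.Im (k i j) * complex.Im (A i j)).
  rewrite Re_sum; apply: eq_bigr => i _; rewrite Re_sum; apply: eq_bigr => j _.
  by case: (k i j) => a b; case: (A i j) => a' b' /=; rewrite mulNr.
have -> : (fun x => complex.Re (\sum_i \sum_j k i j * H x i j)) =
    fun x => \sum_i \sum_j F i j x by apply/funext => x; rewrite E.
have sZ (a : R) G : smooth_on U G -> smooth_on U (fun x => a * G x).
  by move=> sG; apply: smooth_onM => //; exact: smooth_on_cst.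
have sF i j : smooth_on U (F i j).
  by have [s1 s2] := sH i j; apply: smooth_onD => //; exact: sZ.
have sF' i : smooth_on U (fun x => \sum_j F i j x) by apply: smooth_on_sum.
split=> [|c d x ac dx Ux]; first exact: smooth_on_sum.
rewrite E (pd_sum d ac dx Ux _ oU) //; apply: eq_bigr => i _.
rewrite (pd_sum d ac dx Ux _ oU) //; apply: eq_bigr => j _.
have [s1 s2] := sH i j.
rewrite (pdD d ac dx Ux (sZ _ _ s1) (sZ _ _ s2)).
by rewrite (pdZ d ac dx Ux _ s1) (pdZ d ac dx Ux _ s2) mxpd_entry.
Qed.

Lemma lform_functional n (A : 'M[C]_(n + 2)) w l :
  lform (A *m w) l = \sum_i \sum_j (w j 0 * (gram *m l) i 0) * A i j.
Proof.
rewrite lformE -mulmxA mxE; apply: eq_bigr => i _.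
rewrite [X in X * _]mxE [X in X * _]mxE mulr_suml; apply: eq_bigr => j _.
by rewrite mulrC mulrA mulrAC [_ * w j 0]mulrC.
Qed.

Lemma lform_smooth n (U : set M) (H : M -> 'M[C]_(n + 2)) w l :
  open U -> mxsmooth_on U H ->
  smooth_on U (fun x => complex.Re (lform (H x *m w) l)) /\
  forall c j x, atlas c -> cdom c x -> U x ->
    pd c j (fun x => complex.Re (lform (H x *m w) l)) x =
    complex.Re (lform (mxpd c j H x *m w) l).
Proof.
move=> oU sH.
have [s1 s2] := Re_linear (fun i j => w j 0 * (gram *m l) i 0) oU sH.
have E : (fun x => complex.Re (lform (H x *m w) l)) =
    fun x => complex.Re (\sum_i \sum_j (w j 0 * (gram *m l) i 0) * H x i j).
  by apply/funext => x; rewrite lform_functional.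
by rewrite E; split=> // c j x ac dx Ux; rewrite s2 // lform_functional.
Qed.

End LinearFunctionals.

(** * Dressing by a simple factor *)

Section Pullback.
Context {R : realType} {M : surface R} {n : nat}.
Local Notation C := R[i].
Variables (o : M) (f fc : M -> 'cV[R]_n) (Phi : M -> C -> 'M[C]_(n + 2)).
Variables (alpha : C) (r : R) (u : 'cV[R]_n).
Hypotheses (sf : vsmooth_on setT f) (sfc : vsmooth_on setT fc).
Hypothesis frame : extended_frame o f fc Phi.
Hypotheses (alpha0 : alpha != 0) (alpha2 : alpha ^+ 2 = r%:C) (u0 : u != 0).

Let l := emb alpha u (dot u u) 1.
(* This is Phi^-1 l at lambda = alpha: it spans the line of the simple factor on
   the right of the factorisation. *)
Definition pullback x : 'cV[C]_(n + 2) := adj (Phi x alpha) *m l.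

Definition pull_vec x : 'cV[R]_n := \col_i complex.Re (lpart (pullback x) i 0).
Definition pull_mu x : R := complex.Re (alpha^-1 * lmu (pullback x)).
Definition pull_nu x : R := complex.Re (alpha * lnu (pullback x)).

Lemma pullbackE x : pullback x = emb alpha (pull_vec x) (pull_mu x) (pull_nu x).
Proof.
have K : Phi x alpha *m pullback x = l.
  by rewrite mulmxA (orthogonal_adjr (frame_orthogonal frame x alpha)) mul1mx.
apply: (embP alpha0); apply: (frame_reality (frame_plus frame x) _ K).
exact: (reality_emb alpha2).
Qed.

Lemma frame_pullback x : Phi x alpha *m pullback x = l.
Proof.
by rewrite mulmxA (orthogonal_adjr (frame_orthogonal frame x alpha)) mul1mx.
Qed.

Lemma pull_null x : dot (pull_vec x) (pull_vec x) = pull_mu x * pull_nu x.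
Proof.
have : lform (pullback x) (pullback x) = 0.
  have oP := frame_orthogonal frame x alpha.
  rewrite -oP frame_pullback (lform_emb alpha0).
  by rewrite mul1r mulr1 -mulr2n -[_ *+ 2]mulr_natr mulfK ?pnatr_eq0 ?subrr.
rewrite pullbackE (lform_emb alpha0) => /(congr1 (@complex.Re R)) /= /eqP.
have -> : forall a b : R, (a * b + b * a) / 2 = a * b by move=> a b; field.
by rewrite subr_eq0 => /eqP.
Qed.

Lemma lform_pullback x w : lform w (pullback x) = lform (Phi x alpha *m w) l.
Proof. by rewrite /pullback lform_adj. Qed.

Lemma dot_delta (x : 'cV[C]_n) i : dot x (delta_mx i 0) = x i 0.
Proof.
rewrite /dot (bigD1 i) //= big1 ?addr0 => [|j /negPf ji]; rewrite mxE ?ji ?mulr0 //.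
by rewrite !eqxx mulr1.
Qed.

(** Pairing with a fixed vector and moving the adjoint across the form exhibits each coordinate as
    the real part of a linear functional of the frame, from which smoothness and derivatives are
    inherited. *)
Lemma pull_vecE i : (fun x => pull_vec x i 0) =
  fun x => complex.Re (lform (Phi x alpha *m lvec (delta_mx i 0) 0 0) l).
Proof.
apply/funext => x.
rewrite -lform_pullback [in RHS](lvecE (pullback x)) lform_lvec !mul0r addr0 mul0r subr0.
by rewrite mxE dotC dot_delta.
Qed.

(** The factor -2 undoes the -1/2 with which the form pairs the coordinates mu and nu; the power of
    [alpha] is the scaling in [emb]. *)
Lemma pull_muE : pull_mu =
  fun x => complex.Re (lform (Phi x alpha *m lvec 0 0 (- 2 / alpha)) l).
Proof.
apply/funext => x.
rewrite -lform_pullback [in RHS](lvecE (pullback x)) lform_lvec dot0l.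
by congr complex.Re; field.
Qed.

Lemma pull_nuE : pull_nu =
  fun x => complex.Re (lform (Phi x alpha *m lvec 0 (- 2 * alpha) 0) l).
Proof.
apply/funext => x.
rewrite -lform_pullback [in RHS](lvecE (pullback x)) lform_lvec dot0l.
by congr complex.Re; field.
Qed.

Let functional w := lform_smooth w l (@openT M) (let: And4 _ s _ _ := frame in s alpha).

Lemma pull_vec_smooth : vsmooth_on setT pull_vec.
Proof. by move=> i; rewrite pull_vecE; have [] := functional (lvec (delta_mx i 0) 0 0). Qed.

Lemma pull_mu_smooth : smooth_on setT pull_mu.
Proof. by rewrite pull_muE; have [] := functional (lvec 0 0 (- 2 / alpha)). Qed.

Lemma pull_nu_smooth : smooth_on setT pull_nu.
Proof. by rewrite pull_nuE; have [] := functional (lvec 0 (- 2 * alpha) 0). Qed.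

Lemma pd_functional w c j x : atlas c -> cdom c x ->
  pd c j (fun x => complex.Re (lform (Phi x alpha *m w) l)) x =
  complex.Re (alpha * lform (radm (vpd c j f x) (vpd c j fc x) *m w)
    (emb alpha (pull_vec x) (pull_mu x) (pull_nu x))).
Proof.
move=> ac dx; have [_ ->] := functional w; rewrite // (frame_mxpd frame) //.
by rewrite -scalemxAl lformZl -mulmxA -lform_pullback pullbackE.
Qed.

Lemma pd_pull_nu c j x : atlas c -> cdom c x ->
  pd c j pull_nu x = 2 * r * dot (vpd c j fc x) (pull_vec x).
Proof.
move=> ac dx; rewrite {1}pull_nuE pd_functional // /radm adm_lvec lform_lvec.
rewrite !dotE !dot_cvec.
rewrite [X in complex.Re X](_ : _ = (2 * r * dot (vpd c j fc x) (pull_vec x))%:C) //.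
by rewrite !rmorphM rmorph_nat /= -alpha2; field.
Qed.

Lemma pd_pull_mu c j x : atlas c -> cdom c x ->
  pd c j pull_mu x = - 2 * dot (vpd c j f x) (pull_vec x).
Proof.
move=> ac dx; rewrite {1}pull_muE pd_functional // /radm adm_lvec lform_lvec.
rewrite !dotE !dot_cvec.
rewrite [X in complex.Re X](_ : _ = (- 2 * dot (vpd c j f x) (pull_vec x))%:C) //.
by rewrite !rmorphM rmorphN rmorph_nat /=; field.
Qed.

Lemma vpd_pull_vec c j x : atlas c -> cdom c x -> vpd c j pull_vec x =
  - (pull_nu x *: vpd c j f x + (- r * pull_mu x) *: vpd c j fc x).
Proof.
move=> ac dx; apply/colP => i; rewrite [LHS]mxE pull_vecE pd_functional //.
rewrite /radm adm_lvec lform_lvec !scale0r subr0 dot0l !dot_delta.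
rewrite [X in complex.Re X](_ : _ = ((- (pull_nu x *: vpd c j f x +
  (- r * pull_mu x) *: vpd c j fc x)) i 0)%:C) //.
move: (vpd c j f x) (vpd c j fc x) => a b; rewrite !mxE.
by rewrite rmorphN rmorphD !rmorphM rmorphN /= -alpha2; field.
Qed.

End Pullback.

Lemma addr_shift (V : zmodType) (A B D E F : V) :
  A = B + D + E -> D = F -> A - B = F + E.
Proof. by move=> -> ->; rewrite [LHS]addrC -[B + F + E]addrA addKr. Qed.

Section OffDiagonal.
Context {K : numFieldType} {n : nat}.

Lemma acts_as_admB (a b a' b' : 'cV[K]_n) :
  acts_as (offdiag (clvec a) (clvec b) - offdiag (clvec a') (clvec b'))
    (adm a b - adm a' b').
Proof.
have -> : offdiag (clvec a) (clvec b) - offdiag (clvec a') (clvec b') =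
    offdiag (clvec (a - a')) (clvec (b - b')).
  apply/matrixP => i j; rewrite !mxE !clvecB.
  by case: ifP => _; case: ifP; rewrite ?subr0.
by rewrite -admB; exact: acts_as_adm.
Qed.

End OffDiagonal.

Section RealOffDiagonal.
Context {R : realType} {n : nat}.
Implicit Types a b : 'cV[R]_n.

Lemma radmD a b a' b' : radm (a + a') (b + b') = radm a b + radm a' b'.
Proof. by rewrite /radm !cvecD admD. Qed.

Lemma projections_radm (alpha : R[i]) (r mu nu : R) (v : 'cV[R]_n) :
  alpha != 0 -> alpha ^+ 2 = r%:C -> mu != 0 -> nu != 0 -> dot v v = mu * nu ->
  (2 / alpha) *: (projp (emb alpha v mu nu) - projm (emb alpha v mu nu)) =
  radm (nu^-1 *: v) ((- r * mu)^-1 *: v).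
Proof.
move=> alpha0 alpha2 mu0 nu0 vv.
have muC : mu%:C != 0 by rewrite fmorph_eq0.
have nuC : nu%:C != 0 by rewrite fmorph_eq0.
have vvC : dot (cvec v) (cvec v) = mu%:C * nu%:C by rewrite dot_cvec vv rmorphM.
apply: etrans (projections_adm alpha0 muC nuC vvC) _.
by rewrite /radm !cvecZ alpha2 !fmorphV /= mulNr rmorphN rmorphM.
Qed.

End RealOffDiagonal.

Section Dressing.
Context {R : realType} {M : surface R} {n : nat}.
Local Notation C := R[i].
Variables (o : M) (f fc : M -> 'cV[R]_n) (Phi : M -> C -> 'M[C]_(n + 2)).
Variables (alpha : C) (r : R) (u : 'cV[R]_n).
Hypotheses (sf : vsmooth_on setT f) (sfc : vsmooth_on setT fc).
Hypothesis frame : extended_frame o f fc Phi.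
Hypotheses (alpha0 : alpha != 0) (alpha2 : alpha ^+ 2 = r%:C) (u0 : u != 0).
Hypothesis connected_surface : connected [set: M].

Local Notation l := (emb alpha u (dot u u) 1).
Local Notation y := (pull_vec Phi alpha u).
Local Notation mu := (pull_mu Phi alpha u).
Local Notation nu := (pull_nu Phi alpha u).
Local Notation Omega := (sharp_domain (sfactor alpha l) Phi).

Definition darboux x : 'cV[R]_n := (nu x)^-1 *: y x.
(** Equal to the Clifford inverse of [r] times [darboux], but written as a ratio of solutions of the
    linear system, so that [riccati_ratio] applies to it as well. *)
Definition darboux_dual x : 'cV[R]_n := (- r * mu x)^-1 *: y x.

Let r0 : r != 0. Proof. exact: (alpha2_neq0 alpha0 alpha2). Qed.

Lemma emb_rho_form (v : 'cV[R]_n) (a b : R) : dot v v = a * b -> v != 0 ->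
  lform (emb alpha v a b) (rho *m emb alpha v a b) != 0.
Proof.
move=> E v0; rewrite rho_emb (lform_emb alpha0) fmorph_eq0.
rewrite (_ : _ - _ = 2 * dot v v); last by rewrite E; field.
by rewrite mulf_neq0 ?pnatr_eq0 ?dot_neq0.
Qed.

Let ll0 : lform l l = 0.
Proof.
rewrite (lform_emb alpha0) (_ : _ - _ = 0) //; by field.
Qed.

Let lrl : lform l (rho *m l) != 0.
Proof. by apply: emb_rho_form => //; rewrite mulr1. Qed.

Lemma pull_neq0 x : y x != 0 -> mu x != 0 /\ nu x != 0.
Proof.
move=> /dot_neq0; rewrite (pull_null u frame alpha0 alpha2).
by rewrite mulf_eq0 negb_or => /andP[].
Qed.

Lemma sharp_darboux x : y x != 0 -> exists2 hp, sharp (sfactor alpha l) (Phi x) hp &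
  Defs.deriv0 hp - Defs.deriv0 (sfactor alpha l) =
  radm (f x) (fc x) - radm (f o) (fc o) + radm (darboux x) (darboux_dual x).
Proof.
move=> y0; have [mu0 nu0] := pull_neq0 y0.
have lhE := pullbackE u frame alpha0 alpha2 x.
have lhrl : lform (pullback Phi alpha u x) (rho *m pullback Phi alpha u x) != 0.
  by rewrite lhE; apply: emb_rho_form; rewrite ?(pull_null u frame alpha0 alpha2).
have lhreal : reality alpha (pullback Phi alpha u x).
  by rewrite lhE; exact: (reality_emb alpha2).
have [hp shp hpE] := sharp_sfactor alpha0 (frame_plus frame x)
  (frame_entire sf sfc frame connected_surface x) (frame_pullback alpha u frame x)
  ll0 lrl lhrl (reality_emb alpha2 _ _ _) lhreal.
exists hp; first exact: shp.
rewrite -(projections_radm alpha0 alpha2 mu0 nu0 (pull_null u frame alpha0 alpha2 x)) -lhE.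
exact: (addr_shift hpE (deriv0_eq (frame_deriv0 sf sfc frame connected_surface x))).
Qed.

(** Where [y] vanishes, [rho] acts as -1 on the pulled back vector, and [sharp_not_stable] rules out
    a factorisation; elsewhere [sharp_darboux] provides one. *)
Lemma sharp_domainE : Omega = [set x | y x != 0].
Proof.
apply/seteqP; split=> x /=; last by move=> /sharp_darboux[hp ? _]; exists hp.
move=> [hp shp]; apply/negP => /eqP y0.
apply: (sharp_not_stable alpha0 (frame_plus frame x) (frame_pullback alpha u frame x)
  ll0 lrl _ shp).
rewrite (pullbackE u frame alpha0 alpha2) rho_emb y0 /emb !rmorphN /= !mulrN.
by rewrite -[- lvec _ _ _]scaleN1r lvecZ /cvec map_mx0 scaler0 !mulN1r.
Qed.

Lemma sharp_domain_open : open Omega.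
Proof.
have sy := pull_vec_smooth alpha u frame.
have sd : smooth_on setT (fun x => dot (y x) (y x)).
  by apply: smooth_on_sum; [exact: openT|move=> i; apply: smooth_onM => //; exact: openT].
have -> : Omega = (fun x => dot (y x) (y x)) @^-1` [set~ 0].
  rewrite sharp_domainE; apply/seteqP; split=> x /=; first by move=> /dot_neq0/eqP.
  by apply: contra_notN => /eqP ->; rewrite dot0l.
apply: open_comp => [x _|]; first exact: (smooth_continuous sd).
exact/closed_openC/accessible_closed_set1/hausdorff_accessible/norm_hausdorff.
Qed.

Let Omega_neq0 x : Omega x -> y x != 0. Proof. by rewrite sharp_domainE. Qed.

Lemma darboux_riccati : riccati Omega r f fc darboux.
Proof.
have T : Omega `<=` setT by [].
apply: (riccati_ratio (b := fun x => - r * mu x)); first exact: sharp_domain_open.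
- by move=> i; apply: (smooth_on_sub T); exact: (pull_vec_smooth alpha u frame i).
- by apply: (smooth_on_sub T); exact: (pull_nu_smooth alpha u frame).
- by move=> x /Omega_neq0/pull_neq0[].
- by move=> x _; rewrite (pull_null u frame alpha0 alpha2) mulrC mulrA.
- by move=> c j x ac dx _; exact: (vpd_pull_vec u frame alpha0 alpha2).
- by move=> c j x ac dx _; exact: (pd_pull_nu u frame alpha0 alpha2).
Qed.

(** The linear system for [y], [nu] and [- r mu] is unchanged when [f] is exchanged with [fc] and
    [nu] with [- r mu]. *)
Lemma darboux_dual_riccati : riccati Omega r fc f darboux_dual.
Proof.
have T : Omega `<=` setT by [].
have oT := @openT M.
have smu := pull_mu_smooth u frame alpha0.
apply: (riccati_ratio (b := nu)); first exact: sharp_domain_open.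
- by move=> i; apply: (smooth_on_sub T); exact: (pull_vec_smooth alpha u frame i).
- apply: (smooth_on_sub T); apply: smooth_onM => //; exact: smooth_on_cst.
- by move=> x /Omega_neq0/pull_neq0[mu0 _]; rewrite mulf_neq0 ?oppr_eq0.
- by move=> x _; rewrite (pull_null u frame alpha0 alpha2) mulrA.
- by move=> c j x ac dx _; rewrite addrC; exact: (vpd_pull_vec u frame alpha0 alpha2).
- move=> c j x ac dx _; rewrite (pdZ j ac dx I _ smu).
  by rewrite (pd_pull_mu u frame alpha0 alpha2) //; ring.
Qed.

Lemma base_sharp : Omega o /\ darboux o = u.
Proof.
have [_ _ Phio _] := frame.
have lE : pullback Phi alpha u o = l.
  by rewrite -[RHS](frame_pullback alpha u frame o) Phio mul1mx.
have yE : y o = u.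
  by apply/colP => i; rewrite mxE lE lpart_lvec mxE.
have nuE : nu o = 1 by rewrite /pull_nu lE lnu_lvec mulr1 divff.
by rewrite sharp_domainE /= yE /darboux nuE yE invr1 scale1r.
Qed.

Lemma darboux_dressing x : Omega x ->
  dressing (sfactor alpha l) o f fc Phi x
    (psi_mx (f x + darboux x) (fc x + darboux_dual x)).
Proof.
move=> /Omega_neq0 y0; split; first by exists (f x + darboux x), (fc x + darboux_dual x).
have [hp shp E] := sharp_darboux y0; exists hp => //; rewrite E.
rewrite addrAC -radmD; exact: acts_as_admB.
Qed.

Lemma darboux_dualE x : Omega x ->
  [/\ darboux x != 0, clvec (darboux_dual x) = (r *: clvec (darboux x))^-1 &
    (alpha ^+ 2 *: clvec (cvec (darboux x)))^-1 = clvec (cvec (darboux_dual x))].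
Proof.
move=> /Omega_neq0 y0; have [mu0 nu0] := pull_neq0 y0.
have rmu0 : - r * mu x != 0 by rewrite mulf_neq0 ?oppr_eq0.
have E : nu x * (- r * mu x) = - r * dot (y x) (y x).
  by rewrite (pull_null u frame alpha0 alpha2) mulrC mulrA.
have dE : darboux_dual x = (nu x / (- r * mu x)) *: darboux x.
  by rewrite /darboux scalerA mulrAC divff // mul1r.
split; first by rewrite scaler_eq0 negb_or invr_eq0 nu0.
- exact: riccati_inverse.
rewrite dE cvecZ; apply: clvec_inv.
rewrite alpha2 dot_cvec -!rmorphM -[RHS](rmorphN1 (real_complex R)); congr (_%:C).
rewrite !dotE (pull_null u frame alpha0 alpha2).
by field; rewrite mu0 nu0 r0.
Qed.

End Dressing.

Lemma simple_factor_sfactor (R : realType) (n : nat) (alpha : R[i]) (r : R)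
    (u : 'cV[R]_n) L p :
  simple_factor alpha r L p -> L = null_line (alpha *: cvec u) ->
  u != 0 /\ p = sfactor alpha (emb alpha u (dot u u) 1).
Proof.
move=> [alpha0 alpha2 [l0 ll LE] [pip [pi0 [pim [pP ->]]]]] Lu.
rewrite (null_line_emb alpha0) in Lu.
have u0 : u != 0 by exact: (lightline_neq0 ll (etrans (esym LE) Lu)).
split=> //; apply/funext => z; apply: (projections_splitting _ _ Lu pP).
  rewrite (lform_emb alpha0) (_ : _ - _ = 0) //; by field.
by apply: emb_rho_form => //; rewrite mulr1.
Qed.

Unset Implicit Arguments.

Theorem theorem4p14 (R : realType) (n : nat) (M : surface R) (o : M)
    (f fc : M -> 'cV[R]_n) (Phi : M -> R[i] -> 'M[R[i]]_(n + 2))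
    (alpha : R[i]) (r : R) (L : {vspace 'cV[R[i]]_(n + 2)})
    (p : R[i] -> 'M[R[i]]_(n + 2)) :
  simply_connected R M ->
  christoffel_pair f fc ->
  extended_frame o f fc Phi ->
  simple_factor alpha r L p ->
  let D := connected_component (sharp_domain p Phi) o in
  (exists v : 'cV[R]_n, L = null_line (alpha *: cvec (v - f o))) /\
  forall v : 'cV[R]_n, L = null_line (alpha *: cvec (v - f o)) ->
    (exists g : M -> 'cV[R]_n, riccati D r f fc g /\ g o = v - f o) /\
    forall g : M -> 'cV[R]_n, riccati D r f fc g -> g o = v - f o ->
      (forall x, D x -> g x != 0 /\
        dressing p o f fc Phi x
          (offdiag (clvec (cvec (f x + g x)))
             (clvec (cvec (fc x)) + (alpha ^+ 2 *: clvec (cvec (g x)))^-1))) /\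
      exists2 k : M -> 'cV[R]_n, riccati D r fc f k &
        forall x, D x -> clvec (k x) = (r *: clvec (g x))^-1.
Proof.
move=> /simply_connected_connected cM [[sf _] sfc _ _] frame pS /=.
have [alpha0 alpha2 [l0 ll LE] _] := pS.
split.
  have [u _ lu] := lightline_emb alpha0 alpha2 ll; exists (u + f o).
  by rewrite addrK (null_line_emb alpha0) LE.
move=> v Lv; have [u0 pE] := simple_factor_sfactor pS Lv.
have [Oo go] := base_sharp sf sfc frame alpha0 alpha2 u0 cM.
have oO := sharp_domain_open sf sfc frame alpha0 alpha2 u0 cM.
rewrite pE; set Omega := sharp_domain _ Phi in Oo oO *.
have DO : connected_component Omega o `<=` Omega by apply: connected_component_sub.
set D := connected_component Omega o in DO *.
have rg := riccati_sub DO (darboux_riccati sf sfc frame alpha0 alpha2 u0 cM).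
have rk := riccati_sub DO (darboux_dual_riccati sf sfc frame alpha0 alpha2 u0 cM).
split; first by exists (darboux Phi alpha (v - f o)).
move=> g gr g_o.
(* The dressing is computed for the solution built from the frame; uniqueness on the component
   identifies every solution with the same initial value with it. *)
have gE : forall x, D x -> g x = darboux Phi alpha (v - f o) x.
  apply: (riccati_unique _ sfc gr rg (o := o)); first exact: open_connected_component.
  - exact: component_connected.
  - exact: connected_component_refl.
  - by rewrite g_o go.
split=> [x Dx|].
  have [g0 _ gV] := darboux_dualE sf sfc frame alpha0 alpha2 u0 cM (DO x Dx).
  rewrite gE // gV -clvecD -cvecD; split=> //.
  exact: (darboux_dressing sf sfc frame alpha0 alpha2 u0 cM (DO x Dx)).
exists (darboux_dual Phi alpha r (v - f o)) => // x Dx.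
by have [_ kE _] := darboux_dualE sf sfc frame alpha0 alpha2 u0 cM (DO x Dx); rewrite gE.
Qed.
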